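(* Let $h:\Omega\times Q\times\mathbb{R}^d\to\mathbb{R}$ be a quenched two-scale normal integrand, and let $(u_\varepsilon)$ be a bounded sequence in $(\mathscr{B}^p)^d=L^p(\Omega\times Q)^d$ that generates a Young measure $\boldsymbol{\nu}=\{\nu_\omega\}_{\omega\in\Omega}$ on $(\mathscr{B}^p)^d$. Suppose that the functions $h_\varepsilon:\Omega\to\mathbb{R}$, $h_\varepsilon(\omega):=-\int_Q\min\{0,h(\tau_{\frac{x}{\varepsilon}}\omega,x,u_\varepsilon(\omega,x))\}\,dx$, are uniformly integrable. Then $$\liminf_{\varepsilon\to0}\int_\Omega\int_Qh(\tau_{\frac{x}{\varepsilon}}\omega,x,u_\varepsilon(\omega,x))\,dx\,dP(\omega)\ \ge\ \int_\Omega\int_{(\mathscr{B}^p)^d}\Big(\int_\Omega\int_Qh(\tilde\omega,x,v(\tilde\omega,x))\,dx\,dP(\tilde\omega)\Big)d\nu_\omega(v)\,dP(\omega).$$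
   Context: Standing assumptions: $(\Omega,\mathcal{F},P)$ is a probability space with countably generated $\sigma$-algebra, and $\tau=\{\tau_x\}_{x\in\mathbb{R}^d}$ is a group of measurable bijections of $\Omega$ with $\tau_0=\mathrm{Id}$, $\tau_{x+y}=\tau_x\circ\tau_y$, $P(\tau_xA)=P(A)$ for $A\in\mathcal{F}$, and $(\omega,x)\mapsto\tau_x\omega$ is $\mathcal{F}\otimes\mathcal{L}$-measurable ($\mathcal{L}$ the Lebesgue $\sigma$-algebra on $\mathbb{R}^d$); $P$ is ergodic: every $A\in\mathcal{F}$ with $\tau_xA=A$ for all $x$ has $P(A)\in\{0,1\}$. $\langle\cdot\rangle=\int_\Omega\cdot\,dP$. $p\in(1,\infty)$, $q=\frac{p}{p-1}$, $Q\subset\mathbb{R}^d$ is open and bounded, $\mathscr{B}^r:=L^r(\Omega\times Q)$. Sequences are indexed by $\varepsilon$ ranging over a sequence of positive numbers tending to $0$. Test functions: $\mathscr{D}_\Omega$ is a fixed countable set of bounded measurable functions on $\Omega$ containing $\mathbf{1}_\Omega$ and dense in $L^1(\Omega)$; $\mathscr{D}_Q\subset C(\overline{Q})$ is a fixed countable set containing $\mathbf{1}_Q$ and dense in $L^1(Q)$. $\mathscr{A}:=\{\varphi_\Omega(\omega)\varphi_Q(x):\varphi_\Omega\in\mathscr{D}_\Omega,\varphi_Q\in\mathscr{D}_Q\}$, $\mathscr{D}_0$ is the $\mathbb{Q}$-linear span of $\mathscr{A}$, $\mathscr{D}:=\mathrm{span}\,\mathscr{A}$. For $\varphi\in\mathscr{D}$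 (and products), $(\mathcal{T}^*_\varepsilon\varphi)(\omega,x):=\varphi(\tau_{\frac{x}{\varepsilon}}\omega,x)$. $\Omega_0\subset\Omega$ is a fixed measurable set with $P(\Omega_0)=1$ such that for all $\varphi,\varphi'\in\mathscr{A}$, $\omega_0\in\Omega_0$, $r\in\{p,q\}$: $\limsup_{\varepsilon\to0}\|(\mathcal{T}^*_\varepsilon\varphi)(\omega_0,\cdot)\|_{L^r(Q)}\le\|\varphi\|_{\mathscr{B}^r}$ and $\lim_{\varepsilon\to0}\int_Q\mathcal{T}^*_\varepsilon(\varphi\varphi')(\omega_0,x)\,dx=\langle\int_Q\varphi\varphi'\,dx\rangle$. Quenched two-scale convergence: for $\omega_0\in\Omega_0$, $u_\varepsilon\overset{2s}{\rightharpoonup}_{\omega_0}u$ (with $u_\varepsilon\in L^p(Q)$, $u\in\mathscr{B}^p$; componentwise for vector fields) means that $(u_\varepsilon)$ is bounded in $L^p(Q)$ and $\lim_{\varepsilon\to0}\int_Qu_\varepsilon(x)(\mathcal{T}^*_\varepsilon\varphi)(\omega_0,x)\,dx=\int_\Omega\int_Qu\varphi\,dx\,dP$ for all $\varphi\in\mathscr{D}$. Quenched two-scale normal integrand: $h:\Omega\times Q\times\mathbb{R}^d\to\mathbb{R}$ such that $h(\cdot,\cdot,\xi)$ is measurable on $\Omega\times Q$ with respect to the product of $\mathcal{F}$ and the Borel $\sigma$-algebra for all $\xi\in\mathbb{R}^d$, $h(\omega,x,\cdot)$ is lower semicontinuous for a.e. $(\omega,x)$, and for $P$-a.e. $\omega_0\in\Omega_0$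 and every sequence $(u_\varepsilon)$ in $L^p(Q)^d$: $u_\varepsilon\overset{2s}{\rightharpoonup}_{\omega_0}u$ implies $\liminf_{\varepsilon\to0}\int_Qh(\tau_{\frac{x}{\varepsilon}}\omega_0,x,u_\varepsilon(x))\,dx\ge\int_\Omega\int_Qh(\omega,x,u(\omega,x))\,dx\,dP(\omega)$. (It is implicit that the integrals involved are well defined.) Generated Young measures. A Young measure on a separable metric space (or on $(\mathscr{B}^p)^m$ with the weak topology) is a family $\{\mu_\omega\}_{\omega\in\Omega}$ of Borel probability measures on it such that $\omega\mapsto\mu_\omega(B)$ is measurable for all Borel sets $B$. $\mathrm{Lin}(\mathscr{D})$ is the space of linear functionals on $\mathscr{D}$ with metric $d(U,V)=\sum_{j}2^{-j}\frac{|U(\varphi_j)-V(\varphi_j)|}{|U(\varphi_j)-V(\varphi_j)|+1}$, $\{\varphi_j\}$ an enumeration of $\{\varphi/\|\varphi\|_{\mathscr{B}^q}:0\ne\varphi\in\mathscr{D}_0\}$; $(J^{\omega_0}_\varepsilon u)(\varphi)=\int_Qu(x)(\mathcal{T}^*_\varepsilon\varphi)(\omega_0,x)\,dx$ for $u\in L^p(Q)$ and $(J_0u)(\varphi)=\langle\int_Qu\varphi\rangle$ for $u\in\mathscr{B}^p$ (componentwise for vector fields, with values in $\mathrm{Lin}(\mathscr{D})^m$). Let $\mathscr{M}:=\mathrm{Lin}(\mathscr{D})^m\times[0,\infty)\times[0,\infty)$ with the sum metric. A normal integrand on $\Omega\times\mathscr{M}$ is an $\mathcal{F}\otimes\mathcal{B}(\mathscr{M})$-measurable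 $H:\Omega\times\mathscr{M}\to(-\infty,\infty]$ with $H(\omega,\cdot)$ lower semicontinuous for all $\omega$. For a bounded sequence $(u_\varepsilon)$ in $(\mathscr{B}^p)^m$ put $s_\varepsilon(\omega)=(J^\omega_\varepsilon u_\varepsilon(\omega,\cdot),\varepsilon,\|u_\varepsilon(\omega,\cdot)\|_{L^p(Q)^m})$ for $\omega\in\Omega_0$ and $s_\varepsilon(\omega)=(0,0,0)$ otherwise. One says $(u_\varepsilon)$ generates the Young measure $\boldsymbol{\nu}$ on $(\mathscr{B}^p)^m$ if there is a Young measure $\boldsymbol{\mu}$ on $\mathscr{M}$ such that: (1) $\liminf_{\varepsilon\to0}\int_\Omega H(\omega,s_\varepsilon(\omega))\,dP\ge\int_\Omega\int_{\mathscr{M}}H(\omega,\xi)\,d\mu_\omega(\xi)\,dP(\omega)$ for every normal integrand $H$ for which $|\min\{0,H(\cdot,s_\varepsilon(\cdot))\}|$ is uniformly integrable; (2) for $P$-a.e. $\omega$, $\mu_\omega$ is supported in the set of cluster points of $(s_\varepsilon(\omega))$ in $\mathscr{M}$; (3) the first marginal $\mu_{1,\omega}$ of $\mu_\omega$ is concentrated on $J_0((\mathscr{B}^p)^m)$ and $\nu_\omega(B)=\mu_{1,\omega}(J_0B)$ for all Borel sets $B$. *)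

(* Defs.v *)
From HB Require Import structures.
From mathcomp Require Import all_boot all_order all_algebra.
From mathcomp Require Import all_classical all_reals all_analysis measurable_realfun.
From mathcomp Require Import ring lra.
Set Implicit Arguments.
Unset Strict Implicit.
Unset Printing Implicit Defensive.
Import Order.TTheory GRing.Theory Num.Theory.
Import numFieldNormedType.Exports.
Local Open Scope classical_set_scope.
Local Open Scope ring_scope.

Section lebesgue_outer.
Context (R : realType) (d : nat).
Local Notation V := 'rV[R]_d.
Local Open Scope ereal_scope.

Definition box (ab : V * V) : set V :=
  [set x | forall i, (ab.1 ord0 i < x ord0 i <= ab.2 ord0 i)%R].

Definition box_volume (ab : V * V) : R :=
  (\prod_i Num.max 0 (ab.2 ord0 i - ab.1 ord0 i))%R.

(* [None] stands for the empty set: for [d = 0] no box is empty. *)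
Definition obox (o : option (V * V)) : set V := oapp box set0 o.

Definition obox_volume (o : option (V * V)) : \bar R :=
  oapp (fun ab => (box_volume ab)%:E) 0 o.

Definition lebesgue_outer (A : set V) : \bar R :=
  ereal_inf [set \sum_(0 <= k <oo) obox_volume (F k) |
             F in [set F : nat -> option (V * V) | A `<=` \bigcup_k obox (F k)]].

Lemma obox_volume_ge0 o : 0 <= obox_volume o.
Proof.
case: o => [ab|//] /=; rewrite lee_fin; apply: prodr_ge0 => i _.
by rewrite le_max lexx.
Qed.

Lemma lebesgue_outer_ge0 A : 0 <= lebesgue_outer A.
Proof.
by apply: le_ereal_inf_tmp => _ [F _ <-]; apply: nneseries_ge0 => n _ _;
  exact: obox_volume_ge0.
Qed.

Lemma lebesgue_outer0 : lebesgue_outer set0 = 0.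
Proof.
apply/eqP; rewrite eq_le lebesgue_outer_ge0 andbT.
apply: ereal_inf_lbound; exists (fun=> None) => //=.
by rewrite eseries0.
Qed.

Lemma le_lebesgue_outer : {homo lebesgue_outer : A B / A `<=` B >-> A <= B}.
Proof.
move=> A B AB; apply: ereal_inf_le_tmp => _ [F BF <-].
by exists F => //; exact: subset_trans BF.
Qed.

Lemma lebesgue_outer_sigma_subadditive : sigma_subadditive lebesgue_outer.
Proof.
move=> A; have [[i ioo]|] := pselect (exists i, lebesgue_outer (A i) = +oo).
  rewrite (eseries_pinfty _ _ ioo) ?leey// => n _.
  by rewrite -ltNye (lt_le_trans _ (lebesgue_outer_ge0 _)).
rewrite -forallNE => Aoo.
apply/lee_addgt0Pr => _/posnumP[e].
rewrite (le_trans _ (epsilon_trick _ _ _))//; last first.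
  by move=> n; exact: lebesgue_outer_ge0.
pose P n (B : nat -> option (V * V)) := A n `<=` \bigcup_k obox (B k) /\
  \sum_(0 <= k <oo) obox_volume (B k)
    <= lebesgue_outer (A n) + (e%:num / (2 ^ n.+1)%:R)%:E.
have [G PG] : {G : nat -> nat -> option (V * V) & forall n, P n (G n)}.
  apply: (@choice _ _ P) => n; rewrite /P.
  have fA : lebesgue_outer (A n) \is a fin_num.
    by rewrite ge0_fin_numE ?lebesgue_outer_ge0// ltey; apply/eqP.
  have en1 : (0 < e%:num / (2 ^ n.+1)%:R :> R)%R by [].
  have [x [B AB Bx] xS] := lb_ereal_inf_adherent en1 fA.
  by exists B; split => //; rewrite Bx; exact/ltW.
pose vol := obox_volume.
have volG_ge0 x : 0 <= (vol \o uncurry G) x by exact: obox_volume_ge0.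
apply: (@le_trans _ _ (\esum_(i in setT) (vol \o uncurry G) i)).
  apply: ereal_inf_lbound => /=.
  have /card_esym/ppcard_eqP[f] := card_nat2.
  exists (uncurry G \o f).
    move=> t [i _ /((PG i).1) [j _ Bijt]].
    by exists (f^-1%FUN (i, j)) => //=; rewrite invK ?inE.
  rewrite -(esum_pred_image (vol \o uncurry G) _ xpredT) ?[fun=> _]set_true//.
  by rewrite image_eq.
rewrite (_ : esum _ _ = \sum_(0 <= i <oo) \sum_(0 <= j <oo) vol (G i j)); last first.
  pose J : nat -> set (nat * nat) := fun i => [set (i, j) | j in setT].
  rewrite (_ : setT = \bigcup_k J k); last first.
    by rewrite predeqE => -[a b]; split => // _; exists a => //; exists b.
  rewrite esum_bigcupT /=; last 2 first.
    - apply/trivIsetP => i j _ _ ij.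
      apply/seteqP; split => // -[n m] [[? _ [<- _]] [? _ [ji _]]].
      by move: ij; rewrite ji eqxx.
    - by move=> /= [n m]; exact: obox_volume_ge0.
  rewrite -(image_id [set: nat]) -fun_true esum_pred_image//; last first.
    by move=> n _; apply: esum_ge0 => x _; exact: obox_volume_ge0.
  apply: eq_eseriesr => /= j _.
  rewrite -(esum_pred_image (vol \o uncurry G) (pair j) predT)//=; last first.
    by move=> ? ? _ _; exact: (@can_inj _ _ _ snd).
    by move=> n _; exact: obox_volume_ge0.
  congr esum; apply/seteqP.
  by split => -[a b] [i _ <-]; exists i.
apply: lee_nneseries => [n _ _|n _]; last exact: (PG n).2.
by apply: nneseries_ge0 => m _ _; exact: (volG_ge0 (n, m)).
Qed.

HB.instance Definition _ := isOuterMeasure.Build R V lebesgue_outer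
  lebesgue_outer0 lebesgue_outer_ge0 le_lebesgue_outer
  lebesgue_outer_sigma_subadditive.

(* R^d with its Caratheodory sigma-algebra, i.e. the Lebesgue sigma-algebra;
   [borel] below is used where Borel sets are meant. *)
Definition lebesgueRd : Type := caratheodory_type lebesgue_outer.
HB.instance Definition _ := Measurable.on lebesgueRd.
Definition lebesgue : set lebesgueRd -> \bar R := lebesgue_outer.
HB.instance Definition _ := isMeasure.Build _ lebesgueRd R lebesgue
  (caratheodory_measure0 _) (@caratheodory_measure_ge0 _ _ _)
  (@caratheodory_measure_sigma_additive _ _ _).

Lemma halfspace_measurable (i : 'I_d) (c : R) :
  measurable ([set x : V | x ord0 i <= c]%R : set lebesgueRd).
Proof.
apply: le_caratheodory_measurable => X.
set A := [set x | _]; apply: le_ereal_inf_tmp => _ [F XF <-].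
pose u (ab : V * V) := (ab.1, \row_j if j == i then Num.min (ab.2 ord0 j) c else ab.2 ord0 j)%R.
pose l (ab : V * V) := (\row_j if j == i then Num.max (ab.1 ord0 j) c else ab.1 ord0 j, ab.2)%R.
have h1 : lebesgue_outer (X `&` A) <= \sum_(0 <= k <oo) obox_volume (omap u (F k)).
  apply: ereal_inf_lbound; exists (omap u \o F) => // x [/XF [k _]].
  rewrite /obox; case E: (F k) => [[a b]|//] /= bx Ax.
  exists k => //=; rewrite E /= => j /=; rewrite mxE.
  case/andP: (bx j) => -> /= bj; case: eqP => [->|//].
  by rewrite le_min Ax andbT; case/andP: (bx i).
have h2 : lebesgue_outer (X `&` ~` A) <= \sum_(0 <= k <oo) obox_volume (omap l (F k)).
  apply: ereal_inf_lbound; exists (omap l \o F) => // x [/XF [k _]].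
  rewrite /obox; case E: (F k) => [[a b]|//] /= bx Ax.
  exists k => //=; rewrite E /= => j /=; rewrite mxE.
  case/andP: (bx j) => aj -> /=; rewrite andbT; case: eqP => [->|//].
  rewrite gt_max; case/andP: (bx i) => -> _ /=.
  by rewrite ltNge; apply/negP.
apply: (le_trans (leeD h1 h2)).
rewrite -nneseriesD; try by move=> *; exact: obox_volume_ge0.
apply: lee_nneseries => [k _ _|k _]; first by rewrite adde_ge0 ?obox_volume_ge0.
case: (F k) => [[a b]|] /=; last by rewrite adde0.
rewrite -EFinD lee_fin /box_volume /= 3!(bigD1 i isT) /=.
rewrite !mxE !eqxx.
set p := (\prod_(j | j != i) Num.max 0 (b ord0 j - a ord0 j))%R.
rewrite [X in (_ * X + _)%R](_ : _ = p); last first.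
  by apply: eq_bigr => j ji; rewrite !mxE (negbTE ji).
rewrite [X in (_ + _ * X)%R](_ : _ = p); last first.
  by apply: eq_bigr => j ji; rewrite !mxE (negbTE ji).
rewrite -mulrDl ler_wpM2r//.
  by apply: prodr_ge0 => j _; rewrite le_max lexx.
move: (a ord0 i) (b ord0 i) => x y.
rewrite /Num.max /Num.min.
by repeat case: ifPn; rewrite ?lt_def -?leNgt; lra.
Qed.

Lemma box_measurable ab : measurable (box ab : set lebesgueRd).
Proof.
rewrite (_ : box ab = \bigcap_(i in [set: 'I_d])
    ([set x : V | x ord0 i <= ab.2 ord0 i]%R `\`
     [set x : V | x ord0 i <= ab.1 ord0 i]%R)).
  by apply: fin_bigcap_measurable => // i _; apply: measurableD;
    exact: halfspace_measurable.
apply/seteqP; split => x /= bx i => [_|].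
  by case/andP: (bx i) => h1 h2; split => //; apply/negP; rewrite -ltNge.
by case: (bx i I) => -> /negP; rewrite -ltNge => ->.
Qed.

Lemma open_lebesgue_measurable (A : set V) :
  open A -> measurable (A : set lebesgueRd).
Proof.
move=> oA.
pose rv (q : 'rV[rat]_d) : V := map_mx ratr q.
pose D := [set ab : 'rV[rat]_d * 'rV[rat]_d | box (rv ab.1, rv ab.2) `<=` A].
rewrite (_ : A = \bigcup_(ab in D) box (rv ab.1, rv ab.2)).
  rewrite bigcup_mkcond; apply: countable_bigcupT_measurable => // ab.
  by case: ifP => // _; exact: box_measurable.
apply/seteqP; split => [x Ax|x [ab]]; last exact.
have /nbhs_ballP [e /= e0 eA] : nbhs x A by exact: open_nbhs_nbhs.
have /choice[f fP] : forall i : 'I_d, exists q : rat,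
    (x ord0 i - e < ratr q < x ord0 i)%R.
  move=> i; have := @rat_in_itvoo R (x ord0 i - e)%R (x ord0 i).
  by rewrite ltrBlDr ltrDl => /(_ e0)[q]; rewrite in_itv; exists q.
have /choice[g gP] : forall i : 'I_d, exists q : rat,
    (x ord0 i < ratr q < x ord0 i + e)%R.
  move=> i; have := @rat_in_itvoo R (x ord0 i) (x ord0 i + e)%R.
  by rewrite ltrDl => /(_ e0)[q]; rewrite in_itv; exists q.
exists (\row_i f i, \row_i g i) => /=; last first.
  move=> i /=; rewrite !mxE; case/andP: (fP i) => _ ->.
  by case/andP: (gP i) => /ltW.
move=> y /= yb; apply: eA; split => // i j; rewrite (ord1 i).
rewrite /ball /= ltr_norml.
have := yb j; rewrite /= !mxE => /andP[y1 y2].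
case/andP: (fP j) => f1 f2; case/andP: (gP j) => g1 g2.
by apply/andP; split; lra.
Qed.

Let lebesgue_sigma_finite : sigma_finite setT lebesgue.
Proof.
exists (fun n => box (const_mx (- n%:R), const_mx n%:R)%R).
  apply/esym; rewrite -subTset => x _.
  exists (Num.bound (\sum_i `|x ord0 i|)) => // i /=; rewrite !mxE.
  have : (`|x ord0 i| < (Num.bound (\sum_i `|x ord0 i|)%R)%:R)%R.
    apply: le_lt_trans (archi_boundP _); last exact: sumr_ge0.
    by rewrite (bigD1 i) //= lerDl sumr_ge0.
  by rewrite ltr_norml => /andP[-> /ltW].
move=> n; split; first exact: box_measurable.
pose F k := if k == 0%N then
  Some (const_mx (- n%:R), const_mx n%:R)%R : option (V * V) else None.
apply: (@le_lt_trans _ _ (\sum_(0 <= k <oo) obox_volume (F k))).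
  apply: ereal_inf_lbound; exists F => // x xb.
  by exists 0%N.
rewrite (@nneseries_split _ _ 0 1)//; last by move=> *; exact: obox_volume_ge0.
rewrite add0n big_nat1 /= eseries0 ?adde0 ?ltry//.
by move=> [|k].
Qed.

HB.instance Definition _ :=
  Measure_isSigmaFinite.Build _ _ _ lebesgue lebesgue_sigma_finite.

End lebesgue_outer.

Section measures_on_Q.
Context (R : realType) (d : nat) (Q : set 'rV[R]_d) (oQ : open Q).

Definition lebesgue_on : set (lebesgueRd R d) -> \bar R :=
  mrestr (@lebesgue R d) (open_lebesgue_measurable oQ).

HB.instance Definition _ := Measure.on lebesgue_on.

Let lebesgue_on_sigma_finite : sigma_finite setT lebesgue_on.
Proof.
have [F FT Ffin] := sigma_finiteT (@lebesgue R d).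
exists F => // n; have [mF Foo] := Ffin n; split => //.
apply: le_lt_trans Foo; apply: le_measure; rewrite ?inE//.
by apply: measurableI => //; exact: open_lebesgue_measurable.
Qed.

HB.instance Definition _ :=
  Measure_isSigmaFinite.Build _ _ _ lebesgue_on lebesgue_on_sigma_finite.

End measures_on_Q.

Section Lp_vector_fields.
Context (dT : measure_display) (T : measurableType dT) (R : realType).
Local Open Scope ereal_scope.

(* The norm of a vector field is the L^p norm of its Euclidean length. *)
Definition vnorm (mu : {measure set T -> \bar R}) (p : R) m
    (u : 'I_m -> T -> R) : \bar R :=
  Lnorm mu p%:E (fun z => (Num.sqrt (\sum_i u i z ^+ 2)%R)%:E).

Lemma vnorm_ge0 mu p m (u : 'I_m -> T -> R) : 0 <= vnorm mu p u.
Proof. exact: Lnorm_ge0. Qed.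

Definition vbounded (mu : {measure set T -> \bar R}) (p : R) m
    (u : nat -> 'I_m -> T -> R) : Prop :=
  exists C : R, forall k, vnorm mu p (u k) <= C%:E.

Lemma exponent_ge1 (p : R) : (1 < p)%R -> 1 <= p%:E.
Proof. by move=> hp; rewrite lee_fin ltW. Qed.

(* (L^p)^m with its weak topology. Elements are p-integrable functions rather
   than classes modulo a.e. equality; the functionals below do not separate
   a.e. equal functions, so open (hence Borel) sets are unions of classes. *)
Definition weakLp (mu : {measure set T -> \bar R}) (p : R) (hp : (1 < p)%R)
    (m : nat) : Type :=
  'I_m -> LfunType mu (exponent_ge1 hp).

Context (mu : {measure set T -> \bar R}) (p : R) (hp : (1 < p)%R) (m : nat).
Local Notation V := ('I_m -> LfunType mu (exponent_ge1 hp)).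

Definition bounded_functional (l : {scalar V}) : Prop :=
  exists C : R, forall v : V, `|l v|%:E <= C%:E * vnorm mu p (fun i => v i).

Definition weak_open (B : set V) : Prop :=
  forall v, B v -> exists (n : nat) (l : 'I_n -> {scalar V}) (r : {posnum R}),
    (forall j, bounded_functional (l j)) /\
    (forall w, (forall j, (`|l j w - l j v| < r%:num)%R) -> B w).

Lemma weak_openT : weak_open setT.
Proof.
move=> v _; exists 0%N, (fun=> \0%R), 1%:pos%R; split => // -[].
by [].
Qed.

Lemma weak_openI : setI_closed weak_open.
Proof.
move=> A B oA oB v [Av Bv].
have [n1 [l1 [r1 [b1 A1]]]] := oA v Av.
have [n2 [l2 [r2 [b2 B2]]]] := oB v Bv.
exists (n1 + n2)%N, (fun j : 'I_(n1 + n2) => match fintype.split j with inl i => l1 i | inr i => l2 i end).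
have r0 : (0 < Num.min r1%:num r2%:num)%R by [].
exists (PosNum r0); split.
  by move=> j; case: fintype.split.
move=> w lw; split.
  apply: A1 => j; have := lw (lshift n2 j).
  by rewrite (unsplitK (inl j)) lt_min => /andP[].
apply: B2 => j; have := lw (rshift n1 j).
by rewrite (unsplitK (inr j)) lt_min => /andP[].
Qed.

Lemma weak_open_bigU (I : Type) (f : I -> set V) :
  (forall i, weak_open (f i)) -> weak_open (\bigcup_i f i).
Proof.
move=> fo v [i _ /fo [n [l [r [bl lf]]]]].
by exists n, l, r; split => // w /lf ?; exists i.
Qed.

HB.instance Definition _ := gen_eqMixin (weakLp mu hp m).
HB.instance Definition _ := gen_choiceMixin (weakLp mu hp m).
HB.instance Definition _ :=
  isPointed.Build (weakLp mu hp m) (fun=> [the LfunType mu (exponent_ge1 hp) of cst 0%R]).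
HB.instance Definition _ := isOpenTopological.Build (weakLp mu hp m)
  weak_openT weak_openI weak_open_bigU.

End Lp_vector_fields.

Definition borel (X : ptopologicalType) := g_sigma_algebraType (@open X).
HB.instance Definition _ (X : ptopologicalType) := Measurable.on (borel X).

Section linear_functionals.
Context (R : realType) (X : Type) (D : set (X -> R)).

Definition linear_on (U : D -> R) : Prop :=
  forall (a b : R) (f g k : D),
    (forall x, val k x = a * val f x + b * val g x) -> U k = a * U f + b * U g.

Record Lin := MkLin { Lin_fun :> D -> R ; Lin_linear : linear_on Lin_fun }.

Lemma linear_on0 : linear_on (fun=> 0).
Proof. by move=> a b f g k _; rewrite !mulr0 addr0. Qed.

(* The functional U seen in Lin; the default value 0 is only reached if U is
   not linear. *)
Definition to_Lin (U : D -> R) : Lin :=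
  if pselect (linear_on U) is left lU then MkLin lU else MkLin linear_on0.

Context (phi : nat -> D).

Definition Lin_dist (U V : Lin) : R :=
  limn (series (fun j => 2^-1 ^+ j *
    (`|U (phi j) - V (phi j)| / (`|U (phi j) - V (phi j)| + 1)))).

Definition LinV (m : nat) : Type := 'I_m -> Lin.

Definition LinV_dist m (U V : LinV m) : R := \sum_i Lin_dist (U i) (V i).

Record stateM (m : nat) := MkState {
  st_lin : LinV m ;
  st_eps : {nonneg R} ;
  st_norm : {nonneg R} }.

Definition LinV0 (m : nat) : LinV m := fun=> MkLin linear_on0.
Definition stateM0 (m : nat) : stateM m := MkState (@LinV0 m) 0%:nng 0%:nng.

Definition stateM_dist m (s t : stateM m) : R :=
  LinV_dist (st_lin s) (st_lin t) + `|(st_eps s)%:num - (st_eps t)%:num|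
  + `|(st_norm s)%:num - (st_norm t)%:num|.

End linear_functionals.

Section metric_topology.
Context (R : realType) (Y : Type) (dist : Y -> Y -> R).

Definition dist_open (A : set Y) : Prop :=
  forall x, A x -> exists r : {posnum R}, forall y, dist x y < r%:num -> A y.

Lemma dist_openT : dist_open setT.
Proof. by move=> x _; exists 1%:pos. Qed.

Lemma dist_openI : setI_closed dist_open.
Proof.
move=> A B oA oB x [/oA[r1 A1] /oB[r2 B2]].
have r0 : 0 < Num.min r1%:num r2%:num by [].
by exists (PosNum r0) => y; rewrite /= lt_min => /andP[/A1 + /B2].
Qed.

Lemma dist_open_bigU (I : Type) (f : I -> set Y) :
  (forall i, dist_open (f i)) -> dist_open (\bigcup_i f i).
Proof. by move=> fo x [i _ /fo[r h]]; exists r => y /h; exists i. Qed.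

End metric_topology.

Section state_spaces.
Context (R : realType) (X : Type) (D : set (X -> R)) (phi : nat -> D) (m : nat).

(* Aliases carrying [phi], on which the metric depends. *)
Definition LinV_of (_ : nat -> D) : Type := LinV D m.
Definition stateM_of (_ : nat -> D) : Type := stateM D m.

HB.instance Definition _ := gen_eqMixin (LinV_of phi).
HB.instance Definition _ := gen_choiceMixin (LinV_of phi).
HB.instance Definition _ :=
  isPointed.Build (LinV_of phi) (@LinV0 R X D m).
HB.instance Definition _ := isOpenTopological.Build (LinV_of phi)
  (dist_openT (@LinV_dist _ _ _ phi m)) (@dist_openI _ _ (@LinV_dist _ _ _ phi m))
  (@dist_open_bigU _ _ (@LinV_dist _ _ _ phi m)).

HB.instance Definition _ := gen_eqMixin (stateM_of phi).
HB.instance Definition _ := gen_choiceMixin (stateM_of phi).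
HB.instance Definition _ :=
  isPointed.Build (stateM_of phi) (@stateM0 R X D m).
HB.instance Definition _ := isOpenTopological.Build (stateM_of phi)
  (dist_openT (@stateM_dist _ _ _ phi m)) (@dist_openI _ _ (@stateM_dist _ _ _ phi m))
  (@dist_open_bigU _ _ (@stateM_dist _ _ _ phi m)).

End state_spaces.

Section setting.
Context (R : realType) (dO : measure_display) (Om : measurableType dO)
  (P : probability Om R) (d : nat).
Local Notation Rd := (lebesgueRd R d).
Local Notation leb := (@lebesgue R d).
Local Open Scope ereal_scope.

Definition countably_generated : Prop :=
  exists G : set (set Om), countable G /\ (@measurable _ Om) = <<s G >>.

Record ergodic_dynamical_system (tau : 'rV[R]_d -> Om -> Om) : Prop := {
  tau_measurable : forall x, measurable_fun setT (tau x) ;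
  tau_bijective : forall x, bijective (tau x) ;
  tau_0 : tau 0%R = id ;
  tau_add : forall x y, tau (x + y)%R = tau x \o tau y ;
  tau_preserving : forall x A, measurable A -> P (tau x @` A) = P A ;
  tau_jointly_measurable :
    measurable_fun setT (fun z : (Om * Rd)%type => tau z.2 z.1) ;
  tau_ergodic : forall A, measurable A -> (forall x, tau x @` A = A) ->
    P A = 0 \/ P A = 1 }.

Record test_Omega (DO : set (Om -> R)) : Prop := {
  test_Omega_countable : countable DO ;
  test_Omega_measurable : forall f, DO f -> measurable_fun setT f ;
  test_Omega_bounded : forall f, DO f -> exists M, forall w, (`|f w| <= M)%R ;
  test_Omega_1 : DO (cst 1%R) ;
  test_Omega_dense : forall f : Om -> R, f \in Lfun P 1 ->
    forall r : {posnum R}, exists2 g, DO g &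
      'N[P]_1[EFin \o (fun w => f w - g w)%R] < r%:num%:E }.

(* Elements of C(closure Q) are represented by their extension by 0. *)
Record test_Q (Q : set 'rV[R]_d) (oQ : open Q) (DQ : set ('rV[R]_d -> R)) :
    Prop := {
  test_Q_countable : countable DQ ;
  test_Q_continuous : forall f, DQ f -> {within closure Q, continuous f} ;
  test_Q_out : forall f x, DQ f -> ~ closure Q x -> f x = 0%R ;
  test_Q_1 : DQ (\1_(closure Q)) ;
  test_Q_dense : forall f : Rd -> R, f \in Lfun (lebesgue_on oQ) 1 ->
    forall r : {posnum R}, exists2 g, DQ g &
      'N[lebesgue_on oQ]_1[EFin \o (fun x => f x - g x)%R] < r%:num%:E }.

Definition testA (DO : set (Om -> R)) (DQ : set ('rV[R]_d -> R)) :
    set (Om * Rd -> R) :=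
  [set f | exists2 fO, DO fO & exists2 fQ, DQ fQ &
     f = fun z => (fO z.1 * fQ z.2)%R].

Definition testD DO DQ : set (Om * Rd -> R) :=
  [set f | exists n (c : 'I_n -> R) (g : 'I_n -> Om * Rd -> R),
     (forall i, testA DO DQ (g i)) /\ f = fun z => (\sum_i c i * g i z)%R].

Definition testD0 DO DQ : set (Om * Rd -> R) :=
  [set f | exists n (c : 'I_n -> rat) (g : 'I_n -> Om * Rd -> R),
     (forall i, testA DO DQ (g i)) /\
     f = fun z => (\sum_i ratr (c i) * g i z)%R].

Definition Tstar (tau : 'rV[R]_d -> Om -> Om) (eps : R) (f : Om * Rd -> R) :
    Om * Rd -> R :=
  fun z => f (tau (eps^-1 *: z.2)%R z.1, z.2).

Definition conjugate (p : R) : R := (p / (p - 1))%R.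

Record good_set (tau : 'rV[R]_d -> Om -> Om) (p : R) (Q : set 'rV[R]_d)
    (oQ : open Q) DO DQ (Om0 : set Om) : Prop := {
  good_measurable : measurable Om0 ;
  good_full : P Om0 = 1 ;
  good_norm : forall f w0 r, testA DO DQ f -> Om0 w0 ->
    r = p \/ r = conjugate p ->
    limf_esup (fun eps : R =>
        'N[lebesgue_on oQ]_r%:E[EFin \o (fun x => Tstar tau eps f (w0, x))])
      0^'+ <= 'N[P \x lebesgue_on oQ]_r%:E[EFin \o f] ;
  good_product : forall f g w0, testA DO DQ f -> testA DO DQ g -> Om0 w0 ->
    \int[leb]_(x in Q) (Tstar tau eps (fun z => f z * g z)%R (w0, x))%:E
      @[eps --> (0 : R)^'+]
      --> \int[P]_w \int[leb]_(x in Q) (f (w, x) * g (w, x))%:E }.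

(* [phi] enumerates the elements of D0 that are nonzero in L^q(Omega * Q),
   normalized in that space. *)
Definition normalized_enumeration (p : R) (Q : set 'rV[R]_d) (oQ : open Q)
    DO DQ (phi : nat -> testD DO DQ) : Prop :=
  forall f : testD DO DQ, range phi f <->
    exists2 g, testD0 DO DQ g &
      'N[P \x lebesgue_on oQ]_(conjugate p)%:E[EFin \o g] != 0 /\
      forall z, val f z =
        (g z / fine 'N[P \x lebesgue_on oQ]_(conjugate p)%:E[EFin \o g])%R.

Definition vanishing (e : nat -> {posnum R}) : Prop :=
  ((e k)%:num @[k --> \oo] --> (0 : R)%R).

Definition well_defined_integral dX (X : measurableType dX)
    (mu : {measure set X -> \bar R}) (D : set X) (f : X -> \bar R) : Prop :=
  measurable_fun D f /\
  (\int[mu]_(x in D) f^\+ x < +oo \/ \int[mu]_(x in D) f^\- x < +oo).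

Definition uniformly_integrable (f : nat -> Om -> \bar R) : Prop :=
  (forall k, measurable_fun setT (f k)) /\
  ereal_sup (range (fun k =>
      \int[P]_(w in [set w | c%:E < `|f k w|]) `|f k w|))
    @[c --> (+oo : set_system R)%R] --> 0.

Section two_scale.
Context (tau : 'rV[R]_d -> Om -> Om) (p : R) (hp : (1 < p)%R)
  (Q : set 'rV[R]_d) (oQ : open Q)
  (DO : set (Om -> R)) (DQ : set ('rV[R]_d -> R)) (Om0 : set Om).

Local Notation LpQ := (LfunType (lebesgue_on oQ) (exponent_ge1 hp)).
Local Notation LpOmQ := (LfunType (P \x lebesgue_on oQ) (exponent_ge1 hp)).
Local Notation D := (testD DO DQ).

Definition two_scale_cvg m (e : nat -> {posnum R}) (w0 : Om)
    (u : nat -> 'I_m -> LpQ) (v : 'I_m -> LpOmQ) : Prop :=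
  vbounded (lebesgue_on oQ) p (fun k i => u k i) /\
  forall (i : 'I_m) f, D f ->
    \int[leb]_(x in Q) (u k i x * Tstar tau (e k)%:num f (w0, x))%:E
      @[k --> \oo]
      --> \int[P]_w \int[leb]_(x in Q) (v i (w, x) * f (w, x))%:E.

Definition field_value m X (u : 'I_m -> X -> R) (x : X) : 'rV[R]_m :=
  (\row_i u i x)%R.

Definition two_scale_energy (h : Om -> 'rV[R]_d -> 'rV[R]_d -> R)
    (v : 'I_d -> Om * Rd -> R) : \bar R :=
  \int[P]_w \int[leb]_(x in Q) (h w x (field_value v (w, x)))%:E.

Record two_scale_normal_integrand (h : Om -> 'rV[R]_d -> 'rV[R]_d -> R) :
    Prop := {
  integrand_measurable : forall xi,
    measurable_fun [set z : Om * borel 'rV[R]_d | Q z.2]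
      (fun z => h z.1 z.2 xi) ;
  integrand_lsc :
    {ae P \x lebesgue_on oQ, forall z : Om * Rd,
      lower_semicontinuous (fun xi => (h z.1 z.2 xi)%:E)} ;
  integrand_liminf :
    {ae P, forall w0, Om0 w0 ->
      forall (e : nat -> {posnum R}) (u : nat -> 'I_d -> LpQ)
        (v : 'I_d -> LpOmQ),
      vanishing e -> two_scale_cvg e w0 u v ->
      [/\ forall k, well_defined_integral leb Q
            (fun x => (h (tau ((e k)%:num^-1 *: x)%R w0) x
                         (field_value (fun i => u k i) x))%:E),
          well_defined_integral (P \x leb) [set z : Om * Rd | Q z.2]
            (fun z => (h z.1 z.2 (field_value (fun i => v i) z))%:E) &
          two_scale_energy h (fun i => v i) <=
          limn_einf (fun k => \int[leb]_(x in Q)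
            (h (tau ((e k)%:num^-1 *: x)%R w0) x
               (field_value (fun i => u k i) x))%:E)]} }.

Definition J (eps : R) (w0 : Om) m (u : 'I_m -> Rd -> R) : LinV D m :=
  fun i => to_Lin (fun f : D =>
    fine (\int[leb]_(x in Q) (u i x * Tstar tau eps (val f) (w0, x))%:E)).

Definition J0 m (v : 'I_m -> Om * Rd -> R) : LinV D m :=
  fun i => to_Lin (fun f : D =>
    fine (\int[P]_w \int[leb]_(x in Q) (v i (w, x) * val f (w, x))%:E)).

Section Young.
Context (phi : nat -> D) (m : nat).
Local Notation M := (stateM_of m phi).

(* For the P-null set of w such that u(w, .) is not in L^p(Q), the values of
   [fine] and [to_Lin] are irrelevant. *)
Definition state (e : nat -> {posnum R}) (u : nat -> 'I_m -> LpOmQ) (k : nat)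
    (w : Om) : M :=
  let uw := fun i x => u k i (w, x) in
  if pselect (Om0 w) then
    MkState (J (e k)%:num w uw) (widen_itv (e k))
      (NngNum (fine_ge0 (vnorm_ge0 (lebesgue_on oQ) p uw)))
  else @stateM0 _ _ D m.

Record normal_integrand (H : Om * borel M -> \bar R) : Prop := {
  normal_measurable : measurable_fun setT H ;
  normal_lsc : forall w, lower_semicontinuous (fun xi : M => H (w, xi)) ;
  normal_gtNy : forall z, -oo < H z }.

Definition first_marginal (mu : set (borel M) -> \bar R)
    (C : set (borel (LinV_of m phi))) : \bar R :=
  mu [set xi | C (st_lin xi)].

Definition J0_weakLp (v : weakLp (P \x lebesgue_on oQ) hp m) :
    borel (LinV_of m phi) := J0 (fun i => v i).

(* Young measures are probability kernels with source Omega. In the last clause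
   J_0 B must be Borel for its marginal mass to make sense. *)
Definition generates_Young_measure (e : nat -> {posnum R})
    (u : nat -> 'I_m -> LpOmQ)
    (nu : R.-pker Om ~> borel (weakLp (P \x lebesgue_on oQ) hp m)) : Prop :=
  exists mu : R.-pker Om ~> borel M,
  [/\ forall H, normal_integrand H ->
        uniformly_integrable (fun k w => `|mine 0 (H (w, state e u k w))|) ->
        \int[P]_w \int[mu w]_xi H (w, xi) <=
        limn_einf (fun k => \int[P]_w H (w, state e u k w)),
      {ae P, forall w, mu w (~` cluster (state e u k w @[k --> \oo])) = 0} &
      {ae P, forall w,
        first_marginal (mu w) (range J0_weakLp) = 1 /\
        forall B : set (borel (weakLp (P \x lebesgue_on oQ) hp m)),
          measurable B ->
          measurable (J0_weakLp @` B) /\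
          nu w B = first_marginal (mu w) (J0_weakLp @` B)}].

End Young.
End two_scale.
End setting.

(* Main.v *)
(* For c >= 0 put a_k(w) = (E_k(w) + c)^+, where E_k(w) is the quenched energy of
   u_k, and let H(w, xi) = sup_n inf_k (a_k(w) + n d(s_k(w), xi)). This is a
   nonnegative normal integrand with H(w, s_k(w)) <= a_k(w), so clause (1) of the
   definition of generated Young measures bounds the integral of H against mu_w
   by liminf int a_k, and uniform integrability gives
   int a_k <= int E_k + c + o(1) as c -> oo, uniformly in k.
   Conversely, if H(w, xi) < L at a cluster point xi of (s_k(w)) whose first
   component is J_0 v, some subsequence of (s_k(w)) converges to xi while
   E_k(w) <= L - c; this is quenched two-scale convergence to v, so the energy
   E(v) is at most L - c. Hence (E(v) + c)^+ <= H(w, xi), and transporting mu_w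
   to nu_w through J_0 bounds the integral of (E + c)^+ against nu_w. Subtract c
   and let c -> oo.
   The integral of E against nu_w makes sense because E is a Borel function for
   the weak topology (L^p is separable in L^1, and superpositions with bounded
   truncations of h are L^1-semicontinuous) and because every v is the two-scale
   limit of its own realizations v(tau_(x/eps) w, x). *)
Require Import Defs.
From HB Require Import structures.
From mathcomp Require Import all_boot all_order all_algebra.
From mathcomp Require Import all_classical all_reals all_analysis measurable_realfun.
From mathcomp Require Import lra.
Set Implicit Arguments.
Unset Strict Implicit.
Unset Printing Implicit Defensive.
Import Order.TTheory GRing.Theory Num.Theory.
Import numFieldNormedType.Exports.
Local Open Scope classical_set_scope.
Local Open Scope ring_scope.

(** * Integrals of extended real functions *)

(** The quenched energy depends on the whole function u_k(w, .), while clause (1) accepts only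
    functions of the state, that is of the pairings with test functions, the scale and the norm. The
    energy itself is therefore no candidate for H, and H is built from its values along the given
    sequence. The shift c makes H nonnegative, so min(0, H) vanishes and the uniform integrability
    demanded by clause (1) is trivial; the hypothesis on the negative parts is spent only on
    removing c again. The scale and norm coordinates turn closeness of states into two-scale
    convergence: a cluster point has scale 0, so states close to it have small scales, and the norm
    coordinate bounds the L^p norms. A second obstacle is that the energies may be infinite or badly
    defined. Integrals mean int f^+ - int f^-, with +oo - +oo = -oo, so comparisons are made between
    nonnegative functions and only finite quantities are cancelled. *)

Section signed_integral.
Local Open Scope ereal_scope.
Context d (T : measurableType d) (R : realType) (mu : {measure set T -> \bar R}).

(** Positive parts grow and negative parts shrink; the convention +oo - +oo = -oo keeps subtraction
    monotone even when both integrals are infinite. *)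
Lemma ae_le_integral (f g : T -> \bar R) :
  measurable_fun setT f -> measurable_fun setT g ->
  {ae mu, forall x, f x <= g x} -> \int[mu]_x f x <= \int[mu]_x g x.
Proof.
move=> mf mg fg; rewrite [leLHS]integralE [leRHS]integralE; apply: leeB.
  apply: ae_ge0_le_integral => //; try exact: measurable_funepos.
  apply: filterS fg => x fg _; rewrite !funeposE; case: (leP (f x) 0) => fx.
    by rewrite le_max lexx orbT.
  by rewrite le_max fg.
apply: ae_ge0_le_integral => //; try exact: measurable_funeneg.
apply: filterS fg => x fg _; rewrite !funenegE; case: (leP (- g x) 0) => gx.
  by rewrite le_max lexx orbT.
by rewrite le_max leeN2 fg.
Qed.

(** The integral of f may be infinite. With h = f - g, the identity h^+ + g = f + h^- involves only
    nonnegative functions, and h^- <= g makes the final subtraction legitimate. *)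
Lemma ge0_integralB (f g : T -> \bar R) :
  measurable_fun setT f -> measurable_fun setT g ->
  (forall x, 0 <= f x) -> (forall x, 0 <= g x) ->
  \int[mu]_x g x < +oo ->
  \int[mu]_x (f x - g x) = \int[mu]_x f x - \int[mu]_x g x.
Proof.
move=> mf mg f0 g0 goo.
have ig : mu.-integrable setT g.
  apply/integrableP; split => //.
  by under eq_integral => x _ do rewrite gee0_abs//.
have gfin : \int[mu]_x g x \is a fin_num.
  by rewrite ge0_fin_numE// integral_ge0.
have mh : measurable_fun setT (fun x => f x - g x) by exact: emeasurable_funB.
set h := fun x => f x - g x in mh *.
have hn x : h^\- x <= g x.
  rewrite funenegE /h; case: (leP (- (f x - g x)) 0) => // hx; move: (f0 x) (g0 x).
  case: (f x) => [r| |]; case: (g x) => [s| |] //= r0 s0; rewrite ?leey ?leNye//.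
  by move: r0 s0; rewrite !lee_fin => r0 s0; lra.
have hnoo : \int[mu]_x h^\- x < +oo.
  apply: le_lt_trans goo; apply: ge0_le_integral => //.
  exact: measurable_funeneg.
have hnfin : \int[mu]_x h^\- x \is a fin_num.
  by rewrite ge0_fin_numE// integral_ge0.
rewrite integralE -/h.
have key : \int[mu]_x h^\+ x + \int[mu]_x g x = \int[mu]_x f x + \int[mu]_x h^\- x.
  rewrite -!ge0_integralD//; try exact: measurable_funeneg; try exact: measurable_funepos.
  apply: ge0_ae_eq_integral => //.
  - by apply: emeasurable_funD => //; exact: measurable_funepos.
  - by apply: emeasurable_funD => //; exact: measurable_funeneg.
  - by move=> x _; rewrite adde_ge0.
  - by move=> x _; rewrite adde_ge0.
  apply: filterS (integrable_ae measurableT ig) => x /(_ I) gx _.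
  rewrite funeposE funenegE /h; case: (g x) gx => [s _| |] //.
  case: (f x) (f0 x) => [r _| |] //=.
    rewrite /maxe /Order.max !lte_fin.
    by repeat case: ifPn => ?; rewrite -?EFinD; congr EFin; lra.
  by move=> _; rewrite (max_idPr (leNye _)) adde0 addye// (max_idPl (leey _)).
move: key gfin hnfin.
move: (\int[mu]_x h^\+ x) (\int[mu]_x g x) (\int[mu]_x f x) (\int[mu]_x h^\- x).
move=> [a| |] [b| |] [c| |] [e| |] //=.
by rewrite -!EFinD => -[] h1 _ _; congr EFin; lra.
Qed.

Lemma ge0_integralBl (f g : T -> \bar R) :
  measurable_fun setT f -> measurable_fun setT g ->
  (forall x, 0 <= f x) -> (forall x, 0 <= g x) ->
  \int[mu]_x f x < +oo ->
  \int[mu]_x (f x - g x) = \int[mu]_x f x - \int[mu]_x g x.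
Proof.
move=> mf mg f0 g0 foo.
have if_ : mu.-integrable setT f.
  apply/integrableP; split => //.
  by under eq_integral => x _ do rewrite gee0_abs//.
have E : \int[mu]_x (f x - g x) = - \int[mu]_x (g x - f x).
  have mgf : measurable_fun setT (fun x => g x - f x) by exact: emeasurable_funB.
  have fin : \int[mu]_x (fun x => g x - f x)^\- x \is a fin_num.
    rewrite ge0_fin_numE ?integral_ge0//; apply: le_lt_trans foo.
    apply: ge0_le_integral => //; first exact: measurable_funeneg.
    move=> x _; rewrite funenegE ge_max f0 andbT.
    by move: (f0 x) (g0 x); case: (f x) => [r| |]; case: (g x) => [s| |] //= r0 s0;
      rewrite ?leey ?leNye// lee_fin; move: r0 s0; rewrite !lee_fin => r0 s0; lra.
  rewrite -integralN; last by rewrite fin_num_adde_defl// fin_numN.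
  (* The two sides differ where [f x] and [g x] are both +oo, since +oo - +oo is -oo; integrability
     of f excludes this almost everywhere. *)
  have : {ae mu, forall x, (f x - g x) = - (g x - f x)}.
    apply: filterS (integrable_ae measurableT if_) => x /(_ I) fx.
    by rewrite fin_num_oppeB// addeC.
  move=> ae_; apply: ae_eq_integral => //; first exact: emeasurable_funB.
    exact: measurableT_comp.
  by apply: filterS ae_ => x + _.
rewrite E ge0_integralB// fin_num_oppeB 1?addeC//.
by rewrite ge0_fin_numE ?integral_ge0.
Qed.

(** The sum of the functions has a finite integral, hence is finite almost everywhere, and the terms
    of a convergent series tend to 0. This replaces Borel-Cantelli and the extraction of
    subsequences below. *)
Lemma summable_integral_cvg0 (f : (T -> \bar R)^nat) :
  (forall n, measurable_fun setT (f n)) -> (forall n x, 0 <= f n x) ->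
  \sum_(n <oo) \int[mu]_x f n x < +oo ->
  {ae mu, forall x, f ^~ x @ \oo --> 0}.
Proof.
move=> mf f0; rewrite -integral_nneseries// => foo.
have is_ : mu.-integrable setT (fun x => \sum_(n <oo) f n x).
  apply/integrableP; split; first exact: ge0_emeasurable_sum.
  by under eq_integral => x _ do rewrite gee0_abs ?nneseries_ge0//.
apply: filterS (integrable_ae measurableT is_) => x /(_ I).
rewrite ge0_fin_numE ?nneseries_ge0// => fx.
apply: (@squeeze_cvge _ _ _ _ (cst 0) _ (fun n => \sum_(n <= k <oo) f k x)).
- apply: nearW => n; rewrite f0/=.
  apply: (le_trans _ (@nneseries_lim_ge _ (f^~ x) xpredT n n.+1 _)) => //.
  by rewrite big_nat1.
- exact: cvg_cst.
- exact: nneseries_tail_cvg.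
Qed.

(** Tonelli for the indicator of the region under the graph of f. *)
Lemma layer_cake (f : T -> \bar R) (s : {sigma_finite_measure set T -> \bar R}) :
  measurable_fun setT f -> (forall x, 0 <= f x) ->
  \int[s]_x f x =
  \int[lebesgue_measure]_(r in `[0%R, +oo[) s [set x | r%:E < f x].
Proof.
move=> mf f0.
pose A := [set z : T * measurableTypeR R | (0 <= z.2)%R /\ z.2%:E < f z.1].
have mA : measurable A.
  have m2 : measurable_fun setT (fun z : T * measurableTypeR R => z.2%:E).
    by apply/measurable_EFinP; exact: measurable_snd.
  have -> : A = [set z | 0 <= z.2%:E] `&` [set z | z.2%:E < f z.1] by [].
  apply: measurableI; rewrite -[X in measurable X]setTI.
    by apply: measurable_lee => //; exact: measurable_cst.
  by apply: measurable_lte => //; exact: (measurableT_comp mf measurable_fst).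
have := @fubini_tonelli _ _ T (measurableTypeR R) R s (@lebesgue_measure R)
  (fun z => (\1_A z)%:E).
move=> /(_ _ _)/wrap[].
  by apply/measurable_EFinP; exact: measurable_indic.
  by move=> x; rewrite lee_fin.
have -> : \int[s]_x \int[lebesgue_measure]_y (\1_A (x, y))%:E = \int[s]_x f x.
  apply: eq_integral => x _.
  pose B : set R := [set r | (0 <= r)%R /\ r%:E < f x].
  rewrite (_ : (fun y => _) = (fun y => (\1_B y)%:E)); last first.
    apply/funext => r; rewrite !indicE.
    by have -> : ((x, r) \in A) = (r \in B) by apply/idP/idP; rewrite !inE.
  (* The section over x is the interval from 0 to [f x], whose length is [f x] also when that is
     infinite. *)
  have -> : B =
     [set` Interval (BLeft 0%R) (match f x with r%:E => BLeft r | _ => +oo%O end)].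
    apply/seteqP; split => r; rewrite /B /= in_itv /=; case: (f x) (f0 x) => [t| |] //=.
    - by move=> _ [-> /=]; rewrite lte_fin.
    - by move=> _ [-> /=].
    - by move=> _ /andP[]; rewrite lte_fin.
    - by move=> _ /andP[]; rewrite ltry.
  rewrite integral_indic//= setIT lebesgue_measure_itv /=.
  case: (f x) (f0 x) => [t| |] //=; rewrite ?lte_fin ?lee_fin ?ltry//.
  by case: ltP => // t0 t0'; rewrite ?sube0//; congr EFin; apply/eqP; rewrite eq_le t0 t0'.
move=> ->; rewrite [RHS]integral_mkcond; apply: eq_integral => r _.
rewrite /patch /=; case: ifPn; rewrite ?inE /= => r0.
  rewrite in_itv /= andbT in r0; pose r' : R := r.
  pose C : set T := [set x | r'%:E < f x].
  have mC : measurable C.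
    by rewrite -[X in measurable X]setTI; apply: measurable_lte => //; exact: measurable_cst.
  have -> : [set x | (r : R)%:E < f x] = C by [].
  rewrite -[in RHS](setIT C) -integral_indic//; apply: eq_integral => x _.
  rewrite !indicE; suff -> : ((x, r) \in A) = (x \in C) by [].
  by apply/idP/idP; rewrite !inE /A /C /=; tauto.
rewrite integral0_eq// => x _; rewrite indicE memNset// /A /= => -[r0' _].
by move/negP: r0; rewrite inE /= in_itv /= r0'.
Qed.

End signed_integral.

(** The layer cake formula sees only the measures of superlevel sets, so it compares integrals over
    two unrelated spaces. *)
Lemma le_integral_distribution d1 d2 (T1 : measurableType d1)
  (T2 : measurableType d2) (R : realType)
  (m1 : {sigma_finite_measure set T1 -> \bar R})
  (m2 : {sigma_finite_measure set T2 -> \bar R})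
  (f : T1 -> \bar R) (g : T2 -> \bar R) :
  measurable_fun setT f -> measurable_fun setT g ->
  (forall x, 0 <= f x)%E -> (forall x, 0 <= g x)%E ->
  (forall r : R, m1 [set x | r%:E < f x] = m2 [set x | r%:E < g x])%E ->
  (\int[m1]_x f x = \int[m2]_x g x)%E.
Proof.
move=> mf mg f0 g0 fg; rewrite (@layer_cake _ _ _ f m1)// (@layer_cake _ _ _ g m2)//.
by apply: eq_integral => r _; rewrite fg.
Qed.

Section semi_fubini.
Local Open Scope ereal_scope.
Context (R : realType) (d1 d2 : measure_display) (T1 : measurableType d1)
  (T2 : measurableType d2) (m1 : {sigma_finite_measure set T1 -> \bar R})
  (m2 : {sigma_finite_measure set T2 -> \bar R}).

(** For some x both inner integrals may be infinite. The part with finite total integral is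
    integrable in x, and this decides which of the two subtraction rules applies to the outer
    integral. *)
Lemma integral12_semi (f : T1 * T2 -> \bar R) : measurable_fun setT f ->
  \int[m1 \x m2]_z f^\+ z < +oo \/ \int[m1 \x m2]_z f^\- z < +oo ->
  \int[m1]_x \int[m2]_y f (x, y) = \int[m1 \x m2]_z f^\+ z - \int[m1 \x m2]_z f^\- z.
Proof.
move=> mf foo.
have mp : measurable_fun setT f^\+ by exact: measurable_funepos.
have mn : measurable_fun setT f^\- by exact: measurable_funeneg.
have -> : \int[m1]_x \int[m2]_y f (x, y) =
    \int[m1]_x (\int[m2]_y f^\+ (x, y) - \int[m2]_y f^\- (x, y)).
  apply: eq_integral => x _; rewrite [LHS]integralE; congr (_ - _).
    by apply: eq_integral => y _; rewrite !funeposE.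
  by apply: eq_integral => y _; rewrite !funenegE.
have Mp := @measurable_fun_fubini_tonelli_F _ _ _ _ _ m2 f^\+ mp (fun=> funepos_ge0 _ _).
have Mn := @measurable_fun_fubini_tonelli_F _ _ _ _ _ m2 f^\- mn (fun=> funeneg_ge0 _ _).
have Ep := @fubini_tonelli1 _ _ _ _ _ m1 m2 f^\+ mp (fun=> funepos_ge0 _ _).
have En := @fubini_tonelli1 _ _ _ _ _ m1 m2 f^\- mn (fun=> funeneg_ge0 _ _).
case: foo => foo.
  rewrite ge0_integralBl//.
  - by rewrite Ep En.
  - by move=> x; apply: integral_ge0.
  - by move=> x; apply: integral_ge0.
  - by rewrite Ep in foo.
rewrite ge0_integralB//.
- by rewrite Ep En.
- by move=> x; apply: integral_ge0.
- by move=> x; apply: integral_ge0.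
- by rewrite En in foo.
Qed.

End semi_fubini.

(** * Lebesgue measure and test functions *)

Section lebesgue_Rd.
Context (R : realType) (d : nat).
Local Notation Rd := (lebesgueRd R d).
Local Notation leb := (@lebesgue R d).
Local Notation V := 'rV[R]_d.

Lemma sum_obox_volume1 (o : option (V * V)) :
  (\sum_(0 <= k <oo) obox_volume (if k == 0%N then o else None)
   = obox_volume o)%E.
Proof.
rewrite (@nneseries_split _ _ 0 1)//; last by move=> *; exact: obox_volume_ge0.
by rewrite add0n big_nat1 /= eseries0 ?adde0// => -[|k].
Qed.

Lemma lebesgue_box_lty (ab : V * V) : (leb (box ab) < +oo)%E.
Proof.
apply: (@le_lt_trans _ _ (obox_volume (Some ab))); last exact: ltry.
rewrite -sum_obox_volume1; apply: ereal_inf_lbound.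
by exists (fun k => if k == 0%N then Some ab else None) => // x xb; exists 0%N.
Qed.

(** Rescaling a cover of A by boxes covers the preimage, and each volume is multiplied by c^-d. *)
Let scale_le (c : R) (A : set V) : 0 < c ->
  (lebesgue_outer ((fun x => c *: x) @^-1` A) <= (c^-1 ^+ d)%:E * lebesgue_outer A)%E.
Proof.
move=> c0; rewrite muleC -lee_pdivrMr ?exprn_gt0 ?invr_gt0//.
apply: le_ereal_inf_tmp => _ [F AF <-].
rewrite lee_pdivrMr ?exprn_gt0 ?invr_gt0// muleC.
pose s (ab : V * V) := (c^-1 *: ab.1, c^-1 *: ab.2).
rewrite -nneseriesZl; last by move=> *; exact: obox_volume_ge0.
rewrite (_ : (\sum_(_ <= _ <oo) _)%E = (\sum_(0 <= k <oo) obox_volume (omap s (F k)))%E); last first.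
  apply: eq_eseriesr => k _; case: (F k) => [[a b]|] /=; last by rewrite mule0.
  rewrite -EFinM; congr EFin; rewrite /box_volume /=.
  rewrite -[in c^-1 ^+ d](card_ord d) -prodr_const -big_split /=.
  apply: eq_bigr => i _; rewrite !mxE -mulrBr.
  by rewrite maxr_pMr ?invr_ge0 ?ltW// mulr0.
apply: ereal_inf_lbound; exists (omap s \o F) => // x /AF[k _].
rewrite /obox; case E: (F k) => [[a b]|//] /= bx.
exists k => //=; rewrite E /= => i /=; have := bx i.
by rewrite /= !mxE ![c^-1 * _]mulrC ltr_pdivrMr// ler_pdivlMr// ![_ * c]mulrC.
Qed.

(** The reverse inequality is [scale_le] for the factor c^-1. *)
Lemma lebesgue_outer_scale (c : R) (A : set V) : 0 < c ->
  (lebesgue_outer ((fun x => c *: x) @^-1` A) = (c^-1 ^+ d)%:E * lebesgue_outer A)%E.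
Proof.
move=> c0; apply/eqP; rewrite eq_le scale_le//=.
have {1}-> : A = (fun x => c^-1 *: x) @^-1` ((fun x => c *: x) @^-1` A).
  by apply/seteqP; split=> x /=; rewrite scalerA mulfV ?gt_eqF// scale1r.
apply: (@le_trans _ _ ((c^-1 ^+ d)%:E * ((c^-1^-1 ^+ d)%:E * lebesgue_outer ((fun x => c *: x) @^-1` A)))%E).
  by rewrite lee_pmul2l ?lte_fin ?exprn_gt0 ?invr_gt0// scale_le ?invr_gt0.
rewrite muleA -EFinM -exprMn mulfV ?expr1n ?mul1e// invr_neq0//.
by rewrite gt_eqF.
Qed.

Let caratheodory_scale (c : R) (A : set V) : 0 < c ->
  (forall X, lebesgue_outer X = lebesgue_outer (X `&` A) + lebesgue_outer (X `&` ~` A))%E ->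
  forall X, (lebesgue_outer X =
   lebesgue_outer (X `&` (fun x => c *: x) @^-1` A) +
   lebesgue_outer (X `&` ~` ((fun x => c *: x) @^-1` A)))%E.
Proof.
move=> c0 mA X.
have [Y ->] : exists Y, X = (fun x : V => c *: x) @^-1` Y.
  exists ((fun x : V => c^-1 *: x) @^-1` X).
  by apply/seteqP; split=> x /=; rewrite scalerA mulVf ?gt_eqF// scale1r.
have -> : (fun x : V => c *: x) @^-1` Y `&` (fun x : V => c *: x) @^-1` A =
  (fun x : V => c *: x) @^-1` (Y `&` A) by [].
have -> : (fun x : V => c *: x) @^-1` Y `&` ~` ((fun x : V => c *: x) @^-1` A) =
  (fun x : V => c *: x) @^-1` (Y `&` ~` A) by [].
rewrite !lebesgue_outer_scale//.
by rewrite {1}(mA Y) ge0_muleDr//; exact: lebesgue_outer_ge0.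
Qed.

(** The target carries the Lebesgue and not the Borel sigma-algebra, so continuity would not
    suffice; the Caratheodory criterion is transported by the scaling of the outer measure. *)
Lemma measurable_scale (c : R) : 0 < c ->
  measurable_fun setT ((fun x : V => c *: x) : Rd -> Rd).
Proof.
move=> c0 _ A mA; rewrite setTI.
exact: (@caratheodory_scale c A c0 mA).
Qed.

End lebesgue_Rd.
Section lebesgue_on.
Context (R : realType) (d : nat) (Q : set 'rV[R]_d) (oQ : open Q).
Local Notation Rd := (lebesgueRd R d).
Local Notation leb := (@lebesgue R d).
Local Notation lam := (lebesgue_on oQ).
Local Open Scope ereal_scope.

Import HBNNSimple.

(** Here f is arbitrary, because the sections in w to which this is applied may fail to be
    measurable. The integral of a nonnegative function is a supremum over simple functions below it,
    and the complement of Q is null for [lam]. *)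
Lemma integral_lebesgue_on (f : Rd -> \bar R) :
  \int[leb]_(x in Q) f x = \int[lam]_x f x.
Proof.
have mQ := open_lebesgue_measurable oQ.
rewrite (@eq_measure_integral _ _ _ _ lam); last first.
  move=> A mA AQ; apply/esym; transitivity (leb (A `&` Q)) => //.
  by rewrite setIidl.
have lQ : lam (~` Q) = 0 by rewrite -(measure0 leb) -(setICl Q).
have key (g : Rd -> \bar R) : (forall x, 0 <= g x) ->
    \int[lam]_(x in Q) g x = \int[lam]_x g x.
  move=> g0; apply/eqP; rewrite eq_le; apply/andP; split.
    rewrite integral_mkcond !ge0_integralTE//; last exact: erestrict_ge0.
    apply: ge_ereal_sup => _ [h hg <-]; apply: ereal_sup_ubound; exists h => // x; apply: (le_trans (hg x)).
    by rewrite /patch; case: ifP.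
  rewrite [leLHS]ge0_integralTE//; apply: ge_ereal_sup => _ [h hg <-].
  rewrite -integralT_nnsfun (@ge0_negligible_integral _ _ _ lam setT (~` Q))//=; last 3 first.
    exact: measurableC.
    exact/measurable_EFinP.
    by move=> x _; rewrite lee_fin.
  rewrite setTD setCK integral_nnsfun// (mrestrict h mQ).
  rewrite ge0_integralE//; apply: ereal_sup_ubound.
  exists (proj_nnsfun h mQ) => // x; rewrite -mrestrict /patch.
  by case: ifP.
by rewrite integralE [RHS]integralE !key.
Qed.

Hypothesis bQ : bounded_set Q.

Lemma lebesgue_on_lty : lam setT < +oo.
Proof.
have [M [_ MQ]] := bQ.
have {}MQ x : Q x -> (`|x| <= Num.max 0%R M + 1)%R.
  by apply: MQ; rewrite (@le_lt_trans _ _ (Num.max 0%R M))// ?le_max ?lexx ?orbT// ltrDl.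
set N := (Num.max 0%R M + 1)%R in MQ.
(* Boxes exclude their lower faces, so the lower corner is moved one unit below -N. *)
apply: le_lt_trans (lebesgue_box_lty (const_mx (- (N + 1)), const_mx N)%R).
rewrite (_ : lam setT = leb Q); last first.
  by transitivity (leb (setT `&` Q)) => //; rewrite setTI.
apply: le_measure; rewrite ?inE.
- exact: open_lebesgue_measurable.
- exact: box_measurable.
move=> x /MQ xN i /=; rewrite !mxE.
have : (`|x ord0 i| <= N)%R.
  apply: le_trans xN; rewrite [leRHS]/Num.norm /= mx_normrE.
  exact: (le_bigmax_cond _ (fun ij => `|x ij.1 ij.2|%R) (j := (ord0, i))).
by rewrite ler_norml => /andP[h1 ->]; rewrite andbT (lt_le_trans _ h1)// ltrN2 ltrDl.
Qed.

End lebesgue_on.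

Section test_functions.
Context (R : realType) (dO : measure_display) (Om : measurableType dO)
  (P : probability Om R) (d : nat) (Q : set 'rV[R]_d) (oQ : open Q)
  (bQ : bounded_set Q) (DO : set (Om -> R)) (DQ : set ('rV[R]_d -> R)).
Hypotheses (hDO : test_Omega P DO) (hDQ : test_Q oQ DQ).
Local Notation Rd := (lebesgueRd R d).

Lemma closed_lebesgue_measurable (A : set 'rV[R]_d) :
  closed A -> measurable (A : set Rd).
Proof.
move=> cA; rewrite -[A]setCK; apply: measurableC.
by apply: open_lebesgue_measurable; exact: closed_openC.
Qed.

Lemma test_Q_measurable f : DQ f -> measurable_fun setT (f : Rd -> R).
Proof.
move=> Df; have mC : measurable (closure Q : set Rd).
  by apply: closed_lebesgue_measurable; exact: closed_closure.
have f_out : (f : Rd -> R) = (f : Rd -> R) \_ (closure Q).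
  apply/funext => x; rewrite /patch; case: ifPn => // /negP xQ.
  by apply: (test_Q_out hDQ) => // Qx; apply: xQ; rewrite inE.
rewrite f_out; apply/(measurable_restrictT _ _).1 => //.
have /continuousP cf := test_Q_continuous hDQ Df.
apply: (measurability _ (RGenOpens.measurableE R)).
move=> _ [_ [a [b ->] <-]].
have /open_subspaceP[V oV VD] := cf _ (@interval_open R (BRight a) (BLeft b) isT isT).
rewrite setIC -VD; apply: measurableI => //; exact: open_lebesgue_measurable.
Qed.

Lemma test_Q_bounded f : DQ f -> exists M, forall x, `|f x| <= M.
Proof.
move=> Df; have cQ : compact (closure Q).
  apply: bounded_closed_compact; last exact: closed_closure.
  have [M [Mr MQ]] := bQ; exists M; split => // N MN x.
  have cN : closed [set y : 'rV[R]_d | `|y| <= N].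
    apply: (@preimage_closed _ _ (fun y : 'rV[R]_d => `|y|) [set x | x <= N]).
      by move=> y _; exact: norm_continuous.
    exact: closed_le.
  by rewrite [X in _ -> X x](closure_id _).1//; apply: closureS; exact: MQ.
have [M [Mr HM]] := compact_bounded (continuous_compact (test_Q_continuous hDQ Df) cQ).
exists (Num.max 0 (M + 1)) => x; have [xQ|xQ] := pselect (closure Q x).
  by rewrite le_max (HM (M + 1)) ?orbT// ?ltrDl//.
by rewrite (test_Q_out hDQ Df xQ) normr0 le_max lexx.
Qed.

Lemma testA_measurable f : testA DO DQ f -> measurable_fun setT f.
Proof.
move=> [a Da [b Db ->]]; apply: measurable_funM.
  exact: measurableT_comp (test_Omega_measurable hDO Da) measurable_fst.
exact: measurableT_comp (test_Q_measurable Db) measurable_snd.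
Qed.

Lemma testA_bounded f : testA DO DQ f -> exists M, forall z, `|f z| <= M.
Proof.
move=> [a Da [b Db ->]].
have [M1 h1] := test_Omega_bounded hDO Da; have [M2 h2] := test_Q_bounded Db.
by exists (M1 * M2) => z; rewrite normrM ler_pM.
Qed.

Lemma testA_testD f : testA DO DQ f -> testD DO DQ f.
Proof.
move=> Af; exists 1%N, (fun=> 1), (fun=> f); split => //.
by apply/funext => z; rewrite big_ord_recl big_ord0 mul1r addr0.
Qed.

Lemma testD_measurable f : testD DO DQ f -> measurable_fun setT f.
Proof.
move=> [n [c [g [Ag ->]]]]; apply: measurable_sum => i.
by apply: measurable_funM => //; exact: testA_measurable.
Qed.

Lemma testD_bounded f : testD DO DQ f -> exists M, forall z, `|f z| <= M.
Proof.
move=> [n [c [g [Ag ->]]]].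
have [M hM] := choice (fun i => testA_bounded (Ag i)).
exists (\sum_i `|c i| * M i) => z.
apply: le_trans (ler_norm_sum _ _ _) _; apply: ler_sum => i _.
by rewrite normrM ler_wpM2l.
Qed.

End test_functions.

(** * The measure-preserving shear of Omega x R^d *)

Section shear.
Context (R : realType) (dO : measure_display) (Om : measurableType dO)
  (P : probability Om R) (d : nat) (tau : 'rV[R]_d -> Om -> Om)
  (htau : ergodic_dynamical_system P tau).
Local Notation Rd := (lebesgueRd R d).
Local Open Scope ereal_scope.

(* [Tstar tau eps f] is [f \o shear eps^-1]. *)
Definition shear (c : R) (z : Om * Rd) : Om * Rd :=
  (tau (c *: (z.2 : 'rV[R]_d)) z.1, z.2).

Lemma measurable_shear (c : R) : (0 < c)%R -> measurable_fun setT (shear c).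
Proof.
move=> c0; apply/measurable_fun_pair => /=; last exact: measurable_snd.
have m1 : measurable_fun setT
    (fun z : Om * Rd => (z.1, (c *: (z.2 : 'rV[R]_d))%R) : Om * Rd).
  apply/measurable_fun_pair => /=; first exact: measurable_fst.
  exact: measurableT_comp (measurable_scale c0) measurable_snd.
exact: measurableT_comp (tau_jointly_measurable htau) m1.
Qed.

Lemma integral_tau y (F : Om -> \bar R) : measurable_fun setT F ->
  (forall w, 0 <= F w) -> \int[P]_w F (tau y w) = \int[P]_w F w.
Proof.
move=> mF F0.
have mt := tau_measurable htau y.
rewrite -[LHS](@ge0_integral_pushforward _ _ _ _ _ (tau y) mt P setT F)//.
apply: eq_measure_integral => A mA _ /=; rewrite /pushforward.
(* Invariance is assumed for images; the preimage under [tau y] is the image under [tau (- y)]. *)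
rewrite -(tau_preserving htau (- y)%R mA); congr (P _).
apply/seteqP; split => [w /= Aw|_ [w Aw <-] /=].
  exists (tau y w) => //.
  by have := tau_add htau (- y)%R y; rewrite addNr (tau_0 htau) => /(congr1 (@^~ w)).
have := tau_add htau y (- y)%R; rewrite addrN (tau_0 htau) => /(congr1 (@^~ w)) /= <-.
by [].
Qed.

(** For fixed x the shear is the measure-preserving map [tau (c *: x)] of Omega, so integrating over
    Omega first removes it. Thus L^1 approximations on the product survive the passage to
    realizations, on average over w. *)
Lemma integral_shear (lam : {sigma_finite_measure set Rd -> \bar R}) c
    (F : Om * Rd -> \bar R) : (0 < c)%R -> measurable_fun setT F ->
  (forall z, 0 <= F z) ->
  \int[P \x lam]_z F (shear c z) = \int[P \x lam]_z F z.
Proof.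
move=> c0 mF F0; rewrite (fubini_tonelli2 (F \o shear c)) /=; last 2 first.
- exact: measurableT_comp mF (measurable_shear c0).
- by move=> z; exact: F0.
rewrite (@fubini_tonelli2 _ _ _ _ _ P lam F mF F0); apply: eq_integral => x _.
rewrite /fubini_G /shear /=.
rewrite (@integral_tau _ (fun w => F (w, x)))//.
exact: measurableT_comp mF (pair2_measurable x).
Qed.

End shear.

(** * L^1 density of test functions *)

Section L1_distance.
Context d (T : measurableType d) (R : realType) (mu : {measure set T -> \bar R}).
Local Open Scope ereal_scope.

Lemma bounded_integrable (f : T -> R) (M : R) : mu setT < +oo ->
  measurable_fun setT f -> (forall x, `|f x|%R <= M)%R ->
  mu.-integrable setT (EFin \o f).
Proof.
move=> muoo mf fM; apply/integrableP; split; first exact/measurable_EFinP.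
apply: (@le_lt_trans _ _ (\int[mu]_x (cst `|M|%:E x))).
  apply: ge0_le_integral => //.
  - by apply/measurable_EFinP; exact: measurableT_comp.
  - by move=> x _; rewrite lee_fin (le_trans (fM x))// ler_norm.
by rewrite integral_cst// lte_mul_pinfty// lee_fin.
Qed.

Definition L1dist (f g : T -> R) : \bar R := \int[mu]_z `|(f z - g z)%R|%:E.

Lemma L1dist_ge0 f g : 0 <= L1dist f g.
Proof. by apply: integral_ge0 => z _; rewrite lee_fin. Qed.

Lemma L1distC f g : L1dist f g = L1dist g f.
Proof. by apply: eq_integral => z _; rewrite distrC. Qed.

Let measurable_dist (f g : T -> R) : measurable_fun setT f ->
  measurable_fun setT g -> measurable_fun setT (fun z => `|(f z - g z)%R|%:E).
Proof.
move=> mf mg; apply/measurable_EFinP; apply: measurableT_comp => //.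
exact: measurable_funB.
Qed.

Lemma L1dist_triangle f g h : measurable_fun setT f -> measurable_fun setT g ->
  measurable_fun setT h -> L1dist f h <= L1dist f g + L1dist g h.
Proof.
move=> mf mg mh; rewrite -ge0_integralD//; try exact: measurable_dist;
  try by move=> *; rewrite lee_fin.
apply: ge0_le_integral => //; first exact: measurable_dist.
  by apply: emeasurable_funD; exact: measurable_dist.
by move=> z _; rewrite -EFinD lee_fin ler_distD.
Qed.

Lemma L1distD (f g f' g' : T -> R) : measurable_fun setT f -> measurable_fun setT g ->
  measurable_fun setT f' -> measurable_fun setT g' ->
  L1dist (f \+ g)%R (f' \+ g')%R <= L1dist f f' + L1dist g g'.
Proof.
move=> mf mg mf' mg'; rewrite -ge0_integralD//; try exact: measurable_dist;
  try by move=> *; rewrite lee_fin.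
apply: ge0_le_integral => //.
- by apply: measurable_dist; exact: measurable_funD.
- by apply: emeasurable_funD; exact: measurable_dist.
by move=> z _; rewrite -EFinD lee_fin /= opprD addrACA ler_normD.
Qed.

End L1_distance.

Section product_density.
Context (R : realType) (d1 d2 : measure_display) (T1 : measurableType d1)
  (T2 : measurableType d2) (m1 : {sigma_finite_measure set T1 -> \bar R})
  (m2 : {sigma_finite_measure set T2 -> \bar R}).
Local Open Scope ereal_scope.

Lemma integral_prod_mul (F : T1 -> \bar R) (G : T2 -> \bar R) :
  measurable_fun setT F -> measurable_fun setT G ->
  (forall x, 0 <= F x) -> (forall y, 0 <= G y) ->
  \int[m1 \x m2]_z (F z.1 * G z.2) = \int[m1]_x F x * \int[m2]_y G y.
Proof.
move=> mF mG F0 G0.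
rewrite (fubini_tonelli1 (fun z => F z.1 * G z.2)) /=; last 2 first.
- apply: emeasurable_funM; first exact: measurableT_comp mF measurable_fst.
  exact: measurableT_comp mG measurable_snd.
- by move=> z; rewrite mule_ge0.
rewrite /fubini_F /=.
under eq_integral => x _ do rewrite ge0_integralZl//.
by rewrite ge0_integralZr// integral_ge0.
Qed.

Hypotheses (m1oo : m1 setT < +oo) (m2oo : m2 setT < +oo).
Context (a : nat -> T1 -> R) (b : nat -> T2 -> R).
Hypotheses (ia : forall n, m1.-integrable setT (EFin \o a n))
  (ib : forall n, m2.-integrable setT (EFin \o b n)).
Hypothesis a_dense : forall f : T1 -> R, m1.-integrable setT (EFin \o f) ->
  forall r : R, (0 < r)%R -> exists n, L1dist m1 f (a n) < r%:E.
Hypothesis b_dense : forall f : T2 -> R, m2.-integrable setT (EFin \o f) ->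
  forall r : R, (0 < r)%R -> exists n, L1dist m2 f (b n) < r%:E.

(** No coefficients occur: the [a n] are dense in L^1, so a scalar is absorbed into the first
    factor. The index type is then countable. *)
Definition prod_sum (s : seq (nat * nat)) (z : T1 * T2) : R :=
  (\sum_(ij <- s) a ij.1 z.1 * b ij.2 z.2)%R.

Let ma n : measurable_fun setT (a n).
Proof. by apply/measurable_EFinP; apply: measurable_int (ia n). Qed.

Let mb n : measurable_fun setT (b n).
Proof. by apply/measurable_EFinP; apply: measurable_int (ib n). Qed.

Lemma measurable_prod_sum s : measurable_fun setT (prod_sum s).
Proof.
apply: measurable_sum => ij; apply: measurable_funM.
  exact: measurableT_comp (ma _) measurable_fst.
exact: measurableT_comp (mb _) measurable_snd.
Qed.

Let mu := (m1 \x m2).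

Let approx (f : T1 * T2 -> R) := measurable_fun setT f /\
  forall r : R, (0 < r)%R -> exists s, L1dist mu f (prod_sum s) < r%:E.

Let approx_closed f : measurable_fun setT f ->
  (forall r : R, (0 < r)%R -> exists2 g, approx g & L1dist mu f g < r%:E) ->
  approx f.
Proof.
move=> mf H; split=> // r r0.
have [g [mg Hg] fg] := H (r / 2)%R (divr_gt0 r0 (ltr0n _ 2)).
have [s gs] := Hg (r / 2)%R (divr_gt0 r0 (ltr0n _ 2)).
exists s; apply: le_lt_trans (L1dist_triangle _ mf mg (measurable_prod_sum s)) _.
by rewrite [in ltRHS](splitr r) EFinD lteD.
Qed.

Let approx0 : approx (cst 0%R).
Proof.
split=> // r r0; exists [::]; rewrite (_ : L1dist _ _ _ = 0) ?lte_fin//.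
by apply: integral0_eq => z _; rewrite /prod_sum big_nil subrr normr0.
Qed.

Let approxD (f g : T1 * T2 -> R) : approx f -> approx g -> approx (f \+ g)%R.
Proof.
move=> [mf Hf] [mg Hg]; split=> [|r r0]; first exact: measurable_funD.
have [s fs] := Hf (r / 2)%R (divr_gt0 r0 (ltr0n _ 2)).
have [t gt] := Hg (r / 2)%R (divr_gt0 r0 (ltr0n _ 2)).
exists (s ++ t).
rewrite (_ : prod_sum (s ++ t) = prod_sum s \+ prod_sum t)%R; last first.
  by apply/funext => z; rewrite /prod_sum big_cat.
apply: le_lt_trans (L1distD _ mf mg (measurable_prod_sum s) (measurable_prod_sum t)) _.
by rewrite [in ltRHS](splitr r) EFinD lteD.
Qed.

Let indic_rect (c : R) A B : measurable A -> measurable B ->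
  approx (fun z => c * \1_(A `*` B) z)%R.
Proof.
move=> mA mB.
have mfA : measurable_fun setT (fun x => (c * \1_A x)%R).
  by apply: measurable_funM => //; exact: measurable_indic.
have mfB : measurable_fun setT (\1_B : T2 -> R) by exact: measurable_indic.
have E : (fun z => c * \1_(A `*` B) z)%R = (fun z => c * \1_A z.1 * \1_B z.2)%R.
  by apply/funext => z; rewrite -mulrA; congr (c * _)%R; rewrite !indicE in_setX;
    case: (_ \in A); case: (_ \in B); rewrite ?mulr0 ?mulr1 ?mul0r.
rewrite E; split.
  apply: measurable_funM; first exact: measurableT_comp mfA measurable_fst.
  exact: measurableT_comp mfB measurable_snd.
move=> r r0.
have icA : m1.-integrable setT (EFin \o (fun x => c * \1_A x)%R).
  rewrite (_ : _ \o _ = (fun x => c%:E * (\1_A x)%:E))//.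
  apply: integrableZl => //; apply: (bounded_integrable (M := 1)) => //.
  by move=> x; rewrite indicE; case: (_ \in _); rewrite ?normr1 ?normr0.
have iB : m2.-integrable setT (EFin \o (\1_B : T2 -> R)).
  apply: (bounded_integrable (M := 1)) => //.
  by move=> x; rewrite indicE; case: (_ \in _); rewrite ?normr1 ?normr0.
have m2f : m2 B \is a fin_num.
  rewrite ge0_fin_numE// (le_lt_trans _ m2oo)// le_measure// ?inE//.
pose M := fine (m2 B); have M0 : (0 <= M)%R by rewrite fine_ge0.
(* The error is split as (c 1_A - a_i) 1_B + a_i (1_B - b_j). The tolerance for b_j depends on the
   norm K of a_i, hence this order of choice; adding 1 to M and K keeps the divisors positive. *)
have [i hi] := a_dense icA (divr_gt0 (divr_gt0 r0 (ltr0n _ 2)) (ltr_wpDl M0 ltr01)).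
have Kf : \int[m1]_x `|a i x|%:E \is a fin_num.
  rewrite ge0_fin_numE; first by have /integrableP[_ h] := ia i; exact: h.
  by apply: integral_ge0 => x _; rewrite lee_fin.
pose K := fine (\int[m1]_x `|a i x|%:E).
have K0 : (0 <= K)%R by rewrite fine_ge0// integral_ge0// => x _; rewrite lee_fin.
have [j hj] := b_dense iB (divr_gt0 (divr_gt0 r0 (ltr0n _ 2)) (ltr_wpDl K0 ltr01)).
exists [:: (i, j)].
have mA' : measurable_fun setT (fun x => `|c * \1_A x - a i x|%:E).
  by apply/measurable_EFinP; apply: measurableT_comp => //; exact: measurable_funB.
have mB' : measurable_fun setT (fun x => `|\1_B x - b j x|%:E).
  by apply/measurable_EFinP; apply: measurableT_comp => //; exact: measurable_funB.
have mA'' : measurable_fun setT (fun x => `|a i x|%:E).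
  by apply/measurable_EFinP; exact: measurableT_comp.
have mB'' : measurable_fun setT (fun x => (\1_B x : R)%:E).
  exact/measurable_EFinP.
have m1' : measurable_fun setT (fun z : T1 * T2 => `|(c * \1_A z.1 - a i z.1)%R|%:E * (\1_B z.2)%:E).
  apply: emeasurable_funM; first exact: measurableT_comp mA' measurable_fst.
  exact: measurableT_comp mB'' measurable_snd.
have m2' : measurable_fun setT (fun z : T1 * T2 => `|a i z.1|%:E * `|(\1_B z.2 - b j z.2)%R|%:E).
  apply: emeasurable_funM; first exact: measurableT_comp mA'' measurable_fst.
  exact: measurableT_comp mB' measurable_snd.
apply: (@le_lt_trans _ _ (\int[mu]_z (`|(c * \1_A z.1 - a i z.1)%R|%:E * (\1_B z.2)%:E +
    `|a i z.1|%:E * `|(\1_B z.2 - b j z.2)%R|%:E))).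
  apply: ge0_le_integral => //.
  - apply/measurable_EFinP; apply: measurableT_comp => //.
    apply: measurable_funB; last exact: measurable_prod_sum.
    apply: measurable_funM; first exact: measurableT_comp mfA measurable_fst.
    exact: measurableT_comp mfB measurable_snd.
  - exact: emeasurable_funD.
  move=> z _; rewrite -!EFinM -EFinD lee_fin /prod_sum big_seq1 /=.
  have -> : (c * \1_A z.1 * \1_B z.2 - a i z.1 * b j z.2 =
    (c * \1_A z.1 - a i z.1) * \1_B z.2 + a i z.1 * (\1_B z.2 - b j z.2))%R.
    by rewrite mulrBl mulrBr addrA subrK.
  apply: le_trans (ler_normD _ _) _; rewrite !normrM.
  by rewrite [`|\1_B _|%R]ger0_norm.
rewrite ge0_integralD//.
rewrite (integral_prod_mul mA' mB'')//; try by move=> ?; rewrite lee_fin.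
rewrite (integral_prod_mul mA'' mB')//; try by move=> ?; rewrite lee_fin.
have -> : \int[m2]_y (\1_B y)%:E = M%:E by rewrite integral_indic// setIT fineK.
rewrite -(fineK Kf) -/K.
rewrite [in ltRHS](splitr r) EFinD; apply: lteD.
  apply: (@le_lt_trans _ _ (L1dist m1 (fun x => c * \1_A x)%R (a i) * (M + 1)%:E)).
    by rewrite lee_wpmul2l ?L1dist_ge0// lee_fin lerDl.
  by rewrite -lte_pdivlMr// ltr_wpDl.
apply: (@le_lt_trans _ _ ((K + 1)%:E * L1dist m2 \1_B (b j))).
  by rewrite lee_wpmul2r ?L1dist_ge0// lee_fin lerDl.
by rewrite muleC -lte_pdivlMr// ltr_wpDl.
Qed.

(** Dynkin's theorem for the pi-system of rectangles; disjoint countable unions are L^1 limits of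
    finite ones because the measure is finite. *)
Let approx_indic (c : R) A : measurable A -> approx (fun z => c * \1_A z)%R.
Proof.
have muoo : mu setT < +oo.
  by rewrite -setXTT /mu product_measure1E// lte_mul_pinfty// ge0_fin_numE.
rewrite measurable_prod_measurableType => mA; move: c; move: A mA.
(* The scalar is quantified inside the predicate because the complement of A uses the hypothesis on
   A with - c. *)
apply: (dynkin_induction (P := fun A => forall c, approx (fun z => c * \1_A z)%R)).
- exact: measurable_prod_measurableType.
- move=> _ _ [A1 mA1 [B1 mB1 <-]] [A2 mA2 [B2 mB2 <-]].
  exists (A1 `&` A2); first exact: measurableI.
  exists (B1 `&` B2); first exact: measurableI.
  by rewrite setXI.
- by move=> c; rewrite -setXTT; exact: indic_rect.
- by move=> _ [A mA [B mB <-]] c; exact: indic_rect.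
- move=> A mA HA c.
  rewrite (_ : (fun _ => _) = (fun z => c * \1_(setT `*` setT) z) \+ (fun z => - c * \1_A z))%R.
    by apply: approxD; [exact: indic_rect|exact: HA].
  apply/funext => z; rewrite /= setXTT indicT mulr1 mulNr -[X in (X - _)%R]mulr1 -mulrBr.
  by rewrite !indicE in_setC; case: (_ \in A); rewrite ?subrr ?subr0.
move=> F mF tF HF c.
have mU : measurable (\bigcup_k F k) by exact: bigcupT_measurable.
pose g n z := (c * \1_(\big[setU/set0]_(k < n) F k) z)%R.
have mgU n : measurable (\big[setU/set0]_(k < n) F k) by exact: bigsetU_measurable.
have mg n : measurable_fun setT (g n : T1 * T2 -> R).
  by apply: measurable_funM => //; exact: measurable_indic.
have ag n : approx (g n).
  elim: n => [|n IH].
    rewrite (_ : g 0%N = cst 0%R); first exact: approx0.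
    by apply/funext => z; rewrite /g big_ord0 indic0 mulr0.
  rewrite (_ : g n.+1 = g n \+ (fun z => c * \1_(F n) z))%R; first exact: approxD.
  apply/funext => z; rewrite /g /= -mulrDr; congr (c * _)%R.
  rewrite big_ord_recr /= !indicE in_setU.
  have [zn|zn] := boolP (z \in F n); last by rewrite orbF addr0.
  rewrite orbT memNset ?add0r// => zU.
  have /trivIsetP tF' := tF; move: zU; rewrite -bigcup_mkord => -[k /= kn Fk].
  have := tF' k n I I; rewrite ltn_eqF// => /(_ isT).
  by rewrite -subset0 => /(_ z); apply; split => //; rewrite inE in zn.
have mf : measurable_fun setT (fun z => c * \1_(\bigcup_k F k) z)%R.
  by apply: measurable_funM => //; exact: measurable_indic.
apply: approx_closed => // r r0.
have [] := @dominated_convergence _ _ _ mu setT measurableT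
  (fun n => EFin \o g n) (EFin \o (fun z => c * \1_(\bigcup_k F k) z)%R) (cst `|c|%:E).
- by move=> n; exact/measurable_EFinP.
- exact/measurable_EFinP.
- apply: aeW => z _; apply: cvg_EFin; first by apply: nearW.
  apply/cvgrPdist_lt => e e0.
  have [[k _ Fk]|nF] := pselect ((\bigcup_k F k) z); near=> n.
    have kn : (k < n)%N by near: n; exact: nbhs_infty_gt.
    rewrite /= /g !indicE !mem_set ?subrr ?normr0//.
      by rewrite -bigcup_mkord; exists k.
    by exists k.
  rewrite /= /g !indicE !memNset ?subrr ?normr0// -bigcup_mkord.
  by move=> [k _ Fk]; apply: nF; exists k.
- apply: (bounded_integrable (f := cst `|c|%R) (M := `|c|%R)) => // x.
  by rewrite /= normr_id.
- apply: aeW => z n _ /=; rewrite lee_fin /g normrM ler_piMr//.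
  by rewrite indicE; case: (_ \in _); rewrite ?normr1 ?normr0.
move=> _ /fine_cvgP[gfin /cvgrPdist_lt gf] _.
have := filterI gfin (gf r r0) => -[N _ /(_ N (leqnn N))[fN HN]].
exists (g N) => //; rewrite L1distC /L1dist -[ltLHS]fineK//.
by rewrite lte_fin; apply: le_lt_trans HN; rewrite sub0r normrN ler_norm.
Unshelve. all: by end_near. Qed.

Import HBSimple.

Lemma product_L1_dense (f : T1 * T2 -> R) : mu.-integrable setT (EFin \o f) ->
  forall r : R, (0 < r)%R -> exists s, L1dist mu f (prod_sum s) < r%:E.
Proof.
move=> intf; suff [] : approx f by [].
apply: approx_closed; first by apply/measurable_EFinP; apply: measurable_int intf.
have [g [_ _ /fine_cvgP[gfin /cvgrPdist_lt gf]]] := approximation_sfun_integrable measurableT intf.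
move=> r r0; have := filterI gfin (gf r r0) => -[N _ /(_ N (leqnn N))[fN HN]].
exists (g N); last first.
  rewrite /L1dist -[ltLHS]fineK//.
  by rewrite lte_fin; apply: le_lt_trans HN; rewrite sub0r normrN ler_norm.
have [rs gE] : exists rs : seq R,
    (g N : T1 * T2 -> R) = (fun z => \sum_(y <- rs) y * \1_(g N @^-1` [set y]) z)%R.
  exists (finmap.enum_fset (fset_set (range (g N)))).
  by apply/funext => z; rewrite fimfunE fsbig_finite.
rewrite gE; elim: rs {gE} => [|y s IH].
  by rewrite (_ : (fun _ => _) = cst 0%R)//; apply/funext => z; rewrite big_nil.
rewrite (_ : (fun _ => _) = (fun z => y * \1_(g N @^-1` [set y]) z) \+ (fun z => \sum_(y <- s) y * \1_(g N @^-1` [set y]) z))%R.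
  by apply: approxD => //; apply: approx_indic; rewrite -[X in measurable X]setTI; exact: measurable_funP.
by apply/funext => z; rewrite /= big_cons.
Qed.

End product_density.

(** * Weak Borel sets of L^p *)

Section Lp_in_L1.
Context d (T : measurableType d) (R : realType) (mu : {measure set T -> \bar R}).
Hypothesis muoo : (mu setT < +oo)%E.
Context (p : R) (hp : 1 < p).
Local Open Scope ereal_scope.

Let p0 : (0 < p)%R. Proof. exact: lt_trans hp. Qed.

Lemma conjugate_gt0 : (0 < conjugate p)%R.
Proof. by rewrite divr_gt0// subr_gt0. Qed.

Lemma conjugate_inv : (p^-1 + (conjugate p)^-1 = 1)%R.
Proof.
rewrite /conjugate invf_div -[X in (X + _)%R]mul1r -mulrDl addrC subrK mulfV//.
by rewrite gt_eqF.
Qed.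

Definition Lp_L1_cst : R := (fine (mu setT) `^ (conjugate p)^-1)%R.

Lemma Lp_L1_cst_ge0 : (0 <= Lp_L1_cst)%R.
Proof. exact: powR_ge0. Qed.

Lemma L1_le_Lp (f : T -> R) : measurable_fun setT f ->
  \int[mu]_z `|f z|%:E <= 'N[mu]_p%:E[EFin \o f] * Lp_L1_cst%:E.
Proof.
move=> mf.
have := @hoelder _ _ _ mu f (cst 1%R) p (conjugate p) mf (measurable_cst _) p0 conjugate_gt0 conjugate_inv.
rewrite Lnorm1 (_ : (EFin \o cst 1%R) = (cst 1))// Lnorm_cst1.
rewrite -[mu setT]fineK ?ge0_fin_numE// poweR_EFin => /(le_trans _); apply.
by apply: ge0_le_integral => //; [exact/measurable_EFinP/measurableT_comp
 |apply/measurable_EFinP/measurableT_comp => //; exact: measurable_funM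
 |by move=> z _ /=; rewrite mulr1].
Qed.

Lemma Lp_integrable (f : LfunType mu (exponent_ge1 hp)) :
  mu.-integrable setT (EFin \o f).
Proof.
have mf : measurable_fun setT (f : T -> R) by exact: measurable_funP.
apply/integrableP; split; first exact/measurable_EFinP.
apply: le_lt_trans (L1_le_Lp mf) _.
rewrite lte_mul_pinfty ?Lnorm_ge0//; last by exact: ltry.
by rewrite ge0_fin_numE ?Lnorm_ge0//; exact: Lfunction_finite.
Qed.

Lemma le_Lnorm (f g : T -> R) : measurable_fun setT f -> measurable_fun setT g ->
  (forall z, `|f z| <= `|g z|)%R ->
  'N[mu]_p%:E[EFin \o f] <= 'N[mu]_p%:E[EFin \o g].
Proof.
move=> mf mg fg; rewrite unlock /Lnorm.
have mP (h : T -> R) : measurable_fun setT h ->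
    measurable_fun setT (fun x => `|(h x)%:E| `^ p).
  move=> mh; under eq_fun do rewrite abse_EFin poweR_EFin.
  apply/measurable_EFinP; apply: (measurableT_comp (measurable_powR _)) => //.
  exact: measurableT_comp.
apply: gt0_ler_poweR.
- by rewrite invr_ge0 ltW.
- by rewrite in_itv /= integral_ge0//= ?leey// => *; rewrite poweR_ge0.
- by rewrite in_itv /= integral_ge0//= ?leey// => *; rewrite poweR_ge0.
apply: ge0_le_integral => //; [by move=> *; exact: poweR_ge0|exact: mP|exact: mP|].
move=> z _; rewrite /= !lee_fin ge0_ler_powR ?nnegrE//.
exact: ltW.
Qed.

Lemma measurable_vnorm m (u : 'I_m -> T -> R) : (forall i, measurable_fun setT (u i)) ->
  measurable_fun setT (fun z => Num.sqrt (\sum_i u i z ^+ 2)).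
Proof.
move=> mu_; apply: (@measurableT_comp _ _ _ _ _ _ (@Num.sqrt R)).
  by apply: continuous_measurable_fun; exact: sqrt_continuous.
by apply: measurable_sum => i; exact: measurable_funX.
Qed.

Lemma Lnorm_le_vnorm m (u : 'I_m -> T -> R) i :
  (forall i, measurable_fun setT (u i)) ->
  'N[mu]_p%:E[EFin \o u i] <= vnorm mu p u.
Proof.
move=> mu_; apply: (le_Lnorm (g := fun z => Num.sqrt (\sum_i u i z ^+ 2))) => //.
  exact: measurable_vnorm.
move=> z; rewrite [leRHS]ger0_norm ?sqrtr_ge0// -sqrtr_sqr ler_sqrt; last first.
  by apply: sumr_ge0 => j _; rewrite sqr_ge0.
by rewrite (bigD1 i)//= lerDl sumr_ge0// => j _; rewrite sqr_ge0.
Qed.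

End Lp_in_L1.

Section weak_borel.
Context d (T : measurableType d) (R : realType) (mu : {measure set T -> \bar R}).
Hypothesis muoo : (mu setT < +oo)%E.
Context (p : R) (hp : 1 < p) (m : nat).
Local Notation V := ('I_m -> LfunType mu (exponent_ge1 hp)).
Local Notation W := (weakLp mu hp m).

Section pairing.
Context (i : 'I_m) (s : T -> R).
Hypotheses (ms : measurable_fun setT s) (s1 : forall z, `|s z| <= 1).

Let int_pairing (v : V) : mu.-integrable setT (fun z => (v i z * s z)%:E).
Proof.
apply: (le_integrable measurableT _ _ (Lp_integrable muoo (v i))).
  by apply/measurable_EFinP; exact: measurable_funM.
by move=> z _; rewrite /= lee_fin normrM ler_piMr.
Qed.

Definition pairing (v : V) : R := fine (\int[mu]_z (v i z * s z)%:E).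

Let pairing_scalar : scalar pairing.
Proof.
move=> a v w; rewrite /pairing.
have -> : (\int[mu]_z ((a *: v + w) i z * s z)%:E =
   \int[mu]_z (a%:E * (v i z * s z)%:E + (w i z * s z)%:E))%E.
  by apply: eq_integral => z _; rewrite -EFinM -EFinD mulrA -mulrDl.
rewrite integralD//=; last by apply: integrableZl.
rewrite integralZl// fineD ?fineM//; try exact: integrable_fin_num.
by rewrite fin_numM//; exact: integrable_fin_num.
Qed.

(** Provides the packed bounded functional that [weak_open] asks for; its bound is the embedding of
    L^p into L^1. *)
Lemma pairing_functional :
  exists2 l : {scalar V}, bounded_functional l & forall v, l v = pairing v.
Proof.
pose lm := GRing.isLinear.Build R V R *%R pairing pairing_scalar.
pose l : {scalar V} := HB.pack pairing lm.
exists l => //; exists (Lp_L1_cst mu p) => v /=; rewrite -/(pairing v).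
have mv j : measurable_fun setT (v j : T -> R) by exact: measurable_funP.
rewrite -abse_EFin fineK; last exact: integrable_fin_num.
apply: le_trans (le_abse_integral mu measurableT (measurable_int _ (int_pairing v))) _.
apply: (@le_trans _ _ (\int[mu]_z `|v i z|%:E)%E).
  apply: ge0_le_integral => //.
  - by apply: measurableT_comp => //; exact: measurable_int (int_pairing v).
  - by apply/measurable_EFinP; exact: measurableT_comp.
  by move=> z _; rewrite /= lee_fin normrM ler_piMr.
apply: le_trans (L1_le_Lp muoo hp (mv i)) _.
by rewrite muleC lee_wpmul2l ?lee_fin ?Lp_L1_cst_ge0// Lnorm_le_vnorm.
Qed.

Lemma pairingE (v : V) : ((pairing v)%:E = \int[mu]_z (v i z * s z)%:E)%E.
Proof. by rewrite fineK//; exact: integrable_fin_num. Qed.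

End pairing.

(* The complement is weakly open: test against the sign of [v i - g]. *)
Lemma measurable_L1_ball (g : T -> R) (i : 'I_m) (r : R) :
  mu.-integrable setT (EFin \o g) ->
  measurable ([set v : W | (L1dist mu (v i) g <= r%:E)%E] : set (borel W)).
Proof.
move=> ig; rewrite -[X in measurable X]setCK; apply: measurableC.
apply: sub_sigma_algebra.
suff : weak_open (~` [set v : V | (L1dist mu (v i) g <= r%:E)%E]) by [].
move=> v /= /negP; rewrite -ltNge => rv.
have mg : measurable_fun setT g by apply/measurable_EFinP/(measurable_int _ ig).
have mv (w : V) j : measurable_fun setT (w j : T -> R) by exact: measurable_funP.
pose s z : R := if 0 <= v i z - g z then 1 else -1.
have ms : measurable_fun setT s.
  apply: measurable_fun_ifT => //.
  by apply: measurable_fun_ler => //; exact: measurable_funB.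
have s1 z : `|s z| <= 1 by rewrite /s; case: ifP; rewrite ?normrN normr1.
have igs : mu.-integrable setT (fun z => (g z * s z)%:E).
  apply: (le_integrable measurableT _ _ ig).
    by apply/measurable_EFinP; exact: measurable_funM.
  by move=> z _; rewrite /= lee_fin normrM ler_piMr.
have ivs (w : V) : mu.-integrable setT (fun z => (w i z * s z)%:E).
  apply: (le_integrable measurableT _ _ (Lp_integrable muoo (w i))).
    by apply/measurable_EFinP; exact: measurable_funM.
  by move=> z _; rewrite /= lee_fin normrM ler_piMr.
pose G := fine (\int[mu]_z (g z * s z)%:E)%E.
have GE : (G%:E = \int[mu]_z (g z * s z)%:E)%E.
  by rewrite fineK//; exact: integrable_fin_num.
have vE : (L1dist mu (v i) g = (pairing i s v - G)%:E)%E.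
  rewrite EFinB (pairingE i ms s1) GE -integralB//; apply: eq_integral => z _.
  rewrite -EFinB -mulrBl; congr EFin; rewrite /s; case: ifPn => [h|].
    by rewrite ger0_norm// mulr1.
  by rewrite -ltNge => h; rewrite ltr0_norm// mulrN1.
have wE (w : V) : ((pairing i s w - G)%:E <= L1dist mu (w i) g)%E.
  rewrite EFinB (pairingE i ms s1) GE -integralB//.
  apply: le_trans (lee_abs _) _.
  apply: le_trans (le_abse_integral _ _ _) _ => //.
    by apply: emeasurable_funB; apply: measurable_int; [exact: ivs|exact: igs].
  apply: ge0_le_integral => //.
  - by apply: measurableT_comp => //; apply: emeasurable_funB; apply: measurable_int; [exact: ivs|exact: igs].
  - by apply/measurable_EFinP; apply: measurableT_comp => //; exact: measurable_funB.
  by move=> z _; rewrite -EFinB -mulrBl /= lee_fin normrM ler_piMr.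
move: rv; rewrite vE lte_fin => rv.
(* The pairing equals the L^1 distance (up to G) at v and is a lower bound for it elsewhere, so w
   stays outside the ball while its pairing differs from that of v by less than this margin. *)
have r0 : 0 < pairing i s v - G - r by rewrite subr_gt0.
have [l bl lE] := pairing_functional i ms s1.
exists 1%N, (fun=> l), (PosNum r0); split => // w /(_ ord0) /=.
rewrite !lE ltr_norml => /andP[h _] /=.
apply/negP; rewrite -ltNge; apply: lt_le_trans (wE w).
by rewrite lte_fin; move: h; move: (pairing i s w) (pairing i s v) => a b; lra.
Qed.

(** Separability: an L^1-open set is a countable union of products of closed L^1 balls with centres
    among the [c n] and radii 1 / (k + 1). The centres need only lie in L^1, as in
    [measurable_L1_ball]. *)
Lemma measurable_L1_open (c : nat -> T -> R) (U : set W) :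
  (forall n, mu.-integrable setT (EFin \o c n)) ->
  (forall f : T -> R, mu.-integrable setT (EFin \o f) ->
   forall r : R, 0 < r -> exists n, (L1dist mu f (c n) < r%:E)%E) ->
  (forall v, U v -> exists2 r : R, 0 < r &
     forall w : W, (forall i, (L1dist mu (v i) (w i) <= r%:E)%E) -> U w) ->
  measurable (U : set (borel W)).
Proof.
move=> ic cd oU.
pose B (k : {ffun 'I_m -> nat} * nat) : set W :=
  [set v | forall i, (L1dist mu (v i) (c (k.1 i)) <= (k.2.+1%:R^-1)%:E)%E].
have mB k : measurable (B k : set (borel W)).
  rewrite (_ : B k = \bigcap_(i in [set: 'I_m])
     [set v | (L1dist mu (v i) (c (k.1 i)) <= (k.2.+1%:R^-1)%:E)%E]).
    by apply: fin_bigcap_measurable => // i _; exact: measurable_L1_ball.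
  by apply/seteqP; split => [v H i _|v H i]; exact: H.
rewrite (_ : U = \bigcup_(k in [set k | B k `<=` U]) B k).
  rewrite bigcup_mkcond; apply: countable_bigcupT_measurable => // k.
  by case: ifP => // _; exact: mB.
apply/seteqP; split => [v Uv|v [k kU] /kU//].
have [r r0 rU] := oU v Uv.
have mc n : measurable_fun setT (c n) by apply/measurable_EFinP/(measurable_int _ (ic n)).
have mv (w : V) j : measurable_fun setT (w j : T -> R) by exact: measurable_funP.
(* Two radii separate v from w: one from v to the centre, one from the centre to w. *)
have [n nr] : exists n, 2 * n.+1%:R^-1 < r.
  have [n _ /(_ n (leqnn n)) nr] := near_infty_natSinv_lt (PosNum (divr_gt0 r0 (ltr0n R 2))).
  by exists n; rewrite mulrC -ltr_pdivlMr.
have [k Hk] := choice (fun i => cd _ (Lp_integrable muoo (v i)) (n.+1%:R^-1) ltac:(by rewrite invr_gt0)).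
exists ([ffun i => k i], n); last by move=> i /=; rewrite ffunE; exact/ltW/Hk.
move=> w Bw; apply: rU => i.
apply: (le_trans (L1dist_triangle mu (mv v i) (mc (k i)) (mv w i))).
apply: (@le_trans _ _ (n.+1%:R^-1 + n.+1%:R^-1)%:E); last first.
  by rewrite lee_fin; move: nr; set x := _^-1 => nr; lra.
rewrite EFinD; apply: leeD; first exact/ltW/Hk.
by rewrite L1distC; have := Bw i; rewrite /= ffunE.
Qed.

End weak_borel.

(** * Two-scale limits *)

Lemma countable_range (T : Type) (A : set T) (x0 : T) : countable A -> A x0 ->
  exists a : nat -> T, (forall n, A (a n)) /\ (forall x, A x -> exists n, a n = x).
Proof.
move=> /pfcard_geP[A0|[f]] Ax0; first by rewrite A0 in Ax0.
exists f; split => [n|x Ax]; first exact: funS.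
by have [n _ <-] := surj (f := f) Ax; exists n.
Qed.

Lemma cvge_sum (R : realType) (n : nat) (f : 'I_n -> nat -> \bar R) (l : 'I_n -> \bar R) :
  (forall i, f i k @[k --> \oo] --> l i) -> (forall i, l i \is a fin_num) ->
  (\sum_i f i k)%E @[k --> \oo] --> (\sum_i l i)%E.
Proof.
move=> fl lf; elim: (index_enum _) => [|i s IH].
  rewrite (_ : (fun k => _) = cst 0%E); last by apply/funext => k; rewrite big_nil.
  rewrite big_nil; exact: cvg_cst.
under eq_cvg do rewrite big_cons; rewrite big_cons.
by apply: cvgeD => //; rewrite fin_num_adde_defr.
Qed.

Section mul_bounded.
Context d (T : measurableType d) (R : realType) (m : {measure set T -> \bar R}).
Local Open Scope ereal_scope.

Lemma integrable_mul_bounded (u g : T -> R) (M : R) :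
  m.-integrable setT (EFin \o u) -> measurable_fun setT g ->
  (forall x, `|g x| <= M)%R -> m.-integrable setT (fun x => (u x * g x)%:E).
Proof.
move=> iu mg gM.
have mu_ : measurable_fun setT u by apply/measurable_EFinP/(measurable_int _ iu).
apply: (le_integrable measurableT _ _ (integrableZl measurableT M iu)) => /=.
  by apply/measurable_EFinP; exact: measurable_funM.
move=> x _; rewrite lee_fin !normrM mulrC ler_wpM2r// (le_trans (gM x))//.
exact: ler_norm.
Qed.

Lemma le_integral_mul_bounded (u g : T -> R) (M : R) :
  measurable_fun setT u -> measurable_fun setT g ->
  (forall x, `|g x| <= M)%R ->
  `|\int[m]_x (u x * g x)%:E| <= M%:E * \int[m]_x `|u x|%:E.
Proof.
move=> mu_ mg gM.
(* A negative bound on absolute values is possible only if T is empty. *)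
have [M0|M0] := ltP M 0%R.
  have T0 (x : T) : False.
    by have := le_trans (normr_ge0 _) (gM x); rewrite leNgt M0.
  by rewrite !integral0_eq ?abse0 ?mule0// => x; case: (T0 x).
apply: le_trans (le_abse_integral m measurableT _) _.
  by apply/measurable_EFinP; exact: measurable_funM.
rewrite -ge0_integralZl//; last by apply/measurable_EFinP; exact: measurableT_comp.
apply: ge0_le_integral => //.
- by apply/measurable_EFinP; apply: measurableT_comp => //; exact: measurable_funM.
- by apply/measurable_EFinP; apply: measurable_funM => //; exact: measurableT_comp.
by move=> x _; rewrite /= lee_fin normrM mulrC ler_wpM2r.
Qed.

Lemma le_integral_bounded (g : T -> R) (M : R) : measurable_fun setT g ->
  (forall x, `|g x| <= M)%R -> `|\int[m]_x (g x)%:E| <= M%:E * m setT.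
Proof.
move=> mg gM; apply: le_trans (le_abse_integral m measurableT _) _.
  exact/measurable_EFinP.
rewrite -integral_cst//; apply: ge0_le_integral => //.
- by apply/measurable_EFinP; exact: measurableT_comp.
- by move=> x _; rewrite /= lee_fin.
Qed.

Lemma integral_mul_sum (u : T -> R) n (c : 'I_n -> R) (g : 'I_n -> T -> R) :
  m.-integrable setT (EFin \o u) -> (forall i, measurable_fun setT (g i)) ->
  (forall i, exists M, forall x, `|g i x| <= M)%R ->
  \int[m]_x (u x * \sum_i c i * g i x)%:E =
  \sum_i (c i)%:E * \int[m]_x (u x * g i x)%:E.
Proof.
move=> iu mg gM.
have iug i : m.-integrable setT (fun x => (u x * g i x)%:E).
  by have [M hM] := gM i; exact: integrable_mul_bounded (mg i) hM.
under eq_integral => x _.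
  rewrite mulr_sumr -sumEFin.
  under eq_bigr => i _ do rewrite mulrCA EFinM.
  over.
rewrite integral_sum//=; last by move=> i; exact: integrableZl.
by apply: eq_bigr => i _; rewrite integralZl.
Qed.

End mul_bounded.

Section setting.
Context (R : realType) (dO : measure_display) (Om : measurableType dO)
  (P : probability Om R) (d : nat) (tau : 'rV[R]_d -> Om -> Om)
  (p : R) (hp : 1 < p) (Q : set 'rV[R]_d) (oQ : open Q) (bQ : bounded_set Q)
  (DO : set (Om -> R)) (DQ : set ('rV[R]_d -> R)) (Om0 : set Om).
Local Notation Rd := (lebesgueRd R d).
Local Notation leb := (@lebesgue R d).
Local Notation lam := (lebesgue_on oQ).
Local Notation mu := (P \x lam)%E.
Hypotheses (htau : ergodic_dynamical_system P tau) (hDO : test_Omega P DO)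
  (hDQ : test_Q oQ DQ).
Local Open Scope ereal_scope.

Lemma product_measure_lty : mu setT < +oo.
Proof.
rewrite -setXTT product_measure1E// lte_mul_pinfty ?fin_num_measure//.
exact: lebesgue_on_lty.
Qed.

Lemma countable_testA :
  exists f : nat -> Om * Rd -> R, (forall n, testA DO DQ (f n)) /\
    forall g, testA DO DQ g -> exists n, f n = g.
Proof.
have [a [Da aD]] := countable_range (test_Omega_countable hDO) (test_Omega_1 hDO).
have [b [Db bD]] := countable_range (test_Q_countable hDQ) (test_Q_1 hDQ).
pose g (ij : nat * nat) (z : Om * Rd) : R := (a ij.1 z.1 * b ij.2 z.2)%R.
exists (fun n => if unpickle n is Some ij then g ij else g (0%N, 0%N)).
split; last first.
  move=> _ [fO /aD[i <-] [fQ /bD[j <-] ->]].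
  by exists (pickle (i, j)); rewrite pickleK.
move=> n; case: (unpickle n) => [[i j]|].
  by exists (a i) => //; exists (b j).
by exists (a 0%N) => //; exists (b 0%N).
Qed.

Lemma L1_dense_testD : exists c : nat -> Om * Rd -> R,
  (forall n, testD DO DQ (c n)) /\
  forall f : Om * Rd -> R, mu.-integrable setT (EFin \o f) ->
    forall r : R, (0 < r)%R -> exists n, L1dist mu f (c n) < r%:E.
Proof.
have [a [Da aD]] := countable_range (test_Omega_countable hDO) (test_Omega_1 hDO).
have [b [Db bD]] := countable_range (test_Q_countable hDQ) (test_Q_1 hDQ).
have Poo : P setT < +oo by rewrite -ge0_fin_numE// fin_num_measure.
have ia n : P.-integrable setT (EFin \o a n).
  have [M HM] := test_Omega_bounded hDO (Da n).
  apply: (bounded_integrable (M := M)) => //.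
  exact: test_Omega_measurable hDO _ (Da n).
have ib n : lam.-integrable setT (EFin \o (b n : Rd -> R)).
  have [M HM] := test_Q_bounded bQ hDQ (Db n).
  apply: (bounded_integrable (M := M)) => //; first exact: lebesgue_on_lty.
  exact: test_Q_measurable hDQ _ (Db n).
have ad (f : Om -> R) : P.-integrable setT (EFin \o f) ->
    forall r : R, (0 < r)%R -> exists n, L1dist P f (a n) < r%:E.
  move=> /Lfun1_integrable fL r r0.
  have [g /aD[n <-]] := test_Omega_dense hDO fL (PosNum r0).
  by rewrite Lnorm1; exists n.
have bd (f : Rd -> R) : lam.-integrable setT (EFin \o f) ->
    forall r : R, (0 < r)%R -> exists n, L1dist lam f (b n) < r%:E.
  move=> /Lfun1_integrable fL r r0.
  have [g /bD[n <-]] := test_Q_dense hDQ fL (PosNum r0).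
  by rewrite Lnorm1; exists n.
exists (fun n => prod_sum a (b : nat -> Rd -> R) (odflt [::] (unpickle n))); split; last first.
  move=> f fi r r0.
  have [s hs] := product_L1_dense Poo (lebesgue_on_lty oQ bQ) ia ib ad bd fi r0.
  by exists (pickle s); rewrite pickleK.
move=> n; set s := odflt _ _.
exists (size s), (fun=> 1%R), (fun k z => a (nth (0%N,0%N) s k).1 z.1 * b (nth (0%N,0%N) s k).2 z.2)%R.
split=> [k|].
  by exists (a (nth (0%N,0%N) s k).1) => //; exists (b (nth (0%N,0%N) s k).2).
apply/funext => z; rewrite /prod_sum (big_nth (0%N, 0%N)) big_mkord.
by apply: eq_bigr => k _; rewrite mul1r.
Qed.

Lemma testD_section f (c : R) w : (0 < c)%R -> testD DO DQ f ->
  measurable_fun setT (fun x : Rd => f (shear tau c (w, x))) /\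
  exists M, forall x : Rd, (`|f (shear tau c (w, x))| <= M)%R.
Proof.
move=> c0 Df; split.
  apply: (measurable_fun_pair2 (f := f \o shear tau c)).
  exact: measurableT_comp (testD_measurable hDO hDQ Df) (measurable_shear htau c0).
by have [M hM] := testD_bounded bQ hDO hDQ Df; exists M.
Qed.

Lemma testD_pairing_sum (u : Rd -> R) (c : R) w n (a : 'I_n -> R) g :
  (0 < c)%R -> lam.-integrable setT (EFin \o u) ->
  (forall i, testD DO DQ (g i)) ->
  \int[lam]_x (u x * \sum_i a i * g i (shear tau c (w, x)))%:E =
  \sum_i (a i)%:E * \int[lam]_x (u x * g i (shear tau c (w, x)))%:E.
Proof.
move=> c0 iu Dg.
exact: (@integral_mul_sum _ _ _ lam u n a (fun i x => g i (shear tau c (w, x))) iu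
  (fun i => (testD_section w c0 (Dg i)).1) (fun i => (testD_section w c0 (Dg i)).2)).
Qed.

Lemma integral_Om_Q (f : Om * Rd -> R) : mu.-integrable setT (EFin \o f) ->
  \int[P]_w \int[leb]_(x in Q) (f (w, x))%:E = \int[mu]_z (f z)%:E.
Proof.
move=> fi; rewrite -(integral12_prod_meas1 fi); apply: eq_integral => w _.
by rewrite (integral_lebesgue_on oQ).
Qed.

(** Both sides are linear in the test function, and [testD] is the span of [testA]. The iterated
    integrals also become integrals over [lam] and over the product measure. *)
Lemma two_scale_cvg_testA m (e : nat -> {posnum R}) (w0 : Om)
    (u : nat -> 'I_m -> LfunType lam (exponent_ge1 hp))
    (v : 'I_m -> LfunType mu (exponent_ge1 hp)) :
  vbounded lam p (fun k i => u k i) ->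
  (forall i f, testA DO DQ f ->
    \int[lam]_x (u k i x * f (shear tau (e k)%:num^-1 (w0, x)))%:E @[k --> \oo]
      --> \int[mu]_z (v i z * f z)%:E) ->
  two_scale_cvg tau DO DQ e w0 u v.
Proof.
move=> bu H; split=> // i f Df.
have iv : mu.-integrable setT (EFin \o v i) by apply: Lp_integrable; exact: product_measure_lty.
have iu k : lam.-integrable setT (EFin \o u k i).
  by apply: Lp_integrable; exact: lebesgue_on_lty.
rewrite (@integral_Om_Q (fun z => v i z * f z)%R); last first.
  have [M hM] := testD_bounded bQ hDO hDQ Df.
  exact: integrable_mul_bounded iv (testD_measurable hDO hDQ Df) hM.
under eq_cvg do rewrite (integral_lebesgue_on oQ).
have [n [c [g [Ag ->]]]] := Df.
have mg j : measurable_fun setT (g j).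
  by have := testA_measurable hDO hDQ (Ag j).
have bg j : exists M, forall z, (`|g j z| <= M)%R.
  by have := testA_bounded bQ hDO hDQ (Ag j).
rewrite (_ : (fun k : nat => _) = (fun k => \sum_j (c j)%:E *
    \int[lam]_x (u k i x * g j (shear tau (e k)%:num^-1 (w0, x)))%:E)); last first.
  apply/funext => k; rewrite -testD_pairing_sum//.
  by move=> j; exact: testA_testD.
rewrite (integral_mul_sum c iv mg bg).
have fin j : \int[mu]_z (v i z * g j z)%:E \is a fin_num.
  have [M hM] := testA_bounded bQ hDO hDQ (Ag j).
  apply: integrable_fin_num => //.
  exact: integrable_mul_bounded iv (testA_measurable hDO hDQ (Ag j)) hM.
apply: cvge_sum => j; last by rewrite fin_numM.
by apply: cvgeZl => //; exact: H.
Qed.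

End setting.

Lemma ae_exists dO (Om : measurableType dO) (R : realType) (P : probability Om R)
  (A : Om -> Prop) : {ae P, forall w, A w} -> exists w, A w.
Proof.
move=> [N [mN PN NA]]; apply: contrapT => /forallNP nA.
have : P setT = 0.
  by apply: (subset_measure0 (B := N)) => // w _; apply: NA; exact: nA.
by rewrite probability_setT => /eqP; rewrite onee_eq0.
Qed.

Lemma limn_einf_lt (R : realType) (u : nat -> \bar R) (x : \bar R) :
  (limn_einf u < x)%E -> forall k, exists2 n, (k <= n)%N & (u n < x)%E.
Proof.
move=> ux k; have : (einfs u k < x)%E.
  apply: le_lt_trans ux; rewrite limn_einf_lim.
  rewrite (cvg_lim _ (ereal_nondecreasing_cvgn (nondecreasing_einfs u)))//.
  by apply: ereal_sup_ubound; exists k.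
by move=> /ereal_inf_lt[_ [n /= kn <-] un]; exists n.
Qed.

Section vector_norm.
Context d (T : measurableType d) (R : realType) (m : {measure set T -> \bar R}).
Context (p : R) (hp : 1 < p) (n : nat).
Local Open Scope ereal_scope.

Definition euclid (u : 'I_n -> T -> R) (z : T) : R := Num.sqrt (\sum_i u i z ^+ 2)%R.

Lemma vnorm_poweR (u : 'I_n -> T -> R) :
  vnorm m p u = (\int[m]_z (euclid u z `^ p)%:E) `^ p^-1.
Proof.
rewrite /vnorm unlock; apply: (congr1 (fun t => t `^ p^-1)); apply: eq_integral => z _.
by rewrite abse_EFin ger0_norm ?sqrtr_ge0// poweR_EFin.
Qed.

Lemma vnorm_lty_int (u : 'I_n -> T -> R) :
  (vnorm m p u < +oo) = (\int[m]_z (euclid u z `^ p)%:E < +oo).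
Proof.
rewrite vnorm_poweR; apply/idP/idP; last exact: poweR_lty.
by apply: lty_poweRy; rewrite invr_neq0// gt_eqF// (lt_trans _ hp).
Qed.

(** The Euclidean length is at most the sum of the absolute values of the components, to which
    Minkowski's inequality applies one component at a time. *)
Lemma vnorm_lty (v : 'I_n -> LfunType m (exponent_ge1 hp)) :
  vnorm m p (fun i => v i) < +oo.
Proof.
have mv i : measurable_fun setT (v i : T -> R) by exact: measurable_funP.
pose g (s : seq 'I_n) z : R := (\sum_(i <- s) `|v i z|)%R.
have mg s : measurable_fun setT (g s).
  by apply: measurable_sum => i; exact: measurableT_comp.
have g0 s z : (0 <= g s z)%R by apply: sumr_ge0.
have gs s : 'N[m]_p%:E[EFin \o g s] < +oo.
  elim: s => [|i s IH].
    rewrite (_ : EFin \o g [::] = cst 0); first by rewrite Lnorm0// eqe gt_eqF// (lt_trans _ hp).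
    by apply/funext => z; rewrite /g /= big_nil.
  rewrite (_ : EFin \o g (i :: s) = EFin \o ((fun z => `|v i z|%R) \+ g s)%R); last first.
    by apply/funext => z; rewrite /g /= big_cons.
  apply: le_lt_trans (eminkowski _ _ _ _) _ => //.
  - exact: measurableT_comp.
  - by rewrite lee_fin ltW.
  rewrite lte_add_pinfty//.
  rewrite (_ : EFin \o _ = abse \o (EFin \o v i))// Lnorm_abse.
  exact: Lfunction_finite.
apply: le_lt_trans (gs (index_enum _)).
apply: (@le_Lnorm _ _ _ m p hp (euclid (fun i => v i)) (g (index_enum _))) => //.
  exact: measurable_vnorm.
move=> z; rewrite [leLHS]ger0_norm ?sqrtr_ge0// [leRHS]ger0_norm//.
rewrite -[leRHS]ger0_norm// -sqrtr_sqr ler_sqrt ?sqr_ge0// /g.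
elim: (index_enum _) => [|i s IH]; first by rewrite !big_nil expr0n.
rewrite !big_cons; apply: (@le_trans _ _ (v i z ^+ 2 + (g s z) ^+ 2)%R).
  by rewrite lerD2l.
rewrite -/(g s z) -[(v i z ^+ 2)%R]real_normK ?num_real// sqrrD -addrA lerD2l.
by rewrite lerDr mulrn_wge0// mulr_ge0.
Qed.

Lemma measurable_euclid (u : 'I_n -> T -> R) : (forall i, measurable_fun setT (u i)) ->
  measurable_fun setT (fun z => (euclid u z `^ p)%:E).
Proof.
move=> mu_; apply/measurable_EFinP; apply: (measurableT_comp (measurable_powR _)) => //.
exact: measurable_vnorm.
Qed.

Lemma vnorm_Lfun (u : 'I_n -> T -> R) : (forall i, measurable_fun setT (u i)) ->
  vnorm m p u < +oo -> forall i, u i \in Lfun m p%:E.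
Proof.
move=> mu_ uoo i; rewrite inE; apply/andP; split; rewrite inE//=.
exact: le_lt_trans (Lnorm_le_vnorm m hp i mu_) uoo.
Qed.

End vector_norm.

(** * Mean ergodic behaviour of products of test functions *)

Section mean_ergodic.
Context (R : realType) (dO : measure_display) (Om : measurableType dO)
  (P : probability Om R) (d : nat) (tau : 'rV[R]_d -> Om -> Om)
  (p : R) (hp : 1 < p) (Q : set 'rV[R]_d) (oQ : open Q) (bQ : bounded_set Q)
  (DO : set (Om -> R)) (DQ : set ('rV[R]_d -> R)) (Om0 : set Om).
Local Notation Rd := (lebesgueRd R d).
Local Notation leb := (@lebesgue R d).
Local Notation lam := (lebesgue_on oQ).
Local Notation mu := (P \x lam)%E.
Hypotheses (htau : ergodic_dynamical_system P tau) (hDO : test_Omega P DO)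
  (hDQ : test_Q oQ DQ) (hgood : good_set P tau p oQ DO DQ Om0).
Local Open Scope ereal_scope.

Lemma vanishing_right (e : nat -> {posnum R}) : vanishing e ->
  (e k)%:num @[k --> \oo] --> (0 : R)^'+.
Proof.
move=> e0 A A0; 
have H : \forall k \near \oo, ((0 < (e k)%:num)%R -> A (e k)%:num) := e0 _ A0.
suff : \forall k \near \oo, A (e k)%:num by [].
by apply: filterS H => k; apply.
Qed.

Let pr (c : R) (f g : Om * Rd -> R) (w : Om) : \bar R :=
  \int[lam]_x (g (shear tau c (w, x)) * f (shear tau c (w, x)))%:E.

Lemma good_product_testD f g w (e : nat -> {posnum R}) : testD DO DQ f ->
  testA DO DQ g -> Om0 w -> vanishing e ->
  \int[lam]_x (g (shear tau (e k)%:num^-1 (w, x)) * f (shear tau (e k)%:num^-1 (w, x)))%:E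
    @[k --> \oo] --> \int[mu]_z (g z * f z)%:E.
Proof.
move=> [n [a [F [AF ->]]]] Ag w0 e0.
have [M hM] := testA_bounded bQ hDO hDQ Ag.
have mg : measurable_fun setT g by have := testA_measurable hDO hDQ Ag.
have ig : mu.-integrable setT (EFin \o g).
  by apply: bounded_integrable hM => //; exact: product_measure_lty.
have mF j : measurable_fun setT (F j) by have := testA_measurable hDO hDQ (AF j).
have bF j : exists M, forall z, (`|F j z| <= M)%R.
  by have := testA_bounded bQ hDO hDQ (AF j).
rewrite (_ : (fun k : nat => _) = (fun k => \sum_j (a j)%:E *
    pr (e k)%:num^-1 (F j) g w)); last first.
  apply/funext => k; rewrite /pr.
  rewrite -(testD_pairing_sum (u := fun x => g (shear tau (e k)%:num^-1 (w, x))) bQ htau hDO hDQ)//.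
  - have c0 : (0 < (e k)%:num^-1)%R by rewrite invr_gt0.
    have [mgs _] := testD_section bQ htau hDO hDQ w c0 (testA_testD Ag).
    by apply: bounded_integrable (fun x => hM _) => //; exact: lebesgue_on_lty.
  - by move=> j; exact: testA_testD.
rewrite (integral_mul_sum a ig mF bF).
have fin j : \int[mu]_z (g z * F j z)%:E \is a fin_num.
  have [MF hMF] := bF j; apply: integrable_fin_num => //.
  exact: integrable_mul_bounded ig (mF j) hMF.
apply: cvge_sum => j; last by rewrite fin_numM.
apply: cvgeZl => //.
have := good_product hgood Ag (AF j) w0.
rewrite (@integral_Om_Q _ _ _ P _ _ oQ (fun z => g z * F j z)%R); last first.
  have [MF hMF] := bF j; exact: integrable_mul_bounded ig (mF j) hMF.
move=> H.
have -> : (fun k => pr (e k)%:num^-1 (F j) g w) =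
   (fun eps => \int[leb]_(x in Q) (Tstar tau eps (fun z => g z * F j z)%R (w, x))%:E) \o
   (fun k => (e k)%:num).
  by apply/funext => k /=; rewrite (integral_lebesgue_on oQ).
exact: (cvg_comp _ _ (vanishing_right e0) H).
Qed.

Lemma measurable_pairing (F : Om * Rd -> R) : mu.-integrable setT (EFin \o F) ->
  measurable_fun setT (fun w => \int[lam]_x (F (w, x))%:E).
Proof. by move=> iF; exact: (measurable_fubini_F iF). Qed.

(** Pointwise convergence on [Om0] becomes convergence in L^1(Omega) by dominated convergence: f and
    g are bounded, so the pairings are bounded by M N times the measure of Q. *)
Lemma good_product_mean f g (e : nat -> {posnum R}) : testD DO DQ f ->
  testA DO DQ g -> vanishing e ->
  \int[P]_w `|pr (e k)%:num^-1 f g w - \int[mu]_z (g z * f z)%:E| @[k --> \oo] --> 0.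
Proof.
move=> Df Ag e0.
have [M hM] := testA_bounded bQ hDO hDQ Ag.
have [N hN] := testD_bounded bQ hDO hDQ Df.
have mg : measurable_fun setT g by have := testA_measurable hDO hDQ Ag.
have mf : measurable_fun setT f by have := testD_measurable hDO hDQ Df.
have gfMN z : (`|g z * f z| <= M * N)%R by rewrite normrM ler_pM.
have igf : mu.-integrable setT (EFin \o (fun z => g z * f z)%R).
  apply: bounded_integrable gfMN => //; first exact: product_measure_lty.
  exact: measurable_funM.
have c0 k : (0 < (e k)%:num^-1)%R by rewrite invr_gt0.
have mgf k : measurable_fun setT (fun z => g (shear tau (e k)%:num^-1 z) * f (shear tau (e k)%:num^-1 z))%R.
  by apply: measurable_funM; [exact: measurableT_comp mg (measurable_shear htau (c0 k))
    |exact: measurableT_comp mf (measurable_shear htau (c0 k))].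
have mpr k : measurable_fun setT (pr (e k)%:num^-1 f g).
  apply: (measurable_pairing (F := fun z => g (shear tau (e k)%:num^-1 z) * f (shear tau (e k)%:num^-1 z))%R).
  by apply: bounded_integrable (fun z => gfMN _) => //; exact: product_measure_lty.
have [|||||_ H _] := @dominated_convergence _ _ _ P setT measurableT
  (fun k => pr (e k)%:num^-1 f g) (cst (\int[mu]_z (g z * f z)%:E))
  (cst ((M * N)%:E * lam setT)) => //.
- exists (~` Om0); split => [||w /= nw w0].
  + by apply: measurableC; exact: good_measurable hgood.
  + have := probability_setC P (good_measurable hgood).
    by rewrite (good_full hgood) subee.
  by apply: nw => _; exact: good_product_testD.
- have lf : lam setT \is a fin_num by rewrite ge0_fin_numE//; exact: lebesgue_on_lty.
  rewrite -(fineK lf) -EFinM.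
  apply: (@bounded_integrable _ _ _ P (cst (M * N * fine (lam setT))%R)
    `|M * N * fine (lam setT)|%R) => //.
  by rewrite -ge0_fin_numE// fin_num_measure.
- apply: aeW => w k _; rewrite /pr.
  have mgfw : measurable_fun setT (fun x : Rd => g (shear tau (e k)%:num^-1 (w, x)) * f (shear tau (e k)%:num^-1 (w, x)))%R.
    exact: (measurable_fun_pair2 (f := fun z => g (shear tau (e k)%:num^-1 z) * f (shear tau (e k)%:num^-1 z))%R).
  exact: le_integral_bounded mgfw _.
Qed.

End mean_ergodic.

Lemma limn_einf_ge0 (R : realType) (u : nat -> \bar R) :
  (forall n, 0 <= u n)%E -> (0 <= limn_einf u)%E.
Proof.
move=> u0; rewrite limn_einf_lim; apply: lime_ge; first exact: is_cvg_einfs.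
by apply: nearW => n; apply: le_ereal_inf_tmp => _ [k _ <-].
Qed.

Lemma abse_split (R : realType) (a b c d : \bar R) :
  a \is a fin_num -> b \is a fin_num -> c \is a fin_num -> d \is a fin_num ->
  (`|a + b - (c + d)| <= `|a| + `|b - c| + `|d|)%E.
Proof.
move: a b c d => [a| |] [b| |] [c| |] [d| |] //= _ _ _ _.
rewrite lee_fin (_ : (a + b - (c + d) = (a + (b - c)) + (- d))%R); last by lra.
apply: le_trans (ler_normD _ _) _; rewrite normrN lerD2r; exact: ler_normD.
Qed.

(** * Fields as two-scale limits of their realizations *)

Section recovery.
Context (R : realType) (dO : measure_display) (Om : measurableType dO)
  (P : probability Om R) (d : nat) (tau : 'rV[R]_d -> Om -> Om)
  (p : R) (hp : 1 < p) (Q : set 'rV[R]_d) (oQ : open Q) (bQ : bounded_set Q)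
  (DO : set (Om -> R)) (DQ : set ('rV[R]_d -> R)) (Om0 : set Om).
Local Notation Rd := (lebesgueRd R d).
Local Notation lam := (lebesgue_on oQ).
Local Notation mu := (P \x lam)%E.
Hypotheses (htau : ergodic_dynamical_system P tau) (hDO : test_Omega P DO)
  (hDQ : test_Q oQ DQ) (hgood : good_set P tau p oQ DO DQ Om0).
Local Open Scope ereal_scope.

Let pr (c : R) (f g : Om * Rd -> R) (w : Om) : \bar R :=
  \int[lam]_x (g (shear tau c (w, x)) * f (shear tau c (w, x)))%:E.

Let harm (l : nat) : {posnum R} := PosNum (divr_gt0 ltr01 (ltr0Sn R l)).

Let harm_vanishing : vanishing harm.
Proof.
rewrite /vanishing (_ : (fun k => _) = (fun k => k.+1%:R^-1)%R); last first.
  by apply/funext => k /=; rewrite div1r.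
exact: cvg_harmonic.
Qed.

Let delta n : R := (1 / (2 ^ n.+1)%:R)%R.

Let delta_gt0 n : (0 < delta n)%R.
Proof. by rewrite divr_gt0// ltr0n expn_gt0. Qed.

Let delta_sum : \sum_(n <oo) (delta n)%:E <= 1.
Proof. exact: epsilon_trick0. Qed.

Let delta0 : (delta n)%:E @[n --> \oo] --> 0.
Proof.
apply: (@squeeze_cvge _ _ _ _ (cst 0) _ (fun n => \sum_(n <= k <oo) (delta k)%:E)).
- apply: nearW => n; rewrite lee_fin ltW//=.
  apply: (le_trans _ (@nneseries_lim_ge _ (fun k => (delta k)%:E) xpredT n n.+1 _)) => //.
    by rewrite big_nat1.
  by move=> *; rewrite lee_fin ltW.
- exact: cvg_cst.
- apply: nneseries_tail_cvg => [|*]; last by rewrite lee_fin ltW.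
  by apply: le_lt_trans delta_sum _; rewrite ltry.
Qed.

(** At stage n only the first n + 1 test functions are controlled, so that the error is a finite sum
    of null sequences; every test function is eventually among them. *)
Let choose_scale m n (s : 'I_m -> Om * Rd -> R) (f : nat -> Om * Rd -> R) :
  (forall i, testD DO DQ (s i)) -> (forall j, testA DO DQ (f j)) ->
  exists2 l, (n <= l)%N &
    \sum_(i < m) \sum_(j < n.+1)
     \int[P]_w `|pr (harm l)%:num^-1 (s i) (f j) w - \int[mu]_z (f j z * s i z)%:E|
      < (delta n)%:E.
Proof.
move=> Ds Af.
have : (fun l => \sum_(i < m) \sum_(j < n.+1)
     \int[P]_w `|pr (harm l)%:num^-1 (s i) (f j) w - \int[mu]_z (f j z * s i z)%:E|)
     @ \oo --> 0.
  rewrite [X in _ --> X](_ : 0 = \sum_(i < m) \sum_(j < n.+1) 0); last first.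
    by rewrite big1// => i _; rewrite big1.
  apply: cvge_sum => i; last by rewrite big1.
  apply: cvge_sum => j //.
  exact: (good_product_mean bQ htau hDO hDQ hgood (Ds i) (Af j) harm_vanishing).
move=> /fine_cvgP[Hf /cvgrPdist_lt/(_ _ (delta_gt0 n)) H].
have [l [nl [fl hl]]] := filter_ex (filterI (nbhs_infty_ge n) (filterI Hf H)).
exists l => //; rewrite -(fineK fl) lte_fin; apply: le_lt_trans hl.
by rewrite sub0r normrN ler_norm.
Qed.

(* Integrability of the compositions [h(., ., v)] is only known for two-scale
   limits [v]; this shows that every [v] is one. The fields are
   [v(tau_(x/eps_k) w, x)], with [eps_k] so small that the mean ergodic
   behaviour has set in for the first test functions, and [w] is found by
   Borel-Cantelli and Fatou. *)
Lemma two_scale_recovery m (v : 'I_m -> LfunType mu (exponent_ge1 hp))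
    (G : Om -> Prop) : {ae P, forall w, G w} ->
  exists w (e : nat -> {posnum R}) (u : nat -> 'I_m -> LfunType lam (exponent_ge1 hp)),
  [/\ G w, Om0 w, vanishing e & two_scale_cvg tau DO DQ e w u v].
Proof.
move=> aeG.
have [f [Af fA]] := countable_testA hDO hDQ.
have [c [Dc cd]] := L1_dense_testD bQ hDO hDQ.
have muoo : mu setT < +oo by exact: product_measure_lty.
have iv i : mu.-integrable setT (EFin \o v i) by exact: Lp_integrable.
have mv i : measurable_fun setT (v i : Om * Rd -> R) by exact: measurable_funP.
have [s0 hs0] : exists s0 : nat -> 'I_m -> nat, forall n i,
    L1dist mu (v i) (c (s0 n i)) < (delta n)%:E.
  have [s0 H] := choice (fun ni : nat * 'I_m => cd _ (iv ni.2) _ (delta_gt0 ni.1)).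
  by exists (fun n i => s0 (n, i)) => n i; exact: H (n, i).
pose s n i := c (s0 n i).
have Ds n i : testD DO DQ (s n i) by exact: Dc.
have ms n i : measurable_fun setT (s n i) by have := testD_measurable hDO hDQ (Ds n i).
have /choice[l hl] n : exists l, (n <= l)%N /\
    \sum_(i < m) \sum_(j < n.+1)
     \int[P]_w `|pr (harm l)%:num^-1 (s n i) (f j) w - \int[mu]_z (f j z * s n i z)%:E|
      < (delta n)%:E.
  by have [l nl hl] := choose_scale n (Ds n) Af; exists l.
pose eps n := (harm (l n))%:num^-1%R.
have eps0 n : (0 < eps n)%R by rewrite invr_gt0.
have msh n : measurable_fun setT (shear tau (eps n)) := measurable_shear htau (eps0 n).
(* [D] is the realized distance between v and its approximation [s n]; since the shear preserves the
   product measure, its mean is their L^1 distance. *)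
pose D n i w := \int[lam]_x (`|v i (shear tau (eps n) (w, x)) - s n i (shear tau (eps n) (w, x))|%R)%:E.
have mvs n i : measurable_fun setT (fun z => (`|v i z - s n i z|%R)%:E).
  by apply/measurable_EFinP; apply: measurableT_comp => //; exact: measurable_funB.
have mD n i : measurable_fun setT (D n i).
  apply: (measurable_fun_fubini_tonelli_F (fun z => (`|v i (shear tau (eps n) z) - s n i (shear tau (eps n) z)|%R)%:E)) => //=.
  exact: measurableT_comp (mvs n i) (msh n).
have D0 n i w : 0 <= D n i w by apply: integral_ge0 => x _; rewrite lee_fin.
have intD n i : \int[P]_w D n i w < (delta n)%:E.
  apply: le_lt_trans (hs0 n i).
  rewrite /L1dist -(integral_shear htau (lebesgue_on oQ) (eps0 n) (mvs n i))//.
  rewrite (fubini_tonelli1 (fun z => (`|v i (shear tau (eps n) z) - s n i (shear tau (eps n) z)|%R)%:E))//.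
  exact: measurableT_comp (mvs n i) (msh n).
pose X n i j w := `|pr (eps n) (s n i) (f j) w - \int[mu]_z (f j z * s n i z)%:E|.
have mX n i j : measurable_fun setT (X n i j).
  apply: measurableT_comp => //; apply: emeasurable_funB => //.
  have [M hM] := testA_bounded bQ hDO hDQ (Af j).
  have [N hN] := testD_bounded bQ hDO hDQ (Ds n i).
  have mf : measurable_fun setT (f j) by have := testA_measurable hDO hDQ (Af j).
  apply: (measurable_pairing (P := P) (F := fun z => f j (shear tau (eps n) z) * s n i (shear tau (eps n) z))%R).
  apply: (bounded_integrable (M := (M * N)%R)) => //.
    by apply: measurable_funM; [exact: measurableT_comp mf (msh n)|exact: measurableT_comp (ms n i) (msh n)].
  by move=> z; rewrite normrM ler_pM.
have X0 n i j w : 0 <= X n i j w by exact: abse_ge0.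
pose Z n w := \sum_(i < m) D n i w + \sum_(i < m) \sum_(j < n.+1) X n i j w.
have mZ n : measurable_fun setT (Z n).
  apply: emeasurable_funD; first exact: emeasurable_sum.
  by apply: emeasurable_sum => i; exact: emeasurable_sum.
have sX0 n w : 0 <= \sum_(i < m) \sum_(j < n.+1) X n i j w.
  by apply: sume_ge0 => i _; apply: sume_ge0.
have Z0 n w : 0 <= Z n w by rewrite adde_ge0// sume_ge0.
(* One [delta n] for each of the m components of [D], and one more for all the ergodic errors [X]
   together. *)
have intZ n : \int[P]_w Z n w <= m.+1%:R%:E * (delta n)%:E.
  rewrite ge0_integralD//; last 3 first.
  - by move=> w _; apply: sume_ge0.
  - exact: emeasurable_sum.
  - by apply: emeasurable_sum => i; exact: emeasurable_sum.
  rewrite -natr1 EFinD ge0_muleDl ?lee_fin// mul1e; apply: leeD.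
    rewrite ge0_integral_sum//.
    apply: (@le_trans _ _ (\sum_(i < m) (delta n)%:E)).
      by apply: lee_sum => i _; exact: ltW.
    by rewrite sumEFin sumr_const card_ord -EFinM mulr_natl.
  rewrite ge0_integral_sum//; last 2 first.
  - by move=> i; exact: emeasurable_sum.
  - by move=> i w _; apply: sume_ge0.
  under eq_bigr => i _ do rewrite ge0_integral_sum//.
  by apply: ltW; have [_] := hl n.
have aeZ : {ae P, forall w, Z ^~ w @ \oo --> 0}.
  apply: summable_integral_cvg0 => //.
  apply: (@le_lt_trans _ _ (\sum_(n <oo) (m.+1%:R%:E * (delta n)%:E))).
    by apply: lee_nneseries => [*|n _]; [exact: integral_ge0|exact: intZ].
  rewrite nneseriesZl; last by move=> *; rewrite lee_fin ltW.
  rewrite lte_mul_pinfty ?lee_fin//; apply: le_lt_trans delta_sum _; exact: ltry.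
pose V i := v i : Om * Rd -> R.
(* [N] is the p-th power of the L^p norm of the realization. Its mean does not depend on n, so Fatou
   gives a finite lower limit for almost every w, although the sequence itself may be unbounded. *)
pose N n w := \int[lam]_x (euclid (fun i x => V i (shear tau (eps n) (w, x))) x `^ p)%:E.
have mV : measurable_fun setT (fun z => (euclid V z `^ p)%:E).
  exact: measurable_euclid.
have mN n : measurable_fun setT (N n).
  apply: (measurable_fun_fubini_tonelli_F (fun z => (euclid V (shear tau (eps n) z) `^ p)%:E)) => /=.
    exact: measurableT_comp mV (msh n).
  by move=> z; rewrite lee_fin powR_ge0.
have N0 n w : 0 <= N n w by apply: integral_ge0 => x _; rewrite lee_fin powR_ge0.
have intN n : \int[P]_w N n w = \int[mu]_z (euclid V z `^ p)%:E.
  rewrite -(integral_shear htau (lebesgue_on oQ) (eps0 n) mV); last by move=> z; rewrite lee_fin powR_ge0.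
  rewrite (fubini_tonelli1 (fun z => (euclid V (shear tau (eps n) z) `^ p)%:E))//=.
    exact: measurableT_comp mV (msh n).
  by move=> z; rewrite lee_fin powR_ge0.
have Voo : \int[mu]_z (euclid V z `^ p)%:E < +oo.
  by rewrite -(vnorm_lty_int _ hp); exact: vnorm_lty.
have aeN : {ae P, forall w, limn_einf (N ^~ w) < +oo}.
  have L0 w : 0 <= limn_einf (N ^~ w) by exact: limn_einf_ge0.
  have iL : P.-integrable setT (fun w => limn_einf (N ^~ w)).
    apply/integrableP; split.
      rewrite /limn_einf; apply: measurableT_comp => //.
      by apply: measurable_fun_limn_esup => n; exact: measurableT_comp.
    under eq_integral => w _ do rewrite gee0_abs//.
    apply: le_lt_trans (fatou P measurableT mN (fun n w _ => N0 n w)) _.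
    under eq_fun do rewrite intN.
    set C := integral _ _ _ in Voo *.
    have /cvg_limn_einf_sup[-> _] // : (fun=> C) @ \oo --> C by exact: cvg_cst.
  apply: filterS (integrable_ae measurableT iL) => w /(_ I).
  by rewrite ge0_fin_numE.
have aeO : {ae P, forall w, Om0 w}.
  exists (~` Om0); split => //; first by apply: measurableC; exact: good_measurable hgood.
  have := probability_setC P (good_measurable hgood).
  by rewrite (good_full hgood) subee.
have [w [Gw w0 Zw Nw]] : exists w, [/\ G w, Om0 w, Z ^~ w @ \oo --> 0 & limn_einf (N ^~ w) < +oo].
  apply: (@ae_exists _ _ _ P).
  apply: filterS2 (filterI aeG aeO) (filterI aeZ aeN) => w [? ?] [? ?]; split => //.
have [K NK] : exists K : R, limn_einf (N ^~ w) < K%:E.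
  have L0 : 0 <= limn_einf (N ^~ w) by exact: limn_einf_ge0.
  exists (fine (limn_einf (N ^~ w)) + 1)%R.
  by rewrite EFinD fineK ?ge0_fin_numE// lteDl// ge0_fin_numE.
(* The subsequence with bounded norms depends on w, which is why w is fixed beforehand. *)
have /choice[sg hsg] k : exists n, (k <= n)%N /\ N n w < K%:E.
  by have [n kn h] := limn_einf_lt NK k; exists n.
pose U k i (x : Rd) : R := V i (shear tau (eps (sg k)) (w, x)).
have mU k i : measurable_fun setT (U k i).
  apply: (measurable_fun_pair2 (f := fun z => V i (shear tau (eps (sg k)) z))).
  exact: measurableT_comp (mv i) (msh (sg k)).
have Uoo k : vnorm lam p (U k) < +oo.
  by rewrite (vnorm_lty_int _ hp); apply: lt_le_trans (hsg k).2 (leey _).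
have uL k i : U k i \in Lfun lam p%:E by exact: vnorm_Lfun (mU k) (Uoo k) i.
pose u k i : LfunType lam (exponent_ge1 hp) := Lfun_Sub (exponent_ge1 hp) (uL k i).
pose e k := harm (l (sg k)).
have lsg k : (k <= l (sg k))%N by apply: leq_trans (hsg k).1 (hl _).1.
have sgoo : sg @ \oo --> \oo.
  move=> A [k _ kA]; exists k => // n /= kn; apply: kA => /=.
  exact: leq_trans kn (hsg n).1.
exists w, e, u; split => //.
  apply: (cvg_comp (fun k => l (sg k)) (fun k => (harm k)%:num)); last exact: harm_vanishing.
  move=> A [k _ kA]; exists k => // n /= kn; apply: kA => /=.
  exact: leq_trans kn (lsg n).
apply: two_scale_cvg_testA => //.
  exists (K `^ p^-1)%R => k; rewrite vnorm_poweR -poweR_EFin.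
  apply: gt0_ler_poweR.
  - by rewrite invr_ge0 (le_trans ler01)// ltW.
  - by rewrite in_itv /= leey andbT; exact: N0 (sg k) w.
  - by rewrite in_itv /= leey andbT (le_trans (N0 (sg k) w))// ltW// (hsg k).2.
  - by apply: ltW; exact: (hsg k).2.
move=> i _ /fA[j <-].
have [M hM] := testA_bounded bQ hDO hDQ (Af j).
have mf : measurable_fun setT (f j) by have := testA_measurable hDO hDQ (Af j).
have M0 : (0 <= M)%R by apply: le_trans (normr_ge0 _) (hM point).
have ivf : mu.-integrable setT (fun z => (v i z * f j z)%:E).
  exact: integrable_mul_bounded (iv i) mf hM.
apply/sube_cvg0; first exact: integrable_fin_num.
apply/cvg_abse0P.
(* With s the approximation of v, the error is split into the realized pairing of v - s, at most M
   [D], the ergodic error [X] of s, and the averaged pairing of v - s, at most M [delta]. The first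
   two are bounded by (M + 1) [Z]. *)
apply: (@squeeze_cvge _ _ _ _ (cst 0) _
   (fun k => (M + 1)%:E * Z (sg k) w + M%:E * (delta (sg k))%:E)); last 2 first.
- exact: cvg_cst.
- rewrite [X in _ --> X](_ : _ = (M + 1)%:E * 0 + M%:E * 0); last by rewrite !mule0 adde0.
  apply: cvgeD; first by rewrite !mule0.
    by apply: cvgeZl => //; exact: (cvg_comp _ _ sgoo Zw).
  by apply: cvgeZl => //; exact: (cvg_comp _ _ sgoo delta0).
near=> k; rewrite abse_ge0 /=.
(* [Z] at stage [sg k] contains the error of the j-th test function only from here on. *)
have jk : (j <= sg k)%N.
  by apply: leq_trans (hsg k).1; near: k; exact: nbhs_infty_ge.
pose n := sg k.
have is_ : mu.-integrable setT (EFin \o s n i).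
  have [B hB] := testD_bounded bQ hDO hDQ (Ds n i).
  exact: bounded_integrable hB.
have mfw : measurable_fun setT (fun x : Rd => f j (shear tau (eps n) (w, x))).
  apply: (measurable_fun_pair2 (f := fun z => f j (shear tau (eps n) z))).
  exact: measurableT_comp mf (msh n).
have msw : measurable_fun setT (fun x : Rd => s n i (shear tau (eps n) (w, x))).
  apply: (measurable_fun_pair2 (f := fun z => s n i (shear tau (eps n) z))).
  exact: measurableT_comp (ms n i) (msh n).
have lamoo : lam setT < +oo by exact: lebesgue_on_lty.
have iU : lam.-integrable setT (EFin \o U k i) by exact: (Lp_integrable lamoo (u k i)).
have isw : lam.-integrable setT (EFin \o (fun x : Rd => s n i (shear tau (eps n) (w, x)))).
  have [B hB] := testD_bounded bQ hDO hDQ (Ds n i).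
  exact: bounded_integrable (fun x => hB _).
have iUs : lam.-integrable setT (EFin \o (fun x => U k i x - s n i (shear tau (eps n) (w, x)))%R).
  by apply: (integrableB measurableT iU isw).
have ivs : mu.-integrable setT (EFin \o (fun z => v i z - s n i z)%R).
  by apply: (integrableB measurableT (iv i) is_).
pose A1 := \int[lam]_x ((U k i x - s n i (shear tau (eps n) (w, x))) * f j (shear tau (eps n) (w, x)))%:E.
pose A2 := \int[mu]_z ((v i z - s n i z) * f j z)%:E.
have E1 : \int[lam]_x (u k i x * f j (shear tau (e k)%:num^-1 (w, x)))%:E =
    A1 + pr (eps n) (s n i) (f j) w.
  rewrite -integralD//=; last 2 first.
  - exact: integrable_mul_bounded iUs mfw (fun x => hM _).
  - have [B hB] := testD_bounded bQ hDO hDQ (Ds n i).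
    under eq_fun do rewrite mulrC.
    exact: integrable_mul_bounded isw mfw (fun x => hM _).
  apply: eq_integral => x _; rewrite -EFinD; congr EFin.
  by rewrite mulrBl [(f j _ * s n i _)%R]mulrC subrK.
have E2 : \int[mu]_z (v i z * f j z)%:E = \int[mu]_z (f j z * s n i z)%:E + A2.
  rewrite -integralD//=; last 2 first.
  - under eq_fun do rewrite mulrC.
    exact: integrable_mul_bounded is_ mf hM.
  - exact: integrable_mul_bounded ivs mf hM.
  apply: eq_integral => z _; rewrite -EFinD; congr EFin.
  by rewrite mulrBl [(f j _ * s n i _)%R]mulrC addrC subrK.
rewrite E1 E2.
apply: (le_trans (abse_split _ _ _ _)).
- apply: integrable_fin_num => //.
  exact: integrable_mul_bounded iUs mfw (fun x => hM _).
- apply: integrable_fin_num => //.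
  under eq_fun do rewrite mulrC.
  exact: integrable_mul_bounded isw mfw (fun x => hM _).
- apply: integrable_fin_num => //.
  under eq_fun do rewrite mulrC.
  exact: integrable_mul_bounded is_ mf hM.
- apply: integrable_fin_num => //.
  exact: integrable_mul_bounded ivs mf hM.
apply: leeD; last first.
  apply: le_trans (le_integral_mul_bounded _ _ mf hM) _.
    exact: measurable_funB.
  by rewrite lee_wpmul2l ?lee_fin//; apply/ltW/hs0.
rewrite EFinD ge0_muleDl ?lee_fin// mul1e; apply: leeD.
  apply: le_trans (le_integral_mul_bounded _ _ mfw (fun x => hM _)) _.
    by apply: measurable_funB => //; exact: mU.
  rewrite lee_wpmul2l ?lee_fin//.
  apply: (@le_trans _ _ (\sum_(i < m) D n i w)); last by rewrite leeDl.
  by rewrite (bigD1 i)//= leeDl// sume_ge0.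
apply: (@le_trans _ _ (\sum_(i < m) \sum_(j < n.+1) X n i j w)); last by rewrite leeDr// sume_ge0.
rewrite (bigD1 i)//= -[leLHS]adde0; apply: leeD; last by apply: sume_ge0 => *; exact: sume_ge0.
have jn : (j < n.+1)%N by rewrite ltnS.
by rewrite (bigD1 (Ordinal jn))//= leeDl// sume_ge0.
Unshelve. all: by end_near. Qed.

End recovery.

(** * Measurability of the two-scale energy *)

Lemma ereal_between (R : realType) (l x : \bar R) :
  (l < x)%E -> exists2 a : R, (l < a%:E)%E & (a%:E < x)%E.
Proof.
case: l x => [r| |] [s| |] //; rewrite ?lte_fin => rs.
- by exists ((r + s) / 2); rewrite lte_fin; lra.
- by exists (r + 1); rewrite ?ltry// lte_fin; lra.
- by exists (s - 1); rewrite ?ltNyr// lte_fin; lra.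
- by exists 0; rewrite ?ltNyr ?ltry.
Qed.

Lemma le_limn_einf (R : realType) (u : nat -> \bar R) (x : \bar R) :
  (forall a : R, a%:E < x -> \forall n \near \oo, a%:E <= u n)%E ->
  (x <= limn_einf u)%E.
Proof.
move=> H; rewrite leNgt; apply/negP => /ereal_between[a la ax].
have [N _ HN] := H a ax.
have [n Nn] := limn_einf_lt la N; rewrite ltNge => /negP; apply.
exact: HN.
Qed.

Lemma cvg_monotone_integral (dT : measure_display) (T : measurableType dT)
    (R : realType) (m : {measure set T -> \bar R}) (g : nat -> T -> \bar R)
    (f : T -> \bar R) :
  (forall n, measurable_fun setT (g n)) -> (forall n x, (0 <= g n x)%E) ->
  (forall x, nondecreasing_seq (g ^~ x)) -> (forall x, g n x @[n --> \oo] --> f x) ->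
  (\int[m]_x g n x @[n --> \oo] --> \int[m]_x f x)%E.
Proof.
move=> mg g0 ndg gf.
rewrite (_ : (\int[m]_x f x = \int[m]_x limn (g ^~ x))%E); last first.
  by apply: eq_integral => x _; apply/esym/cvg_lim => //; exact: gf.
by apply: cvg_monotone_convergence => // x _; exact: ndg.
Qed.

Section negative_truncation.
Context (R : realType).
Implicit Types s t : R.

(** Equals n - min(t^-, n): a nonnegative, nondecreasing and 1-Lipschitz substitute for - t^-. *)
Definition negative_truncation (n : nat) t : R := Num.max (Num.min t 0 + n%:R) 0.

Lemma negative_truncation_ge0 n t : 0 <= negative_truncation n t.
Proof. by rewrite le_max lexx orbT. Qed.

Lemma negative_truncation_le n t : negative_truncation n t <= n%:R.
Proof. by rewrite ge_max ler0n andbT gerDr ge_min lexx orbT. Qed.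

Lemma negative_truncation_homo n : {homo negative_truncation n : s t / s <= t}.
Proof.
move=> s t st; rewrite ge_max !le_max lexx orbT andbT lerD2r.
by rewrite le_min !ge_min st lexx orbT.
Qed.

Lemma maxr0_contraction s t : s <= t -> Num.max t 0 - Num.max s 0 <= t - s.
Proof. by move=> st; case: (leP t 0); case: (leP s 0); lra. Qed.

Lemma minr0_contraction s t : s <= t -> Num.min t 0 - Num.min s 0 <= t - s.
Proof. by move=> st; case: (leP t 0); case: (leP s 0); lra. Qed.

Lemma negative_truncation_contraction n s t : s <= t ->
  negative_truncation n t - negative_truncation n s <= t - s.
Proof.
move=> st; apply: le_trans (minr0_contraction st).
have mst : Num.min s 0 + n%:R <= Num.min t 0 + n%:R.
  by rewrite lerD2r le_min !ge_min st lexx orbT.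
by apply: le_trans (maxr0_contraction mst) _; rewrite opprD addrACA subrr addr0.
Qed.

Lemma negative_truncation_complement_homo t :
  {homo (fun n : nat => n%:R - negative_truncation n t) : a b / (a <= b)%N >-> a <= b}.
Proof.
move=> a b ab; have : a%:R <= b%:R :> R by rewrite ler_nat.
rewrite /negative_truncation; move: (a%:R : R) (b%:R : R) (Num.min t 0) => x y z xy.
by case: (leP (z + x) 0); case: (leP (z + y) 0); lra.
Qed.

Lemma negative_truncation_complement n t : - t <= n%:R ->
  n%:R - negative_truncation n t = Num.max (- t) 0.
Proof.
have := ler0n R n; rewrite /negative_truncation; move: (n%:R : R) => x x0 tx.
by case: (leP t 0) => t0; [case: (leP (t + x) 0)|case: (leP (0 + x) 0)];
  case: (leP (- t) 0); lra.
Qed.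

End negative_truncation.

Section lsc_composition.
Context (R : realType) (d : nat).

Lemma row_cvg_nbhs (xi : 'rV[R]_d) (x : nat -> 'rV[R]_d) (W : set 'rV[R]_d) :
  (forall i, `|xi ord0 i - x n ord0 i| @[n --> \oo] --> (0 : R)) ->
  nbhs xi W -> \forall n \near \oo, W (x n).
Proof.
move=> xc /nbhs_ballP[e /= e0 eW].
have : \forall n \near \oo, forall i, `|xi ord0 i - x n ord0 i| < e.
  apply: filter_forall => i; have /cvgrPdist_lt/(_ e e0) := xc i.
  by apply: filterS => n; rewrite sub0r normrN normr_id.
apply: filterS => n xn; apply: eW; split => // i j; rewrite (ord1 i); exact: xn.
Qed.

(** Near xi the values of f drop by at most e; th is monotone and loses at most e when its argument
    loses e. *)
Lemma lsc_comp_einf (f : 'rV[R]_d -> R) (th : R -> R) (xi : 'rV[R]_d)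
    (x : nat -> 'rV[R]_d) :
  lower_semicontinuous (fun y => (f y)%:E) -> {homo th : s t / s <= t} ->
  (forall s t, s <= t -> th t - th s <= t - s) ->
  (forall i, `|xi ord0 i - x n ord0 i| @[n --> \oo] --> (0 : R)) ->
  ((th (f xi))%:E <= limn_einf (fun n => (th (f (x n)))%:E))%E.
Proof.
move=> lf th_nd cth xc; apply: le_limn_einf => a; rewrite lte_fin => ax.
have [e e0 he] : exists2 e : R, 0 < e & a < th (f xi - e).
  exists ((th (f xi) - a) / 2); first lra.
  set e := _ / 2; have e0 : e <= f xi - (f xi - e) by lra.
  have /cth : f xi - e <= f xi by rewrite /e; lra.
  by rewrite /e; set b := th (_ - _); lra.
have [W xiW fW] : exists2 W, nbhs xi W & forall y, W y -> ((f xi - e)%:E < (f y)%:E)%E.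
  by apply: lf; rewrite lte_fin ltrBlDr ltrDl.
apply: filterS (row_cvg_nbhs xc xiW) => n /fW; rewrite lte_fin lee_fin => h.
by rewrite ltW// (lt_le_trans he)// th_nd// ltW.
Qed.

End lsc_composition.

Section energy.
Context (R : realType) (dO : measure_display) (Om : measurableType dO)
  (P : probability Om R) (d : nat) (tau : 'rV[R]_d -> Om -> Om)
  (p : R) (hp : 1 < p) (Q : set 'rV[R]_d) (oQ : open Q) (bQ : bounded_set Q)
  (DO : set (Om -> R)) (DQ : set ('rV[R]_d -> R)) (Om0 : set Om)
  (h : Om -> 'rV[R]_d -> 'rV[R]_d -> R).
Local Notation Rd := (lebesgueRd R d).
Local Notation leb := (@lebesgue R d).
Local Notation lam := (lebesgue_on oQ).
Local Notation mu := (P \x lam)%E.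
Local Notation V := (weakLp mu hp d).
Hypotheses (htau : ergodic_dynamical_system P tau) (hDO : test_Omega P DO)
  (hDQ : test_Q oQ DQ) (hgood : good_set P tau p oQ DO DQ Om0)
  (hh : two_scale_normal_integrand P tau hp oQ DO DQ Om0 h).
Local Open Scope ereal_scope.

Definition cylQ : set (Om * Rd) := [set z | Q z.2].

Lemma measurable_cylQ : measurable cylQ.
Proof.
rewrite (_ : cylQ = setT `*` (Q : set Rd)); last by apply/seteqP; split => z //= [].
by apply: measurableX => //; exact: open_lebesgue_measurable.
Qed.

(* The integrand may be arbitrary outside [Q], hence the cut-off. *)
Definition composite (v : 'I_d -> Om * Rd -> R) : Om * Rd -> R :=
  (fun z => h z.1 z.2 (field_value v z)) \_ cylQ.

Lemma integral_cylQ (f : Om * Rd -> \bar R) :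
  measurable_fun cylQ f -> (forall z, cylQ z -> 0 <= f z) ->
  \int[P \x leb]_(z in cylQ) f z = \int[mu]_z (f \_ cylQ) z.
Proof.
move=> mf f0; rewrite integral_mkcond.
have mg : measurable_fun setT (f \_ cylQ).
  by apply/(measurable_restrictT _ _).1 => //; exact: measurable_cylQ.
have g0 z : 0 <= (f \_ cylQ) z by exact: erestrict_ge0.
have E1 : \int[P \x leb]_z (f \_ cylQ) z = \int[P]_w \int[leb]_x (f \_ cylQ) (w, x).
  exact: (@fubini_tonelli1 _ _ _ _ _ P leb (f \_ cylQ) mg g0).
have E2 : \int[mu]_z (f \_ cylQ) z = \int[P]_w \int[lam]_x (f \_ cylQ) (w, x).
  exact: (@fubini_tonelli1 _ _ _ _ _ P lam (f \_ cylQ) mg g0).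
rewrite E1 E2; apply: eq_integral => w _; rewrite -(integral_lebesgue_on oQ).
rewrite [RHS]integral_mkcond; apply: eq_integral => x _.
rewrite [RHS]/patch; case: ifPn => // xQ; rewrite /patch ifF//.
by apply/negbTE; apply: contra xQ; rewrite !inE.
Qed.

(** The hypothesis on h speaks of two-scale limits at almost every w; a recovery sequence at a
    single good w suffices, as the conclusion does not involve w. *)
Lemma composite_well_defined (v : 'I_d -> LfunType mu (exponent_ge1 hp)) :
  measurable_fun setT (composite (fun i => v i)) /\
  (\int[mu]_z (EFin \o composite (fun i => v i))^\+ z < +oo \/
   \int[mu]_z (EFin \o composite (fun i => v i))^\- z < +oo).
Proof.
have [w [e [u [Gw w0 e0 uv]]]] :=
  two_scale_recovery bQ htau hDO hDQ hgood v (integrand_liminf hh).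
have [_ [mf foo] _] := Gw w0 e u v e0 uv.
have mc : measurable_fun setT (composite (fun i => v i)).
  by apply/(measurable_restrictT _ _).1; [exact: measurable_cylQ|exact/measurable_EFinP].
split; first exact: mc.
pose F (z : Om * Rd) := (h z.1 z.2 (field_value (fun i => v i) z))%:E.
have Ep := @integral_cylQ F^\+ (measurable_funepos mf) (fun z _ => funepos_ge0 F z).
have En := @integral_cylQ F^\- (measurable_funeneg mf) (fun z _ => funeneg_ge0 F z).
have Ep' : \int[mu]_z (EFin \o composite (fun i => v i))^\+ z = \int[mu]_z (F^\+ \_ cylQ) z.
  apply: eq_integral => z _; rewrite funeposE /composite /patch /=.
  by case: ifPn => zQ; [rewrite funeposE|rewrite maxxx].
have En' : \int[mu]_z (EFin \o composite (fun i => v i))^\- z = \int[mu]_z (F^\- \_ cylQ) z.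
  apply: eq_integral => z _; rewrite funenegE /composite /patch /=.
  by case: ifPn => zQ; [rewrite funenegE|rewrite oppr0 maxxx].
rewrite Ep' En' -Ep -En; exact: foo.
Qed.

Lemma energyE (v : 'I_d -> LfunType mu (exponent_ge1 hp)) :
  two_scale_energy P Q h (fun i => v i) =
  \int[mu]_z (EFin \o composite (fun i => v i))^\+ z -
  \int[mu]_z (EFin \o composite (fun i => v i))^\- z.
Proof.
have [mc coo] := composite_well_defined v.
have mE : measurable_fun setT (EFin \o composite (fun i => v i)) by exact/measurable_EFinP.
have E := @integral12_semi _ _ _ _ _ P lam (EFin \o composite (fun i => v i)) mE coo.
apply: etrans E.
apply: eq_integral => w _; rewrite -(integral_lebesgue_on oQ).
apply: eq_integral => x; rewrite inE => xQ.
by rewrite /composite /patch /= mem_set.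
Qed.

Section superposition.
Context (th : R -> R).
Hypotheses (th0 : forall t, (0 <= th t)%R) (th_nd : {homo th : s t / (s <= t)%R})
  (cth : forall s t, (s <= t -> th t - th s <= t - s)%R).

Definition superposition (v : V) : \bar R := \int[mu]_z (th (composite (fun i => v i) z))%:E.

Let mth (v : V) : measurable_fun setT (fun z => (th (composite (fun i => v i) z))%:E).
Proof.
apply/measurable_EFinP; apply: measurableT_comp.
  exact: nondecreasing_measurable.
by have [] := composite_well_defined v.
Qed.

(** Otherwise there are fields w_n at L^1 distance at most 2^-(n+1) from v with superposition at
    most t. Summability of the distances gives convergence almost everywhere, and lower
    semicontinuity of h with Fatou carries the bound over to v. *)
Let superposition_open (t : R) (v : V) : t%:E < superposition v ->
  exists2 r : R, (0 < r)%R & forall w : V,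
    (forall i, L1dist mu (v i) (w i) <= r%:E) -> t%:E < superposition w.
Proof.
move=> tv; apply: contrapT => nr.
pose delta n : R := (1 / (2 ^ n.+1)%:R)%R.
have delta_gt0 n : (0 < delta n)%R by rewrite divr_gt0// ltr0n expn_gt0.
have /choice[w hw] n : exists w : V, (forall i, L1dist mu (v i) (w i) <= (delta n)%:E) /\
    superposition w <= t%:E.
  apply: contrapT => nw; apply: nr; exists (delta n) => // w hw.
  by rewrite ltNge; apply/negP => h'; apply: nw; exists w.
have mv (u : V) i : measurable_fun setT (u i : Om * Rd -> R) by exact: measurable_funP.
have mvw n i : measurable_fun setT (fun z => (`|v i z - w n i z|%R)%:E).
  by apply/measurable_EFinP; apply: measurableT_comp => //; exact: measurable_funB.
have cvg_vw : {ae mu, forall z, \sum_i (`|v i z - w n i z|%R)%:E @[n --> \oo] --> 0}.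
  apply: summable_integral_cvg0.
  - by move=> n; exact: emeasurable_sum.
  - by move=> n z; apply: sume_ge0 => i _; rewrite lee_fin.
  apply: (@le_lt_trans _ _ (\sum_(n <oo) (d%:R%:E * (delta n)%:E))).
    apply: lee_nneseries => [n _ _|n _].
      by apply: integral_ge0 => z _; apply: sume_ge0 => i _; rewrite lee_fin.
    rewrite ge0_integral_sum//.
    apply: (@le_trans _ _ (\sum_(i < d) (delta n)%:E)).
      by apply: lee_sum => i _; exact: (hw n).1.
    by rewrite sumEFin sumr_const card_ord -EFinM mulr_natl.
  rewrite nneseriesZl; last by move=> *; rewrite lee_fin ltW.
  rewrite lte_mul_pinfty ?lee_fin//.
  by apply: le_lt_trans (epsilon_trick0 _ _) _ => //; exact: ltry.
have : superposition v <= t%:E.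
  apply: (@le_trans _ _ (\int[mu]_z limn_einf (fun n => (th (composite (fun i => w n i) z))%:E))).
    apply: ae_ge0_le_integral => //.
    - by move=> z _; rewrite lee_fin.
    - by move=> z _; apply: limn_einf_ge0 => n; rewrite lee_fin.
    - rewrite /limn_einf; apply: measurableT_comp => //.
      by apply: measurable_fun_limn_esup => n; exact: measurableT_comp.
    apply: filterS2 cvg_vw (integrand_lsc hh) => z zc lz _.
    (* Off the cylinder over Q every composite has the default value [point], so the sequence is
       constant there. *)
    rewrite /composite /patch; case: ifPn => zQ; last first.
      have /cvg_limn_einf_sup[-> _] // : (fun n : nat => (th point)%:E) @ \oo --> (th point)%:E.
      exact: cvg_cst.
    apply: (lsc_comp_einf lz th_nd cth) => i; rewrite !mxE.
    move/fine_cvgP : zc => [_ zc].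
    apply: (squeeze_cvgr _ (cvg_cst 0%R) zc); apply: nearW => n; rewrite !mxE normr_ge0 /=.
    rewrite sumEFin /= (bigD1 i)//= lerDl; exact: sumr_ge0.
  apply: le_trans (fatou mu measurableT (fun n => mth (w n)) _) _.
    by move=> n z _; rewrite lee_fin.
  rewrite limn_einf_lim; apply: lime_le; first exact: is_cvg_einfs.
  apply: nearW => n; apply: (@le_trans _ _ (superposition (w n))); last exact: (hw n).2.
  by apply: ereal_inf_lbound; exists n => /=.
by rewrite leNgt tv.
Qed.

(* Fatou makes the superposition lower semicontinuous for the L^1 distance, and
   L^1-open sets are weakly Borel. *)
Lemma measurable_superposition :
  measurable_fun setT (superposition : borel V -> \bar R).
Proof.
have [c [Dc cd]] := L1_dense_testD bQ hDO hDQ.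
have ic n : mu.-integrable setT (EFin \o c n).
  have [M hM] := testD_bounded bQ hDO hDQ (Dc n).
  apply: bounded_integrable hM => //; first exact: product_measure_lty.
  by have := testD_measurable hDO hDQ (Dc n).
apply: (measurability _ (ErealGenOInfty.measurableE R)) => _ [_ [t ->] <-].
rewrite setTI.
apply: (measurable_L1_open (product_measure_lty P oQ bQ) ic cd) => v.
rewrite /= in_itv /= andbT => /superposition_open[r r0 hr]; exists r => // w /hr.
by rewrite /= in_itv /= andbT.
Qed.

End superposition.

(* The superposition principle needs a nonnegative nondecreasing profile: it
   applies to the positive part and to [negative_truncation n], and
   [n - negative_truncation n] increases to the negative part. *)
Lemma measurable_energy :
  measurable_fun setT (fun v : borel V => two_scale_energy P Q h (fun i => v i)).
Proof.
have mc (v : V) : measurable_fun setT (composite (fun i => v i)).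
  by have [] := composite_well_defined v.
pose Ep (v : borel V) := \int[mu]_z (EFin \o composite (fun i => v i))^\+ z.
pose En (v : borel V) := \int[mu]_z (EFin \o composite (fun i => v i))^\- z.
have mEp : measurable_fun setT Ep.
  rewrite (_ : Ep = superposition (fun t => Num.max t 0%R)); last first.
    by apply/funext => v; apply: eq_integral => z _; rewrite funeposE /= -EFin_max.
  apply: measurable_superposition => //.
  - by move=> t; rewrite le_max lexx orbT.
  - by move=> s t st; rewrite ge_max !le_max st lexx orbT.
  - exact: maxr0_contraction.
pose th := @negative_truncation R.
have th0 n t : (0 <= th n t)%R by exact: negative_truncation_ge0.
have thn n t : (th n t <= n%:R)%R by exact: negative_truncation_le.
have muf : mu setT \is a fin_num by rewrite ge0_fin_numE//; exact: product_measure_lty.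
have mS n : measurable_fun setT (superposition (th n) : borel V -> \bar R).
  apply: measurable_superposition => //.
  - exact: negative_truncation_homo.
  - exact: negative_truncation_contraction.
suff mEn : measurable_fun setT En.
  rewrite (_ : (fun v : borel V => _) = Ep \- En); last by apply/funext => v; exact: energyE.
  exact: emeasurable_funB mEp mEn.
apply: (emeasurable_fun_cvg (fun n (v : borel V) => n%:R%:E * mu setT - superposition (th n) v)).
  by move=> n; apply: emeasurable_funB => //.
move=> v _.
have mth_ n : measurable_fun setT (fun z => th n (composite (fun i => v i) z)).
  apply: measurable_maxr => //.
  by apply: measurable_funD => //; exact: measurable_minr.
have mth n : measurable_fun setT (fun z => (th n (composite (fun i => v i) z))%:E).
  by apply/measurable_EFinP; exact: mth_.
have E n : n%:R%:E * mu setT - superposition (th n) v =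
    \int[mu]_z (n%:R - th n (composite (fun i => v i) z))%:E.
  have thoo : \int[mu]_z (th n (composite (fun i => v i) z))%:E < +oo.
    apply: (@le_lt_trans _ _ (\int[mu]_z (cst n%:R%:E z))).
      by apply: ge0_le_integral => // z _; rewrite lee_fin.
    by rewrite integral_cst// lte_mul_pinfty ?lee_fin// ltey_eq muf.
  rewrite -integral_cst// /superposition.
  have th0' z : 0 <= (th n (composite (fun i => v i) z))%:E by rewrite lee_fin.
  have n0' (z : Om * Rd) : 0 <= (cst n%:R%:E : Om * Rd -> \bar R) z by rewrite lee_fin.
  have mcst : measurable_fun setT (cst n%:R%:E : Om * Rd -> \bar R) by exact: measurable_cst.
  have EB := @ge0_integralB _ _ _ mu _ _ mcst (mth n) n0' th0' thoo.
  by apply: etrans (esym EB) _; apply: eq_integral => z _; rewrite EFinB.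
under eq_cvg do rewrite E.
apply: cvg_monotone_integral.
- by move=> n; apply/measurable_EFinP; apply: measurable_funB; [exact: measurable_cst|exact: mth_].
- by move=> n z; rewrite lee_fin subr_ge0.
- by move=> z a b ab; rewrite lee_fin; exact: negative_truncation_complement_homo.
- move=> z; rewrite funenegE /=; move: (composite _ z) => t; apply: cvg_near_cst.
  near=> n; have nt : (- t <= n%:R)%R by near: n; exact: nbhs_infty_ger.
  by rewrite negative_truncation_complement// EFin_max.
Unshelve. all: by end_near. Qed.

End energy.

(** * The metric space of states *)

Section ratio.
Context (R : realType).
Implicit Types s t : R.

Definition ratio t : R := t / (t + 1).

Lemma ratioE t : 0 <= t -> ratio t = 1 - (t + 1)^-1.
Proof.
move=> t0; have t1 : t + 1 != 0 by rewrite gt_eqF// ltr_wpDl.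
by rewrite /ratio -{1}[t](addrK 1) mulrBl mul1r mulfV.
Qed.

Lemma ratio_ge0 t : 0 <= t -> 0 <= ratio t.
Proof. by move=> t0; rewrite /ratio divr_ge0// addr_ge0. Qed.

Lemma ratio_le1 t : 0 <= t -> ratio t <= 1.
Proof. by move=> t0; rewrite ratioE// gerBl invr_ge0 addr_ge0. Qed.

Lemma ratio_lt s t : 0 <= s -> 0 <= t -> (ratio s < ratio t) = (s < t).
Proof.
move=> s0 t0; have s1 := ltr_wpDl s0 ltr01; have t1 := ltr_wpDl t0 ltr01.
by rewrite !ratioE// ltrD2l ltrN2 ltf_pV2// ltrD2r.
Qed.

Lemma ratio_le s t : 0 <= s -> 0 <= t -> s <= t -> ratio s <= ratio t.
Proof. by move=> s0 t0; rewrite !leNgt ratio_lt. Qed.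

Lemma ratio_add s t : 0 <= s -> 0 <= t -> ratio (s + t) <= ratio s + ratio t.
Proof.
move=> s0 t0; rewrite {1}/ratio mulrDl; apply: lerD; rewrite /ratio.
  by rewrite ler_wpM2l// lef_pV2 ?posrE ?ltr_wpDl ?addr_ge0// -addrA lerD2l lerDr.
by rewrite ler_wpM2l// lef_pV2 ?posrE ?ltr_wpDl ?addr_ge0// lerD2r lerDr.
Qed.

End ratio.

Section state_metric.
Context (R : realType) (X : Type) (D : set (X -> R)) (phi : nat -> D) (m : nat).
Local Notation M := (stateM_of m phi).
Local Notation dist := (@stateM_dist R X D phi m).
Implicit Types U V W : Lin D.

Definition Lin_term U V (j : nat) : R := 2^-1 ^+ j * ratio `|U (phi j) - V (phi j)|.

Lemma Lin_term_ge0 U V j : 0 <= Lin_term U V j.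
Proof. by rewrite mulr_ge0// ?ratio_ge0// exprn_ge0. Qed.

Lemma Lin_term_cvg U V : cvgn (series (Lin_term U V)).
Proof.
apply: (@series_le_cvg _ _ (geometric 1 2^-1)) => [j|j|j|].
- exact: Lin_term_ge0.
- by rewrite /= mul1r exprn_ge0.
- by rewrite /= mul1r ler_piMr// ?exprn_ge0// ratio_le1.
- by apply: is_cvg_geometric_series; rewrite ger0_norm// invf_lt1// ltr1n.
Qed.

Lemma Lin_distE U V : Lin_dist phi U V = limn (series (Lin_term U V)).
Proof. by []. Qed.

Lemma Lin_dist_cvg U V : series (Lin_term U V) n @[n --> \oo] --> Lin_dist phi U V.
Proof. exact: Lin_term_cvg. Qed.

Lemma Lin_dist_ge0 U V : 0 <= Lin_dist phi U V.
Proof.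
apply: limr_ge; first exact: Lin_term_cvg.
by apply: nearW => n; apply: sumr_ge0 => j _; exact: Lin_term_ge0.
Qed.

Lemma Lin_distC U V : Lin_dist phi U V = Lin_dist phi V U.
Proof.
by rewrite !Lin_distE (_ : Lin_term U V = Lin_term V U)//; apply/funext => j;
  rewrite /Lin_term distrC.
Qed.

Lemma Lin_distxx U : Lin_dist phi U U = 0.
Proof.
apply/cvg_lim => //; rewrite (_ : series _ = cst 0); first exact: cvg_cst.
by apply/funext => n; apply: big1 => j _; rewrite subrr normr0 mul0r mulr0.
Qed.

Lemma Lin_dist_triangle U V W : Lin_dist phi U W <= Lin_dist phi U V + Lin_dist phi V W.
Proof.
apply: (ler_cvg_to (@Lin_dist_cvg U W) (cvgD (@Lin_dist_cvg U V) (@Lin_dist_cvg V W))).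
apply: nearW => n; rewrite /series /= fctE -big_split /=; apply: ler_sum => j _.
rewrite -mulrDr ler_wpM2l ?exprn_ge0//.
apply: le_trans (ratio_add _ _) => //; apply: ratio_le => //.
exact: ler_distD.
Qed.

Lemma Lin_term_le U V j : Lin_term U V j <= Lin_dist phi U V.
Proof.
apply: limr_ge; first exact: Lin_term_cvg.
exists j.+1 => // n /= jn; rewrite /series /= (bigD1_seq j) ?iota_uniq//=; last first.
  by rewrite mem_index_iota.
by rewrite lerDl sumr_ge0// => i _; exact: Lin_term_ge0.
Qed.

Lemma Lin_dist_coordinate j (r : R) : 0 < r ->
  exists2 s : R, 0 < s & forall U V, Lin_dist phi U V < s -> `|U (phi j) - V (phi j)| < r.
Proof.
(* The j-th term alone is at most the distance, and [ratio] is strictly increasing on nonnegative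
   reals. *)
move=> r0; exists (2^-1 ^+ j * ratio r).
  by rewrite mulr_gt0 ?exprn_gt0// divr_gt0// addr_gt0.
move=> U V /(le_lt_trans (Lin_term_le U V j)).
by rewrite ltr_pM2l ?exprn_gt0// ratio_lt// ltW.
Qed.

Lemma LinV_dist_ge0 (U V : LinV D m) : 0 <= LinV_dist phi U V.
Proof. by apply: sumr_ge0 => i _; exact: Lin_dist_ge0. Qed.

Lemma LinV_distC (U V : LinV D m) : LinV_dist phi U V = LinV_dist phi V U.
Proof. by apply: eq_bigr => i _; exact: Lin_distC. Qed.

Lemma LinV_dist_triangle (U V W : LinV D m) :
  LinV_dist phi U W <= LinV_dist phi U V + LinV_dist phi V W.
Proof.
by rewrite /LinV_dist -big_split; apply: ler_sum => i _; exact: Lin_dist_triangle.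
Qed.

Lemma stateM_dist_ge0 (s t : M) : 0 <= dist s t.
Proof. by rewrite !addr_ge0// LinV_dist_ge0. Qed.

Lemma stateM_distC (s t : M) : dist s t = dist t s.
Proof.
by rewrite /stateM_dist LinV_distC; congr (_ + _ + _); exact: distrC.
Qed.

Lemma stateM_distxx (s : M) : dist s s = 0.
Proof.
rewrite /stateM_dist !subrr normr0 !addr0; apply: big1 => i _; exact: Lin_distxx.
Qed.

Lemma stateM_dist_triangle (s t r : M) : dist s r <= dist s t + dist t r.
Proof.
rewrite /stateM_dist; have := LinV_dist_triangle (st_lin s) (st_lin t) (st_lin r).
have := ler_distD (st_eps t)%:num (st_eps s)%:num (st_eps r)%:num.
have := ler_distD (st_norm t)%:num (st_norm s)%:num (st_norm r)%:num.
move: (LinV_dist _ _ _) (LinV_dist _ _ _) (LinV_dist _ _ _) => a b c.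
by move: `|_| `|_| `|_| `|_| `|_| `|_| => *; lra.
Qed.

Lemma st_lin_dist (s t : M) : LinV_dist phi (st_lin s) (st_lin t) <= dist s t.
Proof. by rewrite /stateM_dist -addrA lerDl addr_ge0. Qed.

Lemma st_eps_dist (s t : M) : `|(st_eps s)%:num - (st_eps t)%:num| <= dist s t.
Proof.
rewrite /stateM_dist; have := LinV_dist_ge0 (st_lin s) (st_lin t).
have := normr_ge0 ((st_norm s)%:num - (st_norm t)%:num).
by move: (LinV_dist _ _ _) `|_| `|_| => *; lra.
Qed.

Lemma st_norm_dist (s t : M) : `|(st_norm s)%:num - (st_norm t)%:num| <= dist s t.
Proof. by rewrite /stateM_dist lerDr addr_ge0// LinV_dist_ge0. Qed.

Lemma Lin_st_dist (s t : M) i : Lin_dist phi (st_lin s i) (st_lin t i) <= dist s t.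
Proof.
apply: le_trans (st_lin_dist s t); rewrite /LinV_dist (bigD1 i)//= lerDl.
by apply: sumr_ge0 => j _; exact: Lin_dist_ge0.
Qed.

Lemma state_ball_nbhs (xi : M) (r : R) : 0 < r -> nbhs xi [set eta : M | dist xi eta < r].
Proof.
move=> r0; rewrite nbhsE; exists [set eta : M | dist xi eta < r] => //; split => /=.
  move=> x /= xr; have s0 : 0 < r - dist xi x by rewrite subr_gt0.
  exists (PosNum s0) => y /= xy; apply: le_lt_trans (stateM_dist_triangle xi x y) _.
  by rewrite -ltrBrDl.
by rewrite /= stateM_distxx.
Qed.

Lemma state_continuous_measurable (f : M -> R) :
  (forall xi r, 0 < r -> exists2 s, 0 < s &
     forall eta, dist xi eta < s -> `|f xi - f eta| < r) ->
  measurable_fun setT (f : borel M -> R).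
Proof.
move=> cf; apply: (measurability _ (RGenOInfty.measurableE R)) => _ [_ [t ->] <-].
rewrite setTI; apply: sub_sigma_algebra.
suff : dist_open dist (f @^-1` `]t, +oo[) by [].
move=> xi /=; rewrite in_itv /= andbT => tx.
have [s s0 hs] := cf xi (f xi - t) ltac:(by rewrite subr_gt0).
exists (PosNum s0) => eta /= /hs; rewrite in_itv /= andbT ltr_norml => /andP[_].
by lra.
Qed.

Lemma measurable_st_coordinate i j :
  measurable_fun setT (fun xi : borel M => st_lin xi i (phi j)).
Proof.
apply: state_continuous_measurable => xi r /(Lin_dist_coordinate j)[s s0 hs].
by exists s => // eta; move/(le_lt_trans (Lin_st_dist _ _ i)); exact: hs.
Qed.

Lemma measurable_st_eps : measurable_fun setT (fun xi : borel M => (st_eps xi)%:num).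
Proof.
apply: state_continuous_measurable => xi r r0; exists r => // eta.
exact/le_lt_trans/st_eps_dist.
Qed.

Lemma measurable_st_norm : measurable_fun setT (fun xi : borel M => (st_norm xi)%:num).
Proof.
apply: state_continuous_measurable => xi r r0; exists r => // eta.
exact/le_lt_trans/st_norm_dist.
Qed.

Lemma measurable_st_lin :
  measurable_fun setT (fun xi : borel M => st_lin xi : borel (LinV_of m phi)).
Proof.
have E : @measurable _ (borel (LinV_of m phi)) = <<s @open (LinV_of m phi) >> by [].
apply: (measurability _ E) => _ [A oA <-]; rewrite setTI.
apply: sub_sigma_algebra.
suff : dist_open dist ((fun xi : M => st_lin xi) @^-1` A) by [].
move=> xi /(oA (st_lin xi))[r hr]; exists r => eta /= h; apply: hr.
exact: le_lt_trans (st_lin_dist xi eta) h.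
Qed.

Section measurable_distance.
Context (dO : measure_display) (Om : measurableType dO) (s : Om -> M).
Hypotheses (ms_lin : forall i j, measurable_fun setT (fun w => st_lin (s w) i (phi j)))
  (ms_eps : measurable_fun setT (fun w => (st_eps (s w))%:num))
  (ms_norm : measurable_fun setT (fun w => (st_norm (s w))%:num)).

Let mdiff (f : Om -> R) (g : M -> R) : measurable_fun setT f ->
  measurable_fun setT (g : borel M -> R) ->
  measurable_fun setT (fun z : Om * borel M => `|f z.1 - g z.2|).
Proof.
move=> mf mg; apply: measurableT_comp => //; apply: measurable_funB.
  exact: measurableT_comp mf measurable_fst.
exact: measurableT_comp mg measurable_snd.
Qed.

(** Joint measurability for the product sigma-algebra: the distance is a limit of finite sums of
    functions of |f(w) - g(xi)|. Only the coordinates of [s] have to be measurable, not [s] as a map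
    into the Borel space. *)
Lemma measurable_stateM_dist :
  measurable_fun setT (fun z : Om * borel M => dist (s z.1) z.2).
Proof.
apply: measurable_funD; first apply: measurable_funD.
- apply: measurable_sum => i.
  apply: (measurable_fun_cvg (h := fun n (z : Om * borel M) =>
     series (Lin_term (st_lin (s z.1) i) (st_lin z.2 i)) n)).
    move=> n; rewrite /series /=; apply: measurable_sum => j.
    apply: measurable_funM => //.
    have mt := mdiff (ms_lin i j) (measurable_st_coordinate i j).
    (* [ratio] is monotone only on nonnegative reals; the cut-off at 0 makes it monotone everywhere,
       hence measurable. *)
    have -> : (fun z : Om * borel M => ratio `|st_lin (s z.1) i (phi j) - st_lin z.2 i (phi j)|)
      = (fun t => ratio (Num.max t 0)) \o
        (fun z => `|st_lin (s z.1) i (phi j) - st_lin z.2 i (phi j)|).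
      by apply/funext => z /=; rewrite max_l.
    apply: measurableT_comp mt; apply: nondecreasing_measurable => // a b ab.
    have max0 t : 0 <= Num.max t 0 :> R by rewrite le_max lexx orbT.
    by apply: ratio_le => //; rewrite ge_max max0 le_max ab.
  by move=> z _; exact: Lin_dist_cvg.
- exact: mdiff ms_eps measurable_st_eps.
- exact: mdiff ms_norm measurable_st_norm.
Qed.

End measurable_distance.
End state_metric.

(** * Lower semicontinuous envelopes along a sequence of states *)

Section regularization.
Context (R : realType) (X : Type) (D : set (X -> R)) (phi : nat -> D) (m : nat)
  (dO : measure_display) (Om : measurableType dO).
Local Notation M := (stateM_of m phi).
Local Notation dist := (@stateM_dist R X D phi m).
Context (a : nat -> Om -> \bar R) (s : nat -> Om -> M).
Local Open Scope ereal_scope.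

(* As a supremum of infima of Lipschitz functions, this is a normal integrand.
   It is at most [a k w] at [s k w], and at a limit point of [s ^~ w] it
   dominates the lower limit of [a ^~ w] along the corresponding subsequence. *)
Definition lsc_envelope (z : Om * borel M) : \bar R :=
  ereal_sup (range (fun n : nat => ereal_inf (range (fun k =>
    a k z.1 + (n%:R * dist (s k z.1) z.2)%:E)))).

Hypothesis a0 : forall k w, 0 <= a k w.

Let term_ge0 n k w xi : 0 <= a k w + (n%:R * dist (s k w) xi)%:E.
Proof. by rewrite adde_ge0// lee_fin mulr_ge0// stateM_dist_ge0. Qed.

Lemma lsc_envelope_ge0 z : 0 <= lsc_envelope z.
Proof.
apply: (@le_trans _ _ (ereal_inf (range (fun k => a k z.1 + (0%:R * dist (s k z.1) z.2)%:E)))).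
  by apply: le_ereal_inf_tmp => _ [k _ <-]; exact: term_ge0.
by apply: ereal_sup_ubound; exists 0%N.
Qed.

Lemma lsc_envelope_le k w : lsc_envelope (w, s k w) <= a k w.
Proof.
apply: ge_ereal_sup => _ [n _ <-]; apply: ereal_inf_lbound; exists k => //=.
by rewrite stateM_distxx mulr0 adde0.
Qed.

(** Both summands are nonnegative, so a bound on their sum bounds each. As n grows, the second bound
    forces the chosen states towards xi at rate 1/n. *)
Lemma lsc_envelope_lt w xi (L : R) : lsc_envelope (w, xi) < L%:E ->
  forall n : nat, exists k, a k w <= L%:E /\ (n%:R * dist (s k w) xi < L)%R.
Proof.
move=> HL n.
have : ereal_inf (range (fun k => a k w + (n%:R * dist (s k w) xi)%:E)) < L%:E.
  by apply: le_lt_trans HL; apply: ereal_sup_ubound; exists n.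
move=> /ereal_inf_lt[_ [k _ <-] kL]; exists k; split.
  by apply: le_trans (ltW kL); rewrite leeDl// lee_fin mulr_ge0// stateM_dist_ge0.
by rewrite -lte_fin; apply: le_lt_trans kL; rewrite leeDr.
Qed.

Lemma lsc_envelope_lsc w : lower_semicontinuous (fun xi : M => lsc_envelope (w, xi)).
Proof.
move=> xi b /ereal_sup_gt[_ [n _ <-] bn].
have [c bc cn] := ereal_between bn; rewrite lte_fin in bc.
(* The n-th infimum is n-Lipschitz, so within distance r it loses at most half of c - b; n + 1
   avoids dividing by 0. *)
pose r := ((c - b) / (2 * (n%:R + 1)))%R.
have n1 : (0 < n%:R + 1 :> R)%R by rewrite ltr_wpDl.
have r0 : (0 < r)%R by rewrite divr_gt0 ?subr_gt0// mulr_gt0.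
have nr : (n%:R * r <= (c - b) / 2)%R.
  have : (r * (n%:R + 1) = (c - b) / 2)%R by rewrite /r invfM mulrA divfK// gt_eqF.
  by move: r r0 => {n1}r r0; lra.
exists [set eta : M | (dist xi eta < r)%R]; first exact: state_ball_nbhs.
move=> eta /= xr; apply: (@lt_le_trans _ _ ((b + c) / 2)%:E); first by rewrite lte_fin; lra.
apply: le_trans (ereal_sup_ubound _); last by exists n.
apply: le_ereal_inf_tmp => _ [k _ <-] /=.
have : c%:E <= a k w + (n%:R * dist (s k w) xi)%:E.
  by apply: le_trans (ltW cn) _; apply: ereal_inf_lbound; exists k.
have : (n%:R * dist (s k w) xi <= n%:R * dist (s k w) eta + n%:R * r)%R.
  rewrite -mulrDr ler_wpM2l//; apply: le_trans (stateM_dist_triangle _ eta _) _.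
  by rewrite lerD2l stateM_distC ltW.
case: (a k w) (a0 k w) => [t _|_|//]; last by move=> _ _; rewrite addye// leey.
rewrite -!EFinD !lee_fin; move: (n%:R * dist _ xi)%R (n%:R * dist _ eta)%R => x y.
by move=> xy ctx; lra.
Qed.

Hypotheses (ma : forall k, measurable_fun setT (a k))
  (ms_lin : forall k i j, measurable_fun setT (fun w => st_lin (s k w) i (phi j)))
  (ms_eps : forall k, measurable_fun setT (fun w => (st_eps (s k w))%:num))
  (ms_norm : forall k, measurable_fun setT (fun w => (st_norm (s k w))%:num)).

Lemma lsc_envelope_measurable : measurable_fun setT lsc_envelope.
Proof.
(* A supremum or infimum over a range is the tail supremum or infimum from index 0, a form for which
   measurability is inherited. *)
have E : lsc_envelope = (fun z => esups (fun n => einfs (fun k =>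
   a k z.1 + (n%:R * dist (s k z.1) z.2)%:E) 0%N) 0%N).
  have drop0 (v : nat -> \bar R) : sdrop v 0%N = range v.
    by apply/seteqP; split => _ [k _ <-]; exists k.
  have sup0 (v : nat -> \bar R) : esups v 0%N = ereal_sup (range v) by rewrite -drop0.
  have inf0 (v : nat -> \bar R) : einfs v 0%N = ereal_inf (range v) by rewrite -drop0.
  apply/funext => z; rewrite sup0 /lsc_envelope; congr ereal_sup.
  by congr image; apply/funext => n; rewrite inf0.
rewrite E; apply: measurable_fun_esups => n; apply: measurable_fun_einfs => k.
apply: emeasurable_funD.
  exact: measurableT_comp (ma k) measurable_fst.
apply/measurable_EFinP; apply: measurable_funM => //.
exact: measurable_stateM_dist (ms_lin k) (ms_eps k) (ms_norm k).
Qed.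

End regularization.

(** * Uniform integrability *)

Section truncation.
Context d (T : measurableType d) (R : realType) (P : probability T R).
Local Open Scope ereal_scope.

Lemma uniformly_integrable_tail (f : nat -> T -> \bar R) (r : R) :
  uniformly_integrable P f -> (0 < r)%R ->
  exists2 c : R, (0 <= c)%R &
    forall k, \int[P]_(w in [set w | c%:E < `|f k w|]) `|f k w| <= r%:E.
Proof.
move=> [_ fc] r0.
set S := fun c : R => ereal_sup _ in fc.
have : \forall c \near +oo%R, S c < r%:E.
  have N : nbhs (0 : \bar R) [set x | x < r%:E].
    by apply: open_nbhs_nbhs; split; [exact: open_ereal_lt_ereal|rewrite /= lte_fin].
  exact: fc _ N.
(* [HM] holds strictly above M, hence the added 1. *)
move=> [M [_ HM]]; exists (Num.max 0 (M + 1))%R; first by rewrite le_max lexx.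
move=> k; apply/ltW/(le_lt_trans _ (HM (Num.max 0 (M + 1))%R _)); last first.
  by rewrite lt_max ltrDl ltr01 orbT.
by apply: ereal_sup_ubound; exists k.
Qed.

Lemma tail_integral_lty (f : T -> \bar R) (c r : R) : measurable_fun setT f ->
  (0 <= c)%R -> \int[P]_(w in [set w | c%:E < `|f w|]) `|f w| <= r%:E ->
  \int[P]_w `|f w| < +oo.
Proof.
move=> mf c0 fr.
have mf' : measurable_fun setT (abse \o f) by exact: measurableT_comp.
have mD : measurable [set w | c%:E < `|f w|].
  by have := mf' measurableT _ (emeasurable_itv (`]c%:E, +oo[)); rewrite setTI preimage_itvoy.
have E : \int[P]_w `|f w| <= \int[P]_w (cst c%:E w + ((abse \o f) \_ [set w | c%:E < `|f w|]) w).
  apply: ge0_le_integral => //.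
  - apply: emeasurable_funD => //; apply/(measurable_restrictT _ mD).1.
    exact: measurable_funTS.
  move=> w _; rewrite /patch; case: ifPn => wD; first by rewrite leeDr ?lee_fin.
  by rewrite adde0 leNgt; apply: contra wD => ?; rewrite inE.
apply: (le_lt_trans E); rewrite ge0_integralD//.
- rewrite integral_cst// -integral_mkcond; apply: lte_add_pinfty.
    by rewrite lte_mul_pinfty ?lee_fin// ltey_eq fin_num_measure.
  exact: le_lt_trans fr (ltry _).
- by move=> w _; apply: erestrict_ge0 => x _ /=.
- by apply/(measurable_restrictT _ mD).1; exact: measurable_funTS.
Qed.

(** Since A >= 0, the negative part of A - B + c is at most (B - c)^+, hence at most B on the set
    where B > c. So passing to the positive part costs only the tail of B. *)
Lemma integral_positive_part (A B : T -> \bar R) (c : R) :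
  measurable_fun setT A -> measurable_fun setT B ->
  (forall w, 0 <= A w) -> (forall w, 0 <= B w) -> (0 <= c)%R ->
  \int[P]_w B w < +oo ->
  \int[P]_w maxe (A w - B w + c%:E) 0 <=
  \int[P]_w (A w - B w) + c%:E + \int[P]_(w in [set w | c%:E < B w]) B w.
Proof.
move=> mA mB A0 B0 c0 Boo.
have mD : measurable [set w | c%:E < B w].
  by have := mB measurableT _ (emeasurable_itv (`]c%:E, +oo[)); rewrite setTI preimage_itvoy.
set D := [set w | c%:E < B w] in mD *.
have mBD : measurable_fun setT (B \_ D).
  by apply/(measurable_restrictT _ mD).1; exact: measurable_funTS.
have BD0 w : 0 <= (B \_ D) w by exact: erestrict_ge0.
have mM : measurable_fun setT (fun w => maxe (A w - B w + c%:E) 0).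
  apply: measurable_maxe => //; apply: emeasurable_funD => //.
  exact: emeasurable_funB.
have Bfin : \int[P]_w B w \is a fin_num by rewrite ge0_fin_numE// integral_ge0.
(* The finite integral of B is added to both sides, which leaves integrals of nonnegative functions;
   that of A may be infinite. *)
rewrite ge0_integralB// -(leeD2rE _ _ Bfin) -ge0_integralD//; last first.
  by move=> w _; rewrite le_max lexx orbT.
have -> : \int[P]_w A w - \int[P]_w B w + c%:E + \int[P]_(w in D) B w + \int[P]_w B w =
    \int[P]_w (A w + (cst c%:E w + (B \_ D) w)).
  rewrite ge0_integralD//; last 2 first.
  - by move=> w _; rewrite adde_ge0// lee_fin.
  - exact: emeasurable_funD.
  have Ec : \int[P]_w cst c%:E w = c%:E.
    by rewrite integral_cst//; apply: etrans (congr1 _ (probability_setT P)) _; rewrite mule1.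
  rewrite ge0_integralD// Ec -integral_mkcond.
  move: (\int[P]_w B w) Bfin (\int[P]_(w in D) B w) => b bfin t.
  by rewrite -!addeA (addeCA (- b) c%:E) (addeCA (- b) t) [- b + b]addeC subee// adde0.
apply: ae_le_integral.
- exact: emeasurable_funD.
- by apply: emeasurable_funD => //; exact: emeasurable_funD.
have iB : P.-integrable setT B.
  by apply/integrableP; split => //; under eq_integral => w _ do rewrite gee0_abs//.
apply: filterS (integrable_ae measurableT iB) => w /(_ I).
have wD : (w \in D) = (c%:E < B w) by apply/idP/idP; rewrite inE.
rewrite /patch wD {wD}; move: (A0 w) (B0 w).
case: (A w) => [a| |] //; case: (B w) => [b| |] // a0 b0 _.
- rewrite -EFinB -!EFinD lte_fin -EFin_max; case: ltP => cb; rewrite -!EFinD lee_fin.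
    rewrite !lee_fin in a0 b0.
    by rewrite /Num.max; case: ifPn; rewrite -?leNgt; lra.
  rewrite !lee_fin in a0 b0.
  by rewrite /Num.max; case: ifPn; rewrite -?leNgt; lra.
- by rewrite !addye// ?leey//; case: ifP.
Qed.

End truncation.

(** * The energy at cluster points *)

Lemma to_LinE (R : realType) (X : Type) (D : set (X -> R)) (U : D -> R) :
  linear_on U -> to_Lin U = U :> (D -> R).
Proof. by rewrite /to_Lin; case: pselect. Qed.

Lemma pairing_linear_on dT (T : measurableType dT) (R : realType)
    (m : {measure set T -> \bar R}) (X : Type) (D : set (X -> R)) (u : T -> R)
    (tr : T -> X) :
  m.-integrable setT (EFin \o u) ->
  (forall f, D f -> measurable_fun setT (f \o tr) /\
                    exists M : R, forall x, `|f (tr x)| <= M) ->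
  linear_on (fun f : D => fine (\int[m]_x (u x * val f (tr x))%:E)%E).
Proof.
move=> iu hD a b f g k kE.
have iD (f' : D) : m.-integrable setT (fun x => (u x * val f' (tr x))%:E).
  have [mf [M hM]] := hD _ (set_mem (valP f')).
  exact: (integrable_mul_bounded iu mf hM).
have -> : (\int[m]_x (u x * val k (tr x))%:E)%E = (a%:E * (\int[m]_x (u x * val f (tr x))%:E)
    + b%:E * (\int[m]_x (u x * val g (tr x))%:E))%E.
  rewrite -!integralZl// -integralD//; try exact: integrableZl.
  by apply: eq_integral => x _; rewrite kE -!EFinM -EFinD; congr EFin; lra.
have fin (f' : D) : (\int[m]_x (u x * val f' (tr x))%:E)%E \is a fin_num.
  exact: integrable_fin_num.
by rewrite fineD ?fin_numM// !fineM.
Qed.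

Section Hoelder_pairing.
Context dT (T : measurableType dT) (R : realType) (m : {measure set T -> \bar R}).
Local Open Scope ereal_scope.

Lemma le_pairing_Lnorm (p : R) (u g : T -> R) : (1 < p)%R ->
  measurable_fun setT u -> measurable_fun setT g ->
  `|\int[m]_x (u x * g x)%:E| <= 'N[m]_p%:E[EFin \o u] * 'N[m]_(conjugate p)%:E[EFin \o g].
Proof.
move=> p1 mu_ mg.
have mug : measurable_fun setT (fun x => (u x * g x)%:E).
  by apply/measurable_EFinP; exact: measurable_funM.
have p0 : (0 < p)%R by exact: lt_trans p1.
apply: le_trans (le_abse_integral m measurableT mug) _.
have := hoelder m mu_ mg p0 (conjugate_gt0 p1) (conjugate_inv p1).
by rewrite Lnorm1.
Qed.

Lemma Lnorm_bounded_lty (q : R) (f : T -> R) (M : R) : (1 < q)%R ->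
  m setT < +oo -> measurable_fun setT f -> (forall x, (`|f x| <= M)%R) ->
  'N[m]_q%:E[EFin \o f] < +oo.
Proof.
move=> q1 moo mf fM; have q0 : (0 < q)%R by exact: lt_trans q1.
apply: (@le_lt_trans _ _ ('N[m]_q%:E[EFin \o cst M])).
  by apply: le_Lnorm => // x; apply: le_trans (fM x) (ler_norm _).
rewrite unlock /Lnorm/= poweR_lty// integral_cst// lte_mul_pinfty ?poweR_ge0//.
Qed.

End Hoelder_pairing.

Lemma conjugate_gt1 (R : realType) (p : R) : 1 < p -> 1 < conjugate p.
Proof. by move=> p1; rewrite ltr_pdivlMr ?subr_gt0// mul1r gtrBl. Qed.

Section pointwise.
Context (R : realType) (dO : measure_display) (Om : measurableType dO)
  (P : probability Om R) (d : nat) (tau : 'rV[R]_d -> Om -> Om)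
  (p : R) (hp : 1 < p) (Q : set 'rV[R]_d) (oQ : open Q) (bQ : bounded_set Q)
  (DO : set (Om -> R)) (DQ : set ('rV[R]_d -> R)) (Om0 : set Om)
  (phi : nat -> testD DO DQ).
Local Notation Rd := (lebesgueRd R d).
Local Notation leb := (@lebesgue R d).
Local Notation lam := (lebesgue_on oQ).
Local Notation mu := (P \x lam)%E.
Hypotheses (htau : ergodic_dynamical_system P tau) (hDO : test_Omega P DO)
  (hDQ : test_Q oQ DQ) (hgood : good_set P tau p oQ DO DQ Om0)
  (hphi : normalized_enumeration P p oQ phi).
Local Open Scope ereal_scope.

(** Integrability of [U i] makes the pairing finite and linear in the test function, so neither
    [fine] nor [to_Lin] falls back on its default value. *)
Lemma J_E (c : R) w m (U : 'I_m -> Rd -> R) i f : (0 < c)%R ->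
  lam.-integrable setT (EFin \o U i) ->
  (@J _ _ _ _ tau Q DO DQ c w m U i f)%:E =
  \int[lam]_x (U i x * val f (shear tau c^-1 (w, x)))%:E.
Proof.
move=> c0 iU; rewrite /J; have c0' : (0 < c^-1)%R by rewrite invr_gt0.
have E : (fun f : testD DO DQ => fine (\int[leb]_(x in Q) (U i x * Tstar tau c (val f) (w, x))%:E))
    = (fun f => fine (\int[lam]_x (U i x * val f (shear tau c^-1 (w, x)))%:E)).
  by apply/funext => g; rewrite integral_lebesgue_on.
have lin := pairing_linear_on iU (fun g Dg => testD_section bQ htau hDO hDQ w c0' Dg).
rewrite E (to_LinE lin).
have [mf [M hM]] := testD_section bQ htau hDO hDQ w c0' (set_mem (valP f)).
exact: fineK (integrable_fin_num measurableT (integrable_mul_bounded iU mf hM)).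
Qed.

Lemma J0_E m (v : 'I_m -> LfunType mu (exponent_ge1 hp)) i f :
  (@J0 _ _ _ P d Q DO DQ m (fun i => v i) i f)%:E = \int[mu]_z (v i z * val f z)%:E.
Proof.
rewrite /J0.
have iv : mu.-integrable setT (EFin \o v i) by apply: Lp_integrable; exact: product_measure_lty.
have hD g : testD DO DQ g -> measurable_fun setT (g : Om * Rd -> R) /\
    exists M : R, forall z, (`|g z| <= M)%R.
  move=> Dg; split; first by have := testD_measurable hDO hDQ Dg.
    by have := testD_bounded bQ hDO hDQ Dg.
have ivf (g : testD DO DQ) : mu.-integrable setT (fun z => (v i z * val g z)%:E).
  have [mg [M hM]] := hD _ (set_mem (valP g)).
  exact: (integrable_mul_bounded iv mg hM).
have E : (fun f : testD DO DQ => fine (\int[P]_w \int[leb]_(x in Q) (v i (w, x) * val f (w, x))%:E))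
    = (fun f => fine (\int[mu]_z (v i z * val f z)%:E)).
  by apply/funext => g; rewrite -(integral_Om_Q (ivf g)).
rewrite E to_LinE ?fineK//; first exact: integrable_fin_num.
exact: (pairing_linear_on (tr := id) iv).
Qed.

(** A test function that is null on Omega x Q may still be nonzero along the realization at a given
    w. [good_norm] with the conjugate exponent makes these realizations small in the limit. *)
Lemma Lnorm_Tstar_cvg0 f w (e : nat -> {posnum R}) : testA DO DQ f -> Om0 w ->
  vanishing e -> 'N[mu]_(conjugate p)%:E[EFin \o f] = 0 ->
  'N[lam]_(conjugate p)%:E[EFin \o (fun x => Tstar tau (e k)%:num f (w, x))]
    @[k --> \oo] --> 0.
Proof.
move=> Af Ow e0 Nf.
set N := fun c : R => 'N[lam]_(conjugate p)%:E[EFin \o (fun x => Tstar tau c f (w, x))].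
suff HN (r : R) : (0 < r)%R -> \forall k \near \oo, N (e k)%:num < r%:E.
  have fN : \forall k \near \oo, N (e k)%:num \is a fin_num.
    apply: filterS (HN 1%R ltr01) => k; rewrite ge0_fin_numE ?Lnorm_ge0// => /lt_trans; apply.
    exact: ltry.
  apply/fine_cvgP; split => //; apply/cvgrPdist_lt => r r0.
  apply: filterS2 fN (HN r r0) => k fk kr; rewrite sub0r normrN ger0_norm ?fine_ge0 ?Lnorm_ge0//.
  by rewrite -lte_fin fineK.
move=> r0; have : limf_esup N 0^'+ < r%:E.
  apply: le_lt_trans (good_norm hgood Af Ow (or_intror erefl)) _.
  by rewrite Nf lte_fin.
move=> /ereal_inf_lt[_ [A A0 <-] Ar].
have H : \forall k \near \oo, A (e k)%:num := vanishing_right e0 A0.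
apply: filterS H => k Ak; apply: le_lt_trans Ar; apply: ereal_sup_ubound.
by exists (e k)%:num.
Qed.

(* A test function is a multiple of some [phi j] or vanishes in L^q(Omega * Q),
   in which case [good_norm] applies. *)
Lemma two_scale_cvg_phi m (w : Om) (e : nat -> {posnum R})
    (u : nat -> 'I_m -> LfunType lam (exponent_ge1 hp))
    (v : 'I_m -> LfunType mu (exponent_ge1 hp)) :
  Om0 w -> vanishing e -> vbounded lam p (fun k i => u k i) ->
  (forall i j, @J _ _ _ _ tau Q DO DQ (e k)%:num w m (fun i => u k i) i (phi j) @[k --> \oo] -->
     @J0 _ _ _ P d Q DO DQ m (fun i => v i) i (phi j)) ->
  two_scale_cvg tau DO DQ e w u v.
Proof.
move=> Ow e0 bu uv; apply: two_scale_cvg_testA => // i f Af.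
have Df := testA_testD Af.
have mf : measurable_fun setT f by have := testA_measurable hDO hDQ Af.
have iu k : lam.-integrable setT (EFin \o u k i).
  by apply: Lp_integrable; exact: lebesgue_on_lty.
have mu_ k j : measurable_fun setT (u k j : Rd -> R) by exact: measurable_funP.
have [M hM] := testA_bounded bQ hDO hDQ Af.
have Nfin : 'N[mu]_(conjugate p)%:E[EFin \o f] \is a fin_num.
  rewrite ge0_fin_numE ?Lnorm_ge0//.
  exact: Lnorm_bounded_lty (conjugate_gt1 hp) (product_measure_lty P oQ bQ) mf hM.
have [N0|N0] := eqVneq ('N[mu]_(conjugate p)%:E[EFin \o f]) 0.
  have mv : measurable_fun setT (v i : Om * Rd -> R) by exact: measurable_funP.
  have -> : \int[mu]_z (v i z * f z)%:E = 0.
    apply/eqP; rewrite -abse_eq0 eq_le abse_ge0 andbT.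
    by apply: le_trans (le_pairing_Lnorm mu hp mv mf) _; rewrite N0 mule0.
  have [C hC] := bu.
  apply/cvg_abse0P.
  apply: (@squeeze_cvge _ _ _ _ (cst 0) _ (fun k => `|C|%:E *
     'N[lam]_(conjugate p)%:E[EFin \o (fun x => Tstar tau (e k)%:num f (w, x))])).
  - apply: nearW => k; rewrite abse_ge0 /=.
    have ek : (0 < (e k)%:num^-1 :> R)%R by rewrite invr_gt0.
    have [mfk _] := testD_section bQ htau hDO hDQ w ek Df.
    apply: le_trans (le_pairing_Lnorm lam hp (mu_ k i) mfk) _.
    apply: lee_pmul => //; rewrite ?Lnorm_ge0//.
    apply: le_trans (Lnorm_le_vnorm lam hp i (mu_ k)) _.
    by apply: le_trans (hC k) _; rewrite lee_fin ler_norm.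
  - exact: cvg_cst.
  - rewrite -[X in _ --> X](mule0 `|C|%:E); apply: cvgeZl => //.
    exact: Lnorm_Tstar_cvg0.
set N : R := fine 'N[mu]_(conjugate p)%:E[EFin \o f].
have N0' : (N != 0)%R by rewrite fine_eq0.
have Dg : testD DO DQ (fun z => f z / N)%R.
  exists 1%N, (fun=> N^-1)%R, (fun=> f); split => //.
  by apply/funext => z; rewrite big_ord1 mulrC.
(* f lies in the rational span, with the single coefficient 1, so f divided by its norm is one of
   the [phi j]. *)
have [_ /(_ _)[|j _ gj]] := hphi (SigSub (mem_set Dg)).
  exists f; last by split.
  exists 1%N, (fun=> 1%R), (fun=> f); split => //.
  by apply/funext => z; rewrite big_ord1 rmorph1 mul1r.
have fE z : f z = (N * val (phi j) z)%R by rewrite gj /= mulrC divfK.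
have iv : mu.-integrable setT (EFin \o v i) by apply: Lp_integrable; exact: product_measure_lty.
have Dj := set_mem (valP (phi j)).
have E0 : \int[mu]_z (v i z * f z)%:E =
    N%:E * (@J0 _ _ _ P d Q DO DQ m (fun i => v i) i (phi j))%:E.
  have [B hB] := testD_bounded bQ hDO hDQ Dj.
  have ivj := integrable_mul_bounded iv (testD_measurable hDO hDQ Dj) hB.
  rewrite J0_E -(integralZl measurableT ivj); apply: eq_integral => z _.
  by rewrite fE -EFinM; congr EFin; rewrite mulrCA.
have Ek k : \int[lam]_x (u k i x * f (shear tau (e k)%:num^-1 (w, x)))%:E =
    N%:E * (@J _ _ _ _ tau Q DO DQ (e k)%:num w m (fun i => u k i) i (phi j))%:E.
  have ek : (0 < (e k)%:num^-1 :> R)%R by rewrite invr_gt0.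
  have [mfk [B hB]] := testD_section bQ htau hDO hDQ w ek Dj.
  have iuj := integrable_mul_bounded (iu k) mfk hB.
  rewrite J_E// -(integralZl measurableT iuj); apply: eq_integral => x _.
  by rewrite fE -EFinM; congr EFin; rewrite mulrCA.
rewrite E0 (_ : (fun k : nat => _) = (fun k => N%:E *
  (@J _ _ _ _ tau Q DO DQ (e k)%:num w m (fun i => u k i) i (phi j))%:E)); last exact/funext.
apply: cvgeZl => //; apply/fine_cvgP; split; first exact: nearW.
exact: uv.
Qed.

End pointwise.

Section cluster_bound.
Context (R : realType) (dO : measure_display) (Om : measurableType dO)
  (P : probability Om R) (d : nat) (tau : 'rV[R]_d -> Om -> Om)
  (p : R) (hp : 1 < p) (Q : set 'rV[R]_d) (oQ : open Q) (bQ : bounded_set Q)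
  (DO : set (Om -> R)) (DQ : set ('rV[R]_d -> R)) (Om0 : set Om)
  (phi : nat -> testD DO DQ) (e : nat -> {posnum R})
  (h : Om -> 'rV[R]_d -> 'rV[R]_d -> R)
  (u : nat -> 'I_d -> LfunType (P \x lebesgue_on oQ)%E (exponent_ge1 hp)).
Local Notation Rd := (lebesgueRd R d).
Local Notation leb := (@lebesgue R d).
Local Notation lam := (lebesgue_on oQ).
Local Notation mu := (P \x lam)%E.
Hypotheses (htau : ergodic_dynamical_system P tau) (hDO : test_Omega P DO)
  (hDQ : test_Q oQ DQ) (hgood : good_set P tau p oQ DO DQ Om0)
  (hphi : normalized_enumeration P p oQ phi) (e0 : vanishing e).
Local Open Scope ereal_scope.
Local Notation s := (@state R dO Om P d tau p hp Q oQ DO DQ Om0 phi d e u).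
Local Notation dist := (@stateM_dist R (Om * Rd) (testD DO DQ) phi d).

Definition quenched_energy k w : \bar R := \int[leb]_(x in Q)
  (h (tau ((e k)%:num^-1 *: x)%R w) x (field_value (fun i => u k i) (w, x)))%:E.

Lemma stateE k w : Om0 w ->
  s k w = MkState (@J _ _ _ _ tau Q DO DQ (e k)%:num w d (fun i x => u k i (w, x)))
            (widen_itv (e k))
            (NngNum (fine_ge0 (vnorm_ge0 lam p (fun i x => u k i (w, x))))).
Proof. by rewrite /state; case: pselect. Qed.

(** The scale coordinate of the states is [e k], which tends to 0. Consequently states approaching
    xi have vanishing scales, whatever their indices. *)
Lemma cluster_eps w (xi : stateM_of d phi) : Om0 w ->
  cluster (s ^~ w @ \oo) xi -> (st_eps xi)%:num = 0%R.
Proof.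
move=> Ow cl; apply/eqP; rewrite eq_le [X in _ && X]ge0 andbT leNgt; apply/negP => xi0.
set r := ((st_eps xi)%:num / 2)%R.
have r0 : (0 < r)%R by rewrite divr_gt0.
have A0 : (s ^~ w @ \oo) [set eta | (st_eps eta)%:num < r]%R.
  have /cvgrPdist_lt/(_ r r0) H := e0.
  suff : \forall k \near \oo, ((st_eps (s k w))%:num < r)%R by [].
  by apply: filterS H => k; rewrite stateE//= sub0r normrN ger0_norm.
have [eta [/= er xr]] := cl _ _ A0 (state_ball_nbhs xi r0).
have := le_lt_trans (st_eps_dist xi eta) xr.
by rewrite ltr_norml /r in er * => /andP[_]; lra.
Qed.

(** Each coordinate of the state supplies one ingredient of two-scale convergence: the scales
    vanish, the norms stay bounded, and the pairings with every [phi j] converge to those of v. The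
    cluster property enters through [cluster_eps]. *)
Lemma energy_le_cluster w (xi : stateM_of d phi) (v : weakLp mu hp d) (L : R) (l : \bar R) :
  Om0 w -> (forall k, vnorm lam p (fun i x => u k i (w, x)) < +oo) ->
  (forall (e : nat -> {posnum R}) (u : nat -> 'I_d -> LfunType lam (exponent_ge1 hp))
          (v : 'I_d -> LfunType mu (exponent_ge1 hp)),
      vanishing e -> two_scale_cvg tau DO DQ e w u v ->
      two_scale_energy P Q h (fun i => v i) <=
      limn_einf (fun k => \int[leb]_(x in Q)
            (h (tau ((e k)%:num^-1 *: x)%R w) x
               (field_value (fun i => u k i) x))%:E)) ->
  cluster (s ^~ w @ \oo) xi -> st_lin xi = J0_weakLp phi v ->
  (forall n : nat, exists k, quenched_energy k w <= l /\ (n%:R * dist (s k w) xi < L)%R) ->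
  two_scale_energy P Q h (fun i => v i) <= l.
Proof.
move=> Ow uoo hlim cl xiv hk.
(* [hk] is used at n + 1 so that dividing gives the rate L / (n + 1). The indices [kk n] need not
   increase. *)
have /choice[kk hkk] : forall n : nat, exists k, quenched_energy k w <= l /\
    (dist (s k w) xi < L * harmonic n)%R.
  move=> n; have [k [kl kL]] := hk n.+1; exists k; split => //.
  by rewrite /harmonic /= ltr_pdivlMr// mulrC.
have L0 : (0 <= L)%R.
  by have [k [_ /ltW]] := hk 0%N; rewrite mul0r.
have d0 : (L * harmonic n)%R @[n --> \oo] --> (0 : R)%R.
  rewrite -[X in _ --> X](mulr0 L); apply: cvgM; first exact: cvg_cst.
  exact: cvg_harmonic.
have xi0 := cluster_eps Ow cl.
pose e' n := e (kk n).
have e'0 : vanishing e'.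
  apply: (squeeze_cvgr _ (cvg_cst 0%R) d0); apply: nearW => n; rewrite ge0/=.
  apply: le_trans (ltW (hkk n).2); apply: le_trans (st_eps_dist _ _).
  by rewrite stateE//= xi0 subr0 ler_norm.
have mu_ k i : measurable_fun setT (fun x : Rd => u k i (w, x)).
  by apply: measurable_fun_pair2; exact: measurable_funP.
have uL k i : (fun x : Rd => u k i (w, x)) \in Lfun lam p%:E.
  exact: (vnorm_Lfun hp (mu_ k) (uoo k)).
pose u' n i : LfunType lam (exponent_ge1 hp) := Lfun_Sub (exponent_ge1 hp) (uL (kk n) i).
have bu' : vbounded lam p (fun n i => u' n i).
  (* The norm coordinates differ from that of xi by less than L / (n + 1), which is at most L. *)
  exists ((st_norm xi)%:num + L)%R => n.
  rewrite -[leLHS]fineK ?lee_fin; last by rewrite ge0_fin_numE ?vnorm_ge0//; exact: uoo.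
  have := le_lt_trans (st_norm_dist _ _) (hkk n).2; rewrite stateE//= ltr_norml => /andP[_].
  rewrite ltrBlDl => /ltW/le_trans; apply; rewrite lerD2l.
  by rewrite /harmonic/= ler_piMr// invf_le1// ler1n.
have cJ i j : @J _ _ _ _ tau Q DO DQ (e' n)%:num w d (fun i => u' n i) i (phi j) @[n --> \oo]
    --> @J0 _ _ _ P d Q DO DQ d (fun i => v i) i (phi j).
  apply/cvgrPdist_lt => r /(Lin_dist_coordinate phi j)[q q0 hq].
  have /cvgrPdist_lt/(_ q q0) := d0; apply: filterS => n; rewrite sub0r normrN => nq.
  rewrite distrC; have -> : @J0 _ _ _ P d Q DO DQ d (fun i => v i) i = st_lin xi i by rewrite xiv.
  apply: hq.
  have := Lin_st_dist (s (kk n) w) xi i; rewrite stateE//= => /le_lt_trans; apply.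
  have := lt_trans (hkk n).2; rewrite stateE//; apply.
  exact: le_lt_trans (ler_norm _) nq.
have := hlim e' u' v e'0 (two_scale_cvg_phi bQ htau hDO hDQ hgood hphi Ow e'0 bu' cJ).
move=> /le_trans; apply.
rewrite limn_einf_lim; apply: lime_le; first exact: is_cvg_einfs.
apply: nearW => n; apply: le_trans (hkk n).1.
by apply: ereal_inf_lbound; exists n => /=.
Qed.

End cluster_bound.

(** * Young measures *)

Section unit_mass.
Context d (T : measurableType d) (R : realType) (m : {measure set T -> \bar R})
  (m1 : m setT = 1%E).

(** A copy of m carrying the structure of a probability, hence of a sigma-finite measure, as the
    layer cake formula requires. *)
Definition unit_mass of m setT = 1%E : set T -> \bar R := m.
HB.instance Definition _ := Measure.on (unit_mass m1).
HB.instance Definition _ := Measure_isProbability.Build _ _ _ (unit_mass m1) m1.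

End unit_mass.

(* The supremum of [f] over the fibre of [j] above [pi x] has the superlevel
   sets [pi^-1 (j {f > r})], so it has the same distribution as [f]. This needs
   neither injectivity of [j] nor measurability of its inverse. *)
Lemma le_integral_pushforward (dV dM dL : measure_display) (V : measurableType dV)
    (M : measurableType dM) (L : measurableType dL) (R : realType)
    (n : {measure set V -> \bar R}) (m : {measure set M -> \bar R})
    (j : V -> L) (pi : M -> L) (N : set M) (f : V -> \bar R) (F : M -> \bar R) :
  n setT = 1%E -> m setT = 1%E -> measurable_fun setT pi ->
  (forall B, measurable B -> measurable (j @` B) /\
     n B = m [set x | (j @` B) (pi x)]) ->
  measurable N -> m N = 0%E ->
  measurable_fun setT f -> (forall v, 0 <= f v)%E ->
  measurable_fun setT F -> (forall x, 0 <= F x)%E ->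
  (forall x v, ~ N x -> pi x = j v -> f v <= F x)%E ->
  (\int[n]_v f v <= \int[m]_x F x)%E.
Proof.
move=> n1 m1 mpi nm mN N0 mf f0 mF F0 fF.
pose n' : probability V R := unit_mass n1.
pose m' : probability M R := unit_mass m1.
(* The value 0 is always included, so that the supremum over an empty fibre is 0 and not -oo; it is
   harmless because f is nonnegative. *)
pose S x : set (\bar R) := [set r | r = 0%E \/ exists2 v, pi x = j v & r = f v].
pose g x := ereal_sup (S x).
have tail (r : R) : 0 <= r -> [set x | r%:E < g x]%E =
    [set x | (j @` [set v | r%:E < f v]%E) (pi x)].
  move=> r0; apply/seteqP; split => x /=.
    move=> /ereal_sup_gt[_ [->|[v xv ->]] rf]; first by rewrite lte_fin ltNge r0 in rf.
    by exists v.
  move=> [v rf vx]; apply: lt_le_trans rf _.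
  by apply: ereal_sup_ubound; right; exists v.
have tailN (r : R) : r < 0 -> [set x | r%:E < g x]%E = setT.
  move=> r0; apply/seteqP; split => // x _ /=.
  apply: (@lt_le_trans _ _ 0%E); first by rewrite lte_fin.
  by apply: ereal_sup_ubound; left.
have mtail (r : R) : measurable [set v | r%:E < f v]%E.
  by have := mf measurableT _ (emeasurable_itv (`]r%:E, +oo[)); rewrite setTI preimage_itvoy.
have mg : measurable_fun setT g.
  apply: (measurability _ (ErealGenOInfty.measurableE R)) => _ [_ [r ->] <-].
  rewrite setTI preimage_itvoy; have [r0|r0] := leP 0 r; last by rewrite tailN.
  rewrite tail//; have [mj _] := nm _ (mtail r).
  by have := mpi measurableT _ mj; rewrite setTI.
have g0 x : (0 <= g x)%E by apply: ereal_sup_ubound; left.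
have E : (\int[n']_v f v = \int[m']_x g x)%E.
  apply: le_integral_distribution => // r.
  have [r0|r0] := leP 0 r; first by rewrite tail//; exact: (nm _ (mtail r)).2.
  rewrite tailN// (_ : [set v | r%:E < f v]%E = setT).
    by apply: etrans n1 (esym m1).
  apply/seteqP; split => // v _ /=.
  by apply: lt_le_trans (f0 v); rewrite lte_fin.
rewrite [leLHS]E; apply: ae_le_integral => //.
exists N; split => // x /= /negP; rewrite -ltNge => /ereal_sup_gt[_ [->|[v xv ->]]].
  by rewrite ltNge F0.
by move=> h; apply: contrapT => /fF/(_ xv); rewrite leNgt h.
Qed.

Lemma limn_einf_homo (R : realType) (u v : nat -> \bar R) :
  (forall n, u n <= v n)%E -> (limn_einf u <= limn_einf v)%E.
Proof.
move=> uv; rewrite !limn_einf_lim; apply: lee_lim; try exact: is_cvg_einfs.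
apply: nearW => n; apply: le_ereal_inf_tmp => _ [k nk <-].
by apply: le_trans (uv k); apply: ereal_inf_lbound; exists k.
Qed.

Section integral_inequalities.
Context d (T : measurableType d) (R : realType) (m : {measure set T -> \bar R}).
Local Open Scope ereal_scope.

(** Monotonicity of a supremum over simple functions, available for arbitrary nonnegative functions.
    It is applied to H along the states, whose dependence on w is uncontrolled on a null set. *)
Lemma ge0_integral_homo (f g : T -> \bar R) : (forall x, 0 <= f x) ->
  (forall x, f x <= g x) -> \int[m]_x f x <= \int[m]_x g x.
Proof.
move=> f0 fg; have g0 x : 0 <= g x by exact: le_trans (fg x).
rewrite !ge0_integralTE//; apply: ge_ereal_sup => _ [s sf <-].
by apply: ereal_sup_ubound; exists s => // x; exact: le_trans (fg x).
Qed.

Lemma integral_shift (f : T -> \bar R) (c : R) : m setT = 1 -> (0 <= c)%R ->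
  measurable_fun setT f ->
  \int[m]_x f x + c%:E <= \int[m]_x maxe (f x + c%:E) 0.
Proof.
move=> m1 c0 mf.
have mg : measurable_fun setT (fun x => maxe (f x + c%:E) 0).
  by apply: measurable_maxe => //; exact: emeasurable_funD.
have Ec : \int[m]_x cst c%:E x = c%:E by rewrite integral_cst// m1 mule1.
rewrite -leeBrDr//; apply: (@le_trans _ _ (\int[m]_x (maxe (f x + c%:E) 0 - cst c%:E x))).
  apply: ae_le_integral => //; first exact: emeasurable_funB.
  by apply: aeW => x; rewrite leeBrDr//= le_max lexx.
rewrite ge0_integralB//; first by rewrite Ec.
- by move=> x; rewrite le_max lexx orbT.
- by rewrite Ec ltry.
Qed.

End integral_inequalities.

Section kernel_integral.
Context dX dY (X : measurableType dX) (Y : measurableType dY) (R : realType)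
  (P : probability X R) (k : R.-pker X ~> Y).
Local Open Scope ereal_scope.

Lemma measurable_kernel_integral (f : Y -> \bar R) : measurable_fun setT f ->
  measurable_fun setT (fun x => \int[k x]_y f y).
Proof.
move=> mf; under eq_fun do rewrite integralE.
apply: emeasurable_funB; apply: measurable_fun_integral_kernel => //.
- by move=> U mU; exact: measurable_kernel.
- exact: measurable_funepos.
- by move=> U mU; exact: measurable_kernel.
- exact: measurable_funeneg.
Qed.

(** The inner and the outer measure both have mass 1, so c passes through each integral unchanged,
    even where the integral of f is infinite. *)
Lemma kernel_integral_shift (f : Y -> \bar R) (c : R) : (0 <= c)%R ->
  measurable_fun setT f ->
  \int[P]_x \int[k x]_y f y + c%:E <= \int[P]_x \int[k x]_y maxe (f y + c%:E) 0.
Proof.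
move=> c0 mf; have mI := measurable_kernel_integral mf.
apply: le_trans (integral_shift (probability_setT P) c0 mI) _.
apply: ge0_integral_homo => x; first by rewrite le_max lexx orbT.
rewrite ge_max integral_shift// ?prob_kernel//=.
by apply: integral_ge0 => y _; rewrite le_max lexx orbT.
Qed.

End kernel_integral.

(** * Measurable dependence of the states on w *)

Section measurable_state.
Context (R : realType) (dO : measure_display) (Om : measurableType dO)
  (P : probability Om R) (d : nat) (tau : 'rV[R]_d -> Om -> Om)
  (p : R) (hp : 1 < p) (Q : set 'rV[R]_d) (oQ : open Q) (bQ : bounded_set Q)
  (DO : set (Om -> R)) (DQ : set ('rV[R]_d -> R)) (Om0 : set Om)
  (phi : nat -> testD DO DQ) (e : nat -> {posnum R})
  (u : nat -> 'I_d -> LfunType (P \x lebesgue_on oQ)%E (exponent_ge1 hp)).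
Local Notation Rd := (lebesgueRd R d).
Local Notation leb := (@lebesgue R d).
Local Notation lam := (lebesgue_on oQ).
Local Notation mu := (P \x lam)%E.
Hypotheses (htau : ergodic_dynamical_system P tau) (hDO : test_Omega P DO)
  (hDQ : test_Q oQ DQ).
Local Open Scope ereal_scope.
Local Notation s := (@state R dO Om P d tau p hp Q oQ DO DQ Om0 phi d e u).
Context (N : set Om) (mN : measurable N)
  (NOm0 : forall w, ~ N w -> Om0 w)
  (Nu : forall w, ~ N w -> forall k, vnorm lam p (fun i x => u k i (w, x)) < +oo).

(* On the null set where [u k (w, .)] is not in L^p, the state has junk entries
   that need not depend measurably on [w]. *)
Definition patched_state k w : stateM_of d phi :=
  if w \in N then @stateM0 _ _ (testD DO DQ) d else s k w.

Let mif (f g : Om -> R) : measurable_fun setT g ->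
  (forall w, ~ N w -> f w = g w) -> (forall w, N w -> f w = 0%R) -> measurable_fun setT f.
Proof.
move=> mg fg f0; rewrite (_ : f = g \_ (~` N)); last first.
  apply/funext => w; rewrite /patch; case: ifPn; rewrite ?(inE, notin_setE)/=.
    by move=> Nw; exact: fg.
  by move=> Nw; rewrite f0//; exact: contrapT.
apply/(measurable_restrictT _ (measurableC mN)).1; exact: measurable_funTS.
Qed.

Let msec k i w : measurable_fun setT (fun x : Rd => u k i (w, x)).
Proof. by apply: measurable_fun_pair2; exact: measurable_funP. Qed.

Lemma section_integrable w k i : ~ N w ->
  lam.-integrable setT (EFin \o (fun x : Rd => u k i (w, x))).
Proof.
move=> Nw; have uL := vnorm_Lfun hp (fun i => msec k i w) (Nu Nw k).
pose U : LfunType lam (exponent_ge1 hp) := Lfun_Sub (exponent_ge1 hp) (uL i).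
have lamoo : lam setT < +oo by exact: lebesgue_on_lty.
exact: (Lp_integrable lamoo U).
Qed.

Lemma measurable_patched_lin k i j :
  measurable_fun setT (fun w => st_lin (patched_state k w) i (phi j)).
Proof.
pose F z : R := (u k i z * val (phi j) (shear tau (e k)%:num^-1 z))%R.
have ek : (0 < (e k)%:num^-1 :> R)%R by rewrite invr_gt0.
have Dj := set_mem (valP (phi j)).
have iF : mu.-integrable setT (EFin \o F).
  have [M hM] := testD_bounded bQ hDO hDQ Dj.
  have iu : mu.-integrable setT (EFin \o u k i).
    by apply: Lp_integrable; exact: product_measure_lty.
  have mf := measurableT_comp (testD_measurable hDO hDQ Dj) (measurable_shear htau ek).
  exact: (integrable_mul_bounded iu mf (fun z => hM _)).
have mI := measurable_pairing iF.
apply: (mif (g := fun w => fine (\int[lam]_x (F (w, x))%:E))).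
- exact: measurableT_comp (fine_measurable measurableT) mI.
- move=> w Nw; rewrite /patched_state ifF; last by apply/negP; rewrite inE.
  rewrite (stateE _ _ _ _ _ (NOm0 Nw)) /=.
  have ek0 : (0 < (e k)%:num :> R)%R by [].
  have E := J_E (U := fun i x => u k i (w, x)) bQ htau hDO hDQ w (phi j)
    ek0 (section_integrable k i Nw).
  by rewrite /F -E.
- by move=> w Nw; rewrite /patched_state mem_set.
Qed.

Lemma measurable_patched_eps k :
  measurable_fun setT (fun w => (st_eps (patched_state k w))%:num).
Proof.
apply: (mif (g := cst (e k)%:num)) => //.
- move=> w Nw; rewrite /patched_state ifF; last by apply/negP; rewrite inE.
  by rewrite (stateE _ _ _ _ _ (NOm0 Nw)).
- by move=> w Nw; rewrite /patched_state mem_set.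
Qed.

Lemma measurable_patched_norm k :
  measurable_fun setT (fun w => (st_norm (patched_state k w))%:num).
Proof.
pose F z : \bar R := (euclid (fun i => u k i) z `^ p)%:E.
have mF : measurable_fun setT F.
  by apply: measurable_euclid => i; exact: measurable_funP.
have F0 z : 0 <= F z by rewrite lee_fin powR_ge0.
have mI : measurable_fun setT (fun w => \int[lam]_x F (w, x)).
  exact: (@measurable_fun_fubini_tonelli_F _ _ _ _ _ lam F mF F0).
apply: (mif (g := fun w => fine ((\int[lam]_x F (w, x)) `^ p^-1))).
- apply: measurableT_comp (fine_measurable measurableT) _.
  exact: measurableT_comp (measurable_poweR _) mI.
- move=> w Nw; rewrite /patched_state ifF; last by apply/negP; rewrite inE.
  by rewrite (stateE _ _ _ _ _ (NOm0 Nw)) /= vnorm_poweR.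
- by move=> w Nw; rewrite /patched_state mem_set.
Qed.

End measurable_state.

Lemma uniformly_integrable0 (R : realType) (dO : measure_display)
    (Om : measurableType dO) (P : probability Om R) (f : nat -> Om -> \bar R) :
  (forall k w, f k w = 0%E) -> uniformly_integrable P f.
Proof.
move=> f0; have -> : f = fun _ => cst 0%E.
  by apply/funext => k; apply/funext => w; exact: f0.
split; first by move=> k; exact: measurable_cst.
rewrite (_ : (fun c => _) = cst 0%E); first exact: cvg_cst.
apply/funext => c.
have I0 : (\int[P]_(w in [set w : Om | (c%:E < `|0|)%E]) `|0| = 0 :> \bar R)%E.
  by rewrite integral0_eq// abse0.
rewrite (_ : range _ = [set 0%E]); first exact: ereal_sup1.
apply/seteqP; split => [_ [k _ <-]|_ ->] /=; first exact: I0.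
by exists 0%N.
Qed.

Lemma open_complement_cluster (X : topologicalType) (F : set (set X)) : open (~` cluster F).
Proof.
rewrite openC clusterE; apply: closed_bigI => A _; exact: closed_closure.
Qed.

(** * From quenched bounds to averages over the Young measure *)

Section young_bound.
Context (R : realType) (dO : measure_display) (Om : measurableType dO)
  (P : probability Om R) (d : nat) (tau : 'rV[R]_d -> Om -> Om)
  (p : R) (hp : 1 < p) (Q : set 'rV[R]_d) (oQ : open Q) (bQ : bounded_set Q)
  (DO : set (Om -> R)) (DQ : set ('rV[R]_d -> R)) (Om0 : set Om)
  (phi : nat -> testD DO DQ) (e : nat -> {posnum R})
  (h : Om -> 'rV[R]_d -> 'rV[R]_d -> R)
  (u : nat -> 'I_d -> LfunType (P \x lebesgue_on oQ)%E (exponent_ge1 hp))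
  (nu : R.-pker Om ~> borel (weakLp (P \x lebesgue_on oQ)%E hp d)).
Local Notation Rd := (lebesgueRd R d).
Local Notation leb := (@lebesgue R d).
Local Notation lam := (lebesgue_on oQ).
Local Notation mu := (P \x lam)%E.
Hypotheses (htau : ergodic_dynamical_system P tau) (hDO : test_Omega P DO)
  (hDQ : test_Q oQ DQ) (hgood : good_set P tau p oQ DO DQ Om0)
  (hphi : normalized_enumeration P p oQ phi) (e0 : vanishing e)
  (hh : two_scale_normal_integrand P tau hp oQ DO DQ Om0 h)
  (hnu : generates_Young_measure tau Om0 phi e u nu)
  (mh : forall k, measurable_fun [set z : Om * Rd | Q z.2]
     (fun z => h (tau ((e k)%:num^-1 *: z.2) z.1) z.2
          (field_value (fun i => u k i) z))).
Local Open Scope ereal_scope.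
Local Notation s := (@state R dO Om P d tau p hp Q oQ DO DQ Om0 phi d e u).
Local Notation qenergy := (quenched_energy tau e h u).

(** By Tonelli the p-th power of the norm of the section has a finite mean, and there are countably
    many k. *)
Lemma vnorm_section_lty : {ae P, forall w, forall k,
  vnorm lam p (fun i x => u k i (w, x)) < +oo}.
Proof.
apply: ae_foralln => k.
pose F z : \bar R := (euclid (fun i => u k i) z `^ p)%:E.
have mF : measurable_fun setT F.
  by apply: measurable_euclid => i; exact: measurable_funP.
have F0 z : 0 <= F z by rewrite lee_fin powR_ge0.
have Foo : \int[mu]_z F z < +oo.
  by rewrite -(vnorm_lty_int mu hp); exact: vnorm_lty.
have mI : measurable_fun setT (fun w => \int[lam]_x F (w, x)).
  exact: (@measurable_fun_fubini_tonelli_F _ _ _ _ _ lam F mF F0).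
have I0 w : 0 <= \int[lam]_x F (w, x) by exact: integral_ge0.
have iI : P.-integrable setT (fun w => \int[lam]_x F (w, x)).
  apply/integrableP; split => //.
  have -> : \int[P]_w `|\int[lam]_x F (w, x)| = \int[P]_w \int[lam]_x F (w, x).
    by apply: eq_integral => w _; rewrite gee0_abs.
  by have <- := @fubini_tonelli1 _ _ _ _ _ P lam F mF F0.
apply: filterS (integrable_ae measurableT iI) => w /(_ I) fw.
by rewrite (vnorm_lty_int lam hp) -ge0_fin_numE//; exact: I0.
Qed.

Definition qintegrand k : Om * Rd -> \bar R :=
  (fun z => (h (tau ((e k)%:num^-1 *: z.2)%R z.1) z.2
          (field_value (fun i => u k i) z))%:E) \_ (@cylQ R dO Om d Q).

Lemma measurable_qintegrand k : measurable_fun setT (qintegrand k).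
Proof.
apply/(measurable_restrictT _ _).1; first exact: measurable_cylQ.
by apply/measurable_EFinP; exact: mh.
Qed.

Lemma quenched_energyE k w : qenergy k w =
  \int[lam]_x (qintegrand k)^\+ (w, x) - \int[lam]_x (qintegrand k)^\- (w, x).
Proof.
have -> : qenergy k w = \int[lam]_x qintegrand k (w, x).
  rewrite /quenched_energy -(integral_lebesgue_on oQ).
  apply: eq_integral => x; rewrite inE => xQ.
  by rewrite /qintegrand /patch mem_set.
rewrite [LHS]integralE; congr (_ - _); apply: eq_integral => x _.
  by rewrite !funeposE.
by rewrite !funenegE.
Qed.

Let mA k : measurable_fun setT (fun w => \int[lam]_x (qintegrand k)^\+ (w, x)).
Proof.
exact: (@measurable_fun_fubini_tonelli_F _ _ _ _ _ lam _
  (measurable_funepos (measurable_qintegrand k)) (funepos_ge0 _)).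
Qed.

Let mB k : measurable_fun setT (fun w => \int[lam]_x (qintegrand k)^\- (w, x)).
Proof.
exact: (@measurable_fun_fubini_tonelli_F _ _ _ _ _ lam _
  (measurable_funeneg (measurable_qintegrand k)) (funeneg_ge0 _)).
Qed.

Lemma measurable_quenched_energy k : measurable_fun setT (qenergy k).
Proof.
have -> : qenergy k = (fun w => \int[lam]_x (qintegrand k)^\+ (w, x) -
    \int[lam]_x (qintegrand k)^\- (w, x)).
  by apply/funext => w; exact: quenched_energyE.
exact: emeasurable_funB.
Qed.

(** Identifies the functions assumed uniformly integrable with the part subtracted in
    [quenched_energyE]. *)
Lemma quenched_negative_part k w :
  (- \int[leb]_(x in Q) (Num.min 0%R (h (tau ((e k)%:num^-1 *: x)%R w) x
           (field_value (fun i => u k i) (w, x))))%:E) =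
  \int[lam]_x (qintegrand k)^\- (w, x).
Proof.
set g := fun x => (Num.min 0%R (h (tau ((e k)%:num^-1 *: x)%R w) x
           (field_value (fun i => u k i) (w, x)))).
have -> : \int[leb]_(x in Q) (g x)%:E = \int[leb]_(x in Q) - (- g x)%:E.
  by apply: eq_integral => x _; rewrite -EFinN opprK.
rewrite integral_ge0N ?oppeK; last by move=> x _; rewrite lee_fin oppr_ge0 ge_min lexx.
rewrite -(integral_lebesgue_on oQ); apply: eq_integral => x; rewrite inE => xQ.
rewrite funenegE /qintegrand /patch mem_set// -EFinN -EFin_max /g; congr EFin.
by rewrite oppr_min oppr0 maxC.
Qed.

Lemma liminf_positive_part (c : R) : (0 <= c)%R ->
  \int[P]_w \int[nu w]_v maxe (two_scale_energy P Q h (fun i => v i) + c%:E) 0 <=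
  limn_einf (fun k => \int[P]_w maxe (qenergy k w + c%:E) 0).
Proof.
move=> c0; have [muY [c1 c2 c3]] := hnu.
have aeOm0 : {ae P, forall w, Om0 w}.
  exists (~` Om0); split => //; first exact: measurableC (good_measurable hgood).
  have := probability_setC P (good_measurable hgood).
  by move=> ->; rewrite (good_full hgood) subee.
(* One measurable null set collects all exceptional w; measurability of N is what allows states and
   integrand to be redefined on it. *)
have [N [mN PN0 NP]] := filterI aeOm0 (filterI (integrand_liminf hh)
  (filterI vnorm_section_lty (filterI c2 c3))).
have NG w : ~ N w -> _ := fun Nw => contrapT (fun H => Nw (NP w H)).
have NOm0 w : ~ N w -> Om0 w by move=> /NG[].
have Nu w : ~ N w -> forall k, vnorm lam p (fun i x => u k i (w, x)) < +oo.
  by move=> /NG[_ [_ []]].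
pose a k w : \bar R := maxe (qenergy k w + c%:E) 0.
have a0 k w : 0 <= a k w by rewrite le_max lexx orbT.
have ma k : measurable_fun setT (a k).
  apply: measurable_maxe => //; apply: emeasurable_funD => //.
  exact: measurable_quenched_energy.
pose s' := patched_state tau Om0 phi e u N.
have s'E k w : ~ N w -> s' k w = s k w.
  by move=> Nw; rewrite /s' /patched_state ifF//; apply/negP; rewrite inE.
have mEnv : measurable_fun setT (lsc_envelope a s').
  apply: lsc_envelope_measurable => //.
  - by move=> k i j; apply: measurable_patched_lin.
  - by move=> k; apply: measurable_patched_eps.
  - by move=> k; apply: measurable_patched_norm.
(* Clause (1) speaks of the original states, measurability is known for the patched ones. They agree
   off N, and setting H to 0 on N keeps it below [a k] along the original states everywhere. *)
pose H (z : Om * borel (stateM_of d phi)) : \bar R :=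
  (lsc_envelope a s' \_ [set z | ~ N z.1]) z.
have HN w xi : N w -> H (w, xi) = 0.
  by move=> Nw; rewrite /H /patch ifF//; apply/negP; rewrite inE.
have HNn w xi : ~ N w -> H (w, xi) = lsc_envelope a s' (w, xi).
  by move=> Nw; rewrite /H /patch mem_set.
have H0 z : 0 <= H z by apply: erestrict_ge0 => z' _; exact: lsc_envelope_ge0.
have mH : measurable_fun setT H.
  apply/(measurable_restrictT _ _).1; last exact: measurable_funTS.
  rewrite (_ : [set z | _] = (~` N) `*` setT); last by apply/seteqP; split => z //= [].
  by apply: measurableX => //; exact: measurableC.
have normH : normal_integrand H.
  split=> //.
    move=> w; have [Nw|Nw] := pselect (N w).
      by move=> xi b; rewrite HN// => b0; exists setT; [exact: filterT|move=> y _; rewrite HN].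
    have -> : (fun xi => H (w, xi)) = (fun xi => lsc_envelope a s' (w, xi)).
      by apply/funext => xi; rewrite HNn.
    exact: lsc_envelope_lsc.
  by move=> z; apply: lt_le_trans (H0 z).
have UH : uniformly_integrable P (fun k w => `|mine 0 (H (w, s k w))|).
  by apply: uniformly_integrable0 => k w; rewrite min_l ?abse0.
apply: (@le_trans _ _ (\int[P]_w \int[muY w]_xi H (w, xi))); last first.
  apply: le_trans (c1 H normH UH) _; apply: limn_einf_homo => k.
  apply: ge0_integral_homo => // w; have [Nw|Nw] := pselect (N w); first by rewrite HN//; exact: a0.
  by rewrite HNn// -s'E//; exact: lsc_envelope_le.
pose f (v : borel (weakLp mu hp d)) : \bar R :=
  maxe (two_scale_energy P Q h (fun i => v i) + c%:E) 0.
have mf : measurable_fun setT f.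
  have mE := measurable_energy bQ htau hDO hDQ hgood hh.
  have mEc := emeasurable_funD mE (measurable_cst c%:E).
  exact: (measurable_maxe mEc (measurable_cst 0)).
have f0 v : 0 <= f v by rewrite le_max lexx orbT.
apply: ae_le_integral.
- exact: measurable_kernel_integral.
- exact: (measurable_fun_integral_sfinite_kernel H muY H0 mH).
exists N; split => // w /= nle; apply: contrapT => Nw; apply: nle.
have [_ [hlim [_ [clw [jw nuw]]]]] := NG w Nw.
(* The kernels are compared through [J0_weakLp] and the first coordinate; by clause (2) the states
   that are not cluster points form a null set for [muY w]. *)
have PF := @le_integral_pushforward _ _ _ (borel (weakLp mu hp d)) (borel (stateM_of d phi))
   (borel (LinV_of d phi)) R (nu w) (muY w) (fun v => J0_weakLp phi v)
   (fun xi => st_lin xi) (~` cluster (s ^~ w @ \oo)) f (fun xi => H (w, xi)).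
apply: PF => //.
- exact: prob_kernel.
- exact: prob_kernel.
- exact: measurable_st_lin.
- by apply: sub_sigma_algebra; exact: open_complement_cluster.
- exact: measurableT_comp mH (measurable_pair1 w).
(* A real level L is placed strictly between the two values, so that the envelope bound yields
   states with finite energy bounds. *)
move=> xi v /contrapT cl xiv; rewrite leNgt; apply/negP => /ereal_between[L HL Lf].
rewrite HNn// in HL.
have L0 : (0 <= L)%R by rewrite -lee_fin; apply: le_trans (ltW HL); exact: lsc_envelope_ge0.
have := lsc_envelope_lt a0 HL => hk.
have : two_scale_energy P Q h (fun i => v i) <= (L - c)%:E.
  apply: (energy_le_cluster bQ htau hDO hDQ hgood hphi e0 (NOm0 _ Nw) (Nu _ Nw) _ cl xiv (L := L)).
    by move=> e' u' v' e'0 uv; have [] := hlim (NOm0 _ Nw) e' u' v' e'0 uv.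
  move=> n; have [k [aL dL]] := hk n; exists k; split; last by rewrite -s'E.
  by rewrite EFinB leeBrDr//; move: aL; rewrite ge_max => /andP[].
rewrite EFinB leeBrDr// => EL.
(* L < [f v] cannot come from the entry 0 of the maximum because L >= 0, nor from the energy by
   [EL]. *)
by move: Lf; rewrite /f lt_max !ltNge EL lee_fin L0.
Qed.

End young_bound.

Theorem lemma4p14 (R : realType) (dO : measure_display)
  (Om : measurableType dO) (P : probability Om R) (d : nat)
  (tau : 'rV[R]_d -> Om -> Om) (p : R) (hp : 1 < p)
  (Q : set 'rV[R]_d) (oQ : open Q) (bQ : bounded_set Q)
  (DO : set (Om -> R)) (DQ : set ('rV[R]_d -> R)) (Om0 : set Om)
  (phi : nat -> testD DO DQ)
  (e : nat -> {posnum R})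
  (h : Om -> 'rV[R]_d -> 'rV[R]_d -> R)
  (u : nat -> 'I_d -> LfunType (P \x lebesgue_on oQ)%E (exponent_ge1 hp))
  (nu : R.-pker Om ~> borel (weakLp (P \x lebesgue_on oQ)%E hp d)) :
  countably_generated Om ->
  ergodic_dynamical_system P tau ->
  test_Omega P DO ->
  test_Q oQ DQ ->
  good_set P tau p oQ DO DQ Om0 ->
  normalized_enumeration P p oQ phi ->
  vanishing e ->
  two_scale_normal_integrand P tau hp oQ DO DQ Om0 h ->
  vbounded (P \x lebesgue_on oQ)%E p (fun k i => u k i) ->
  generates_Young_measure tau Om0 phi e u nu ->
  (* implicit in the statement: the integrals of the compositions make sense *)
  (forall k, measurable_fun [set z : Om * lebesgueRd R d | Q z.2]
     (fun z => h (tau ((e k)%:num^-1 *: z.2) z.1) z.2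
          (field_value (fun i => u k i) z))) ->
  uniformly_integrable P (fun k w =>
    - \int[@lebesgue R d]_(x in Q)
        (Num.min 0 (h (tau ((e k)%:num^-1 *: x) w) x
           (field_value (fun i => u k i) (w, x))))%:E)%E ->
  (\int[P]_w \int[nu w]_v two_scale_energy P Q h (fun i => v i) <=
   limn_einf (fun k => \int[P]_w \int[@lebesgue R d]_(x in Q)
     (h (tau ((e k)%:num^-1 *: x) w) x
        (field_value (fun i => u k i) (w, x)))%:E))%E.
Proof.
move=> _ htau hDO hDQ hgood hphi e0 hh _ hnu mh UI.
set f := (fun (k : nat) (w : Om) => _) in UI.
pose B k w := (\int[lebesgue_on oQ]_x (qintegrand tau e h u k)^\- (w, x))%E.
have fB k w : f k w = B k w by exact: quenched_negative_part.
have B0 k w : (0 <= B k w)%E by apply: integral_ge0 => x _; exact: funeneg_ge0.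
have mE := measurable_energy bQ htau hDO hDQ hgood hh.
apply/lee_addgt0Pr => r r0.
(* The limit c -> oo is taken through the slack r: c is fixed so that the tails of the negative
   parts beyond c have mass at most r for every k. *)
have [c c0 hc] := uniformly_integrable_tail UI r0.
have mf k : measurable_fun setT (f k) by have [] := UI.
have fE k : f k = B k by apply/funext => w; exact: fB.
have mB k : measurable_fun setT (B k) by rewrite -fE.
have Boo k : (\int[P]_w B k w < +oo)%E.
  have := tail_integral_lty (mf k) c0 (hc k); congr (_ < _)%E.
  by apply: eq_integral => w _; rewrite fB gee0_abs.
have tailB k : (\int[P]_(w in [set w | c%:E < B k w]) B k w <= r%:E)%E.
  have := hc k; rewrite fE; congr (_ <= _)%E.
  rewrite (_ : [set w | (c%:E < `|B k w|)%E] = [set w | (c%:E < B k w)%E]).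
    by apply: eq_integral => w _; rewrite gee0_abs.
  by apply/seteqP; split => w /=; rewrite gee0_abs.
pose A k w := (\int[lebesgue_on oQ]_x (qintegrand tau e h u k)^\+ (w, x))%E.
have A0 k w : (0 <= A k w)%E by apply: integral_ge0 => x _; exact: funepos_ge0.
have mA k : measurable_fun setT (A k).
  exact: (@measurable_fun_fubini_tonelli_F _ _ _ _ _ (lebesgue_on oQ) _
    (measurable_funepos (measurable_qintegrand mh k)) (funepos_ge0 _)).
have EAB k w : quenched_energy tau e h u k w = (A k w - B k w)%E by exact: quenched_energyE.
(* The error c + r is the same for all k, so it passes through the lower limit. *)
have key k : (\int[P]_w maxe (quenched_energy tau e h u k w + c%:E) 0 <=
    (c + r)%:E + \int[P]_w quenched_energy tau e h u k w)%E.
  have -> : quenched_energy tau e h u k = (fun w => A k w - B k w)%E.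
    by apply/funext => w; exact: EAB.
  apply: le_trans (integral_positive_part (mA k) (mB k) (A0 k) (B0 k) c0 (Boo k)) _.
  by rewrite [leRHS]addeC EFinD addeA leeD2l.
have shift := kernel_integral_shift P nu c0 mE.
have bound := liminf_positive_part bQ htau hDO hDQ hgood hphi e0 hh hnu mh c0.
(* The shift c occurs on both ends of this chain and, being finite, cancels; only r remains. *)
have := le_trans shift (le_trans bound (limn_einf_homo key)).
set X := (\int[P]_x _)%E; rewrite limn_einf_shift//; set l := limn_einf _.
have -> : ((c + r)%:E + l = l + r%:E + c%:E)%E.
  by rewrite addeC [(c + r)%R]addrC EFinD addeA.
by rewrite leeD2rE.
Qed.
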